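(* Let $\alpha=\frac32$ and $\sigma\ge3$. Let $v$ be a solution on $[0,T]$ of $$\partial_t v+W_\varepsilon(v)\,\partial_x v+\frac{i}{\varepsilon}|D|^{3/2} v+\frac1\varepsilon\chi_\omega v=0,\qquad v(t=0)=v_0\in H^\sigma(\mathbb T),$$ and let $$\mathcal E_{\mathrm{cap}}(t)=\sum_{k=0}^{2}\|Z^k v(t)\|_{L^2}^2,\qquad Z=\varepsilon\partial_t .$$ Then $$\frac{d\mathcal E_{\mathrm{cap}}}{dt}\lesssim\mathcal E_{\mathrm{cap}} ,$$ with an implicit constant that is uniform in $\varepsilon$.
   Context: $\mathbb T=\mathbb R/2\pi\mathbb Z$; $H^s=H^s(\mathbb T)$ are the $L^2$-based Sobolev spaces of complex-valued functions; $|D|^\alpha$ is the Fourier multiplier with symbol $|\xi|^\alpha$. $\chi_\omega\in C^\infty(\mathbb T)$ is a fixed non-negative cut-off function supported on an interval $\omega\subset[0,2\pi)$. $\varepsilon\in(0,1)$ is a small parameter. The map $W$ is fixed and satisfies: for some large integer $N$, $W$ is continuous from $H^{s-N}$ to $H^s$ with $\|W(U)\|_{H^s}\lesssim\|\langle D\rangle^{-N}U\|_{H^s}$ for all $s$; $W(U)$ is a real-valued function; $W(U)=W(U^* )$, where $U^*$ is the complex conjugate of $U$; $W$ scales linearly, $W(\lambda U)=\lambda W(U)$ for $\lambda\in\mathbb R$; and $\partial_tW(U)=W(\partial_tU)$ for time-dependent $U$. One sets $W_\varepsilon(v):=\varepsilon^{-1}W(\varepsilon v)$. Conventions. A solution on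 $[0,T]$ is $v\in C([0,T];H^\sigma)$ satisfying the equation in the sense of distributions. Solutions are a priori bounded, so that $\|W_\varepsilon(v)\|_{L^\infty}\lesssim1$ and $\|\partial_xW_\varepsilon(v)\|_{L^\infty}\lesssim1$ uniformly in $\varepsilon$. Accordingly, $\frac{d\mathcal E}{dt}\lesssim\mathcal E$ means: for every $M>0$ there is a constant $C$, depending only on $M$, $\sigma$, $W$, $\chi_\omega$ (not on $\varepsilon$, $t$, $T$ or $v$), such that $\frac{d\mathcal E}{dt}\le C\mathcal E$ on $(0,T)$ for every solution with $\sup_{[0,T]}\|v(t)\|_{H^\sigma}\le M$. The time derivative is taken classically where it exists and otherwise in the sense of distributions. *)

(* Defs.v *)
From HB Require Import structures.
From mathcomp Require Import all_boot all_order all_algebra.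
From mathcomp Require Import complex.
From mathcomp Require Import all_classical all_reals all_analysis.

Set Implicit Arguments.
Unset Strict Implicit.
Unset Printing Implicit Defensive.

Import Order.TTheory GRing.Theory Num.Theory.
Import numFieldNormedType.Exports.
Local Open Scope ring_scope.
Local Open Scope classical_set_scope.

(* Conventions.
   - Functions on T = R/2piZ are functions R -> R[i], integrated over [0, 2pi].
   - A (periodic) distribution u on T is given by its Fourier coefficients
     u k = (2pi)^-1 <u, e^{-ikx}>, k in Z.  No growth condition is put in the
     type; membership in some H^s supplies it. A function f is identified with
     the distribution [fcoef f]. *)

Definition distr (R : realType) := int -> R[i].

Section Torus.
Context {R : realType}.
Implicit Types (u w : distr R) (f : R -> R[i]) (s x : R).

Let mu := @lebesgue_measure R.

Definition smooth (f : R -> R) : Prop :=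
  forall (n : nat) (x : R), derivable (derive1n n f) x 1.

Definition cis (x : R) : R[i] := (cos x +i* sin x)%C.

Definition cintegral (D : set R) f : R[i] :=
  ((\int[mu]_(x in D) complex.Re (f x)) +i*
   (\int[mu]_(x in D) complex.Im (f x)))%C.

Definition fcoef f : distr R := fun k =>
  ((2 * pi)^-1)%:C%C * cintegral `[0, 2 * pi] (fun x => f x * cis (- (k%:~R * x))).

(* \sum_(-n <= k <= n) u k e^{ikx} *)
Definition fpartial u (n : nat) (x : R) : R[i] :=
  \sum_(j < n.*2.+1) u (j%:Z - n%:Z) * cis ((j%:Z - n%:Z)%:~R * x).

(* The function with Fourier coefficients u. It is only meant for u in H^s with
   s > 1/2, where the Fourier series converges absolutely. *)
Definition fsum u (x : R) : R[i] :=
  ((limn (fun n => complex.Re (fpartial u n x))) +i*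
   (limn (fun n => complex.Im (fpartial u n x))))%C.

Definition dist_add u w : distr R := fun k => u k + w k.
Definition dist_sub u w : distr R := fun k => u k - w k.
Definition dist_scale (c : R[i]) u : distr R := fun k => c * u k.

(* Complex conjugation: the Fourier coefficients of the conjugate function. *)
Definition dist_conj u : distr R := fun k => ((u (- k))^*)%C.

Definition fmult (m : R -> R[i]) u : distr R := fun k => m k%:~R * u k.

Definition japanese (xi : R) : R := Num.sqrt (1 + xi ^+ 2).
Definition absD (alpha : R) := fmult (fun xi => (`|xi| `^ alpha)%:C%C).
Definition japD (alpha : R) := fmult (fun xi => (japanese xi `^ alpha)%:C%C).
Definition dx := fmult (fun xi => (0 +i* xi)%C).

Definition Hnorm (s : R) u : \bar R :=
  sqrte (\esum_(k in [set: int])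
           ((japanese k%:~R `^ s * ComplexField.Normc.normc (u k)) ^+ 2)%:E).

Definition inH (s : R) u : Prop := (Hnorm s u < +oo)%E.

Definition L2normsq f : \bar R :=
  (\int[mu]_(x in `[0%R, (2 * pi)%R])
     ((ComplexField.Normc.normc (f x) ^+ 2)%R)%:E)%E.

Definition inL2 f : Prop :=
  [/\ measurable_fun `[0, 2 * pi] (fun x => complex.Re (f x)),
      measurable_fun `[0, 2 * pi] (fun x => complex.Im (f x)) &
      (L2normsq f < +oo)%E].

Definition contH (s : R) (I : set R) (u : R -> distr R) : Prop :=
  (forall t, I t -> inH s (u t)) /\
  (forall t, I t -> forall e : R, 0 < e -> exists2 d : R, 0 < d &
     forall t', I t' -> `|t' - t| < d -> (Hnorm s (dist_sub (u t') (u t)) < e%:E)%E).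

Definition contL2 (I : set R) (z : R -> R -> R[i]) : Prop :=
  (forall t, I t -> inL2 (z t)) /\
  (forall t, I t -> forall e : R, 0 < e -> exists2 d : R, 0 < d &
     forall t', I t' -> `|t' - t| < d ->
       (L2normsq (fun x => (z t' x - z t x)%R) < e%:E)%E).

Definition has_deriv_H (s : R) (I : set R) (u w : R -> distr R) : Prop :=
  forall t, I t -> forall e : R, 0 < e -> exists2 d : R, 0 < d &
    forall h : R, h != 0 -> `|h| < d -> I (t + h) ->
      (Hnorm s (dist_sub (dist_scale (h^-1)%:C%C (dist_sub (u (t + h)) (u t))) (w t))%R
         < e%:E)%E.

Record smoothing (N : nat) (W : distr R -> distr R) : Prop := Smoothing {
  smoothing_cont : forall (s : R) u, inH (s - N%:R) u ->
    forall e : R, 0 < e -> exists2 d : R, 0 < d &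
      forall w, inH (s - N%:R) w -> (Hnorm (s - N%:R)%R (dist_sub w u) < d%:E)%E ->
        (Hnorm s (dist_sub (W w) (W u)) < e%:E)%E;
  smoothing_bound : forall s : R, exists2 K : R, 0 < K &
    forall u, inH (s - N%:R) u ->
      (Hnorm s (W u) <= K%:E * Hnorm s (japD (- N%:R)%R u))%E;
  smoothing_real : forall (s : R) u, inH s u -> dist_conj (W u) = W u;
  smoothing_conj : forall (s : R) u, inH s u -> W u = W (dist_conj u);
  smoothing_scale : forall (s : R) u (lam : R), inH s u ->
    W (dist_scale lam%:C%C u) = dist_scale lam%:C%C (W u);
  (* d/dt (W U) = W (dU/dt) for U of class C^1 in time on ]a, b[ *)
  smoothing_dt : forall (s a b : R) (U U' : R -> distr R),
    contH (s - N%:R) `]a, b[ U -> contH (s - N%:R) `]a, b[ U' ->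
    has_deriv_H (s - N%:R) `]a, b[ U U' ->
    has_deriv_H s `]a, b[ (fun t => W (U t)) (fun t => W (U' t)) }.

Definition Weps (W : distr R -> distr R) (eps : R) u : distr R :=
  dist_scale (eps^-1)%:C%C (W (dist_scale eps%:C%C u)).

Record cutoff (omega : interval R) (chi : R -> R) : Prop := Cutoff {
  cutoff_omega : [set` omega] `<=` `[0, 2 * pi[;
  cutoff_periodic : forall x, chi (x + 2 * pi) = chi x;
  cutoff_smooth : smooth chi;
  cutoff_ge0 : forall x, 0 <= chi x;
  cutoff_support : forall x, 0 <= x < 2 * pi -> x \notin omega -> chi x = 0 }.

(* phi in C_c^oo((0, T)) *)
Definition testfun (T : R) (phi : R -> R) : Prop :=
  smooth phi /\
  exists a b : R, [/\ 0 < a, b < T & forall t, ~~ (a <= t <= b) -> phi t = 0].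

(* d/dt u = w in D'((0, T); D'(T)): the distribution-valued identity
   \int phi w dt = - \int phi' u dt, read on each Fourier coefficient. *)
Definition weak_dt (T : R) (u w : R -> distr R) : Prop :=
  forall (phi : R -> R) (k : int), testfun T phi ->
    cintegral `[0, T] (fun t => (phi t)%:C%C * w t k) =
    - cintegral `[0, T] (fun t => (derive1 phi t)%:C%C * u t k).

(* W_eps(v) d_x v + (i/eps) |D|^alpha v + (1/eps) chi v, where both products are
   pointwise products of functions. *)
Definition spatial_part (alpha : R) (W : distr R -> distr R) (chi : R -> R)
    (eps : R) u : distr R :=
  dist_add (fcoef (fun x => fsum (Weps W eps u) x * fsum (dx u) x))
  (dist_add (dist_scale (0 +i* eps^-1)%C (absD alpha u))
        (dist_scale (eps^-1)%:C%C (fcoef (fun x => (chi x)%:C%C * fsum u x)))).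

Record solution (alpha : R) (W : distr R -> distr R) (chi : R -> R)
    (eps sigma T : R) (v0 : distr R) (v : R -> distr R) : Prop := Solution {
  solution_cont : contH sigma `[0, T] v;
  solution_init : v 0 = v0;
  solution_eq : weak_dt T v
    (fun t => dist_scale (-1) (spatial_part alpha W chi eps (v t))) }.

(* z k = (eps d/dt)^k v for k <= m, as elements of C([0, T]; L^2); the time
   derivatives are distributional.  The functions z k t are thereby determined
   up to a null set. *)
Definition Zpowers (m : nat) (eps T : R) (v : R -> distr R)
    (z : nat -> R -> R -> R[i]) : Prop :=
  [/\ forall k, (k <= m)%N -> contL2 `[0, T] (z k),
      forall t, 0 <= t <= T -> fcoef (z 0%N t) = v t &
      forall k, (k < m)%N ->
        weak_dt T (fun t => dist_scale eps%:C%C (fcoef (z k t)))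
                  (fun t => fcoef (z k.+1 t))].

Definition Ecap (z : nat -> R -> R -> R[i]) (t : R) : R :=
  \sum_(k < 3) fine (L2normsq (z k t)).

(* dE/dt <= C E on (0, T), in the sense of distributions and, moreover, pointwise
   wherever the classical derivative exists. *)
Definition dt_le (T C : R) (E : R -> R) : Prop :=
  (forall phi : R -> R, testfun T phi -> (forall t, 0 <= phi t) ->
     - (\int[mu]_(t in `[0, T]) (derive1 phi t * E t))
       <= C * \int[mu]_(t in `[0, T]) (phi t * E t)) /\
  (forall t, 0 < t < T -> derivable E t 1 -> derive1 E t <= C * E t).

End Torus.

(* Main.v *)
(* Write V_m = (eps d/dt)^m v. The equation expresses V_1 through v and, since W is
   additive (it commutes with d/dt along segments), V_1 and V_2 solve the same equation
   as v up to source terms F_1 = W(V_1) v_x and F_2 = W(V_2) v_x + 2 W(V_1) (V_1)_x. There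
   is no factor 1/eps in them. The sources are bounded in L^2 by the energy: the factors
   W(V_j) are smooth and v is bounded in H^3, while (V_1)_x is recovered elliptically from
   eps V_1' = V_2, because |D|^(3/2) V_1 equals i V_2 plus terms of order at most one in V_1,
   and one derivative is absorbed by 3/2 derivatives.

   For each of the three equations the L^2 estimate is uniform in eps: i |D|^(3/2) is skew,
   chi >= 0, and the transport term costs only the derivative of the real function W(v).
   As V_2 is merely in L^2, the estimate is performed on Fejer-truncated frequencies,
   where the commutators with the truncation either are bounded (transport) or vanish as
   the truncation is removed, at fixed eps (damping). *)

Require Import Defs.
From mathcomp Require Import all_boot all_order all_algebra.
From mathcomp Require Import complex.
From mathcomp Require Import all_classical all_reals all_analysis.
From mathcomp Require Import measurable_realfun.
From mathcomp Require Import ring lra zify.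

Set Implicit Arguments.
Unset Strict Implicit.
Unset Printing Implicit Defensive.

Import Order.TTheory GRing.Theory Num.Theory.
Import numFieldNormedType.Exports.
Local Open Scope ring_scope.
Local Open Scope classical_set_scope.

(** The regularity count shapes everything. The equation trades eps d/dt for 3/2 derivatives, so v
    in H^3 puts V_1 in H^(3/2) and V_2 in L^2, with nothing to spare at sigma = 3. Hence V_2 is
    differentiated in time only one Fourier coefficient at a time, W(v) (V_2)_x makes sense only
    through the duality of H^1 and H^(-1), and no classical derivative of the energy is available.

    For this reason V_1 and V_2 are introduced as explicit functions of v at a fixed time; that they
    are the time derivatives is proved afterwards. Products are absolutely convergent convolutions
    of coefficients.

    The sources must be linear in the energy norm. In W(V_1) (V_1)_x one factor is therefore bounded
    through M alone, by the H^(3/2) bound on V_1, and only the other one by the energy. Membership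
    of V_1 in H^(3/2) also legitimates the elliptic step: the norm of (V_1)_x that is absorbed there
    is finite beforehand. *)

Local Notation nc := (@ComplexField.Normc.normc _).

(** * Sums over the integers *)

Section RealSums.
Variable R : realType.
Implicit Types (f g : int -> R) (s t : seq int).

(* All sums over Z are handled through bounds on their finite partial sums. *)
Definition sumle f (B : R) := forall s, uniq s -> \sum_(k <- s) f k <= B.

Lemma sumle_ge0 f B : sumle f B -> 0 <= B.
Proof. by move=> /(_ [::] isT); rewrite big_nil. Qed.

Lemma sumle_le f g B : (forall k, f k <= g k) -> sumle g B -> sumle f B.
Proof. by move=> fg gB s us; apply: le_trans (gB s us); apply: ler_sum. Qed.

Lemma sumleW f B C : B <= C -> sumle f B -> sumle f C.
Proof. by move=> BC fB s /fB /le_trans; apply. Qed.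

Lemma sumleD f g B C : sumle f B -> sumle g C ->
  sumle (fun k => f k + g k) (B + C).
Proof. by move=> fB gC s us; rewrite big_split lerD ?fB ?gC. Qed.

Lemma sumleZ f B c : 0 <= c -> sumle f B -> sumle (fun k => c * f k) (c * B).
Proof. by move=> c0 fB s us; rewrite -mulr_sumr ler_wpM2l ?fB. Qed.

Lemma sumle_inj f B (h : int -> int) : injective h -> sumle f B ->
  sumle (fun k => f (h k)) B.
Proof. by move=> ih fB s us; rewrite -(big_map h xpredT f) fB ?map_inj_uniq. Qed.

Lemma subn_inj (k : int) : injective (fun j => k - j).
Proof. by move=> i j /addrI /oppr_inj. Qed.

Lemma subnl_inj (k : int) : injective (fun j => j - k).
Proof. by move=> i j /addIr. Qed.

Lemma sumle_term f B k : sumle f B -> f k <= B.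
Proof. by move=> /(_ [:: k] isT); rewrite big_seq1. Qed.

(** Cauchy-Schwarz with a termwise hypothesis, which avoids square roots of the weights. Young's
    inequality below uses it with b = g and c = g f^2. *)
Lemma sum_cs (I : Type) (s : seq I) (a b c : I -> R) :
  (forall i, 0 <= b i) -> (forall i, 0 <= c i) ->
  (forall i, a i ^+ 2 <= b i * c i) ->
  (\sum_(i <- s) a i) ^+ 2 <= (\sum_(i <- s) b i) * (\sum_(i <- s) c i).
Proof.
move=> b0 c0 abc; elim: s => [|i s IH].
  by rewrite !big_nil expr0n mulr0.
rewrite !big_cons; have := abc i; have := b0 i; have := c0 i; move: IH.
have : 0 <= \sum_(i <- s) b i by apply: sumr_ge0.
have : 0 <= \sum_(i <- s) c i by apply: sumr_ge0.
move: (a i) (b i) (c i) (\sum_(i <- s) a i) (\sum_(i <- s) b i)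
  (\sum_(i <- s) c i) => x y z X Y Z Z0 Y0 H z0 y0 h.
(* The cross term: x^2 <= y z and X^2 <= Y Z give (2 x X)^2 <= 4 (y Z)(z Y) <= (y Z + z Y)^2. *)
suff : 2 * (x * X) <= y * Z + z * Y by nra.
apply: (@le_trans _ _ `|2 * (x * X)|); first exact: ler_norm.
rewrite -(@ler_pXn2r _ 2) ?nnegrE ?addr_ge0 ?mulr_ge0 // real_normK ?num_real //.
have hh : x ^+ 2 * X ^+ 2 <= (y * z) * (Y * Z) by apply: ler_pM; rewrite ?sqr_ge0.
have : 0 <= (y * Z - z * Y) ^+ 2 by apply: sqr_ge0.
rewrite !exprMn; nra.
Qed.

Lemma sum_cs2 (I : Type) (s : seq I) (a b : I -> R) A B : 0 <= A -> 0 <= B ->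
  \sum_(i <- s) a i ^+ 2 <= A ^+ 2 -> \sum_(i <- s) b i ^+ 2 <= B ^+ 2 ->
  \sum_(i <- s) a i * b i <= A * B.
Proof.
move=> A0 B0 ha hb; apply: le_trans (ler_norm _) _.
rewrite -(@ler_pXn2r _ 2) ?nnegrE ?mulr_ge0 // real_normK ?num_real //.
apply: le_trans (@sum_cs _ s _ (fun i => a i ^+ 2) (fun i => b i ^+ 2) _ _ _) _.
- by move=> i; apply: sqr_ge0.
- by move=> i; apply: sqr_ge0.
- by move=> i; rewrite exprMn.
rewrite exprMn; apply: ler_pM => //; apply: sumr_ge0 => i _; exact: sqr_ge0.
Qed.

Lemma sumle_cs f g A B : 0 <= A -> 0 <= B ->
  sumle (fun k => f k ^+ 2) (A ^+ 2) -> sumle (fun k => g k ^+ 2) (B ^+ 2) ->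
  sumle (fun k => f k * g k) (A * B).
Proof. by move=> A0 B0 fA gB s us; apply: sum_cs2 => //; [exact: fA|exact: gB]. Qed.

Lemma sum_sqD (I : Type) (s : seq I) (a b : I -> R) A B : 0 <= A -> 0 <= B ->
  \sum_(i <- s) a i ^+ 2 <= A ^+ 2 -> \sum_(i <- s) b i ^+ 2 <= B ^+ 2 ->
  \sum_(i <- s) (a i + b i) ^+ 2 <= (A + B) ^+ 2.
Proof.
move=> A0 B0 ha hb; under eq_bigr do rewrite sqrrD.
rewrite !big_split /= sqrrD lerD // lerD //.
by rewrite -mulr2n lerMn2r; apply/orP; right; exact: sum_cs2.
Qed.

(** Young's inequality for l^1 and l^2: Cauchy-Schwarz with weight g bounds the squared inner sum by
    B times the sum of g f^2, and exchanging the sums produces the second factor B. *)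
Lemma young_finite f g A B s t : 0 <= A -> 
  (forall k, 0 <= g k) ->
  sumle g B -> sumle (fun k => f k ^+ 2) (A ^+ 2) -> uniq s -> uniq t ->
  \sum_(k <- s) (\sum_(j <- t) g (k - j) * f j) ^+ 2 <= (B * A) ^+ 2.
Proof.
move=> A0 g0 gB fA us ut.
have B0 := sumle_ge0 gB.
have h k : (\sum_(j <- t) g (k - j) * f j) ^+ 2 <=
    B * \sum_(j <- t) g (k - j) * f j ^+ 2.
  apply: le_trans (@sum_cs _ t _ (fun j => g (k - j))
    (fun j => g (k - j) * f j ^+ 2) _ _ _) _.
  - by move=> j.
  - by move=> j; rewrite mulr_ge0 ?sqr_ge0.
  - by move=> j; rewrite exprMn mulrA -expr2.
  rewrite ler_wpM2r ?sumr_ge0 // => [j _|]; first by rewrite mulr_ge0 ?sqr_ge0.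
  by apply: (sumle_inj (@subn_inj k) gB).
apply: le_trans (ler_sum _ (fun k _ => h k)) _.
rewrite -mulr_sumr exchange_big /= exprMn [B ^+ 2]expr2 -mulrA ler_wpM2l //.
apply: (@le_trans _ _ (\sum_(j <- t) B * f j ^+ 2)); last first.
  by rewrite -mulr_sumr ler_wpM2l // fA.
apply: ler_sum => j _; rewrite -mulr_suml ler_wpM2r ?sqr_ge0 //.
exact: (sumle_inj (@subnl_inj j) gB).
Qed.

(** A Fatou property for sums. It carries Young's inequality from truncated convolutions to
    [fconv]. *)
Lemma sumle_lim (F : nat -> int -> R) f B :
  (forall k, F n k @[n --> \oo] --> f k) -> (forall n, sumle (F n) B) -> sumle f B.
Proof.
move=> Ff FB s us.
have : \sum_(k <- s) F n k @[n --> \oo] --> \sum_(k <- s) f k.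
  elim: s {us} => [|k s IH].
    rewrite big_nil; under eq_fun do rewrite big_nil; exact: cvg_cst.
  rewrite big_cons; under eq_fun do rewrite big_cons; exact: cvgD.
by move/cvgr_to_le; apply; near=> n; exact: FB.
Unshelve. all: by end_near. Qed.

End RealSums.

(** The frequencies from -m to m in the order of [fpartial], locked so that simplification does not
    unroll the list. *)
Definition symr : nat -> seq int :=
  locked (fun m => [seq j%:Z - m%:Z | j <- iota 0 m.*2.+1]).

Lemma symrE m : symr m = [seq j%:Z - m%:Z | j <- iota 0 m.*2.+1].
Proof. by rewrite /symr -lock. Qed.

Lemma symr_uniq m : uniq (symr m).
Proof. by rewrite symrE map_inj_uniq ?iota_uniq // => i j /addIr []. Qed.

Lemma mem_symr m k : (k \in symr m) = (`|k| <= m)%N.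
Proof.
rewrite symrE; apply/mapP/idP => [[j]|km]; first by rewrite mem_iota => jm ->; lia.
exists (absz (k + m%:Z)%R).
  by rewrite mem_iota; move: k km; change (forall k : int, (absz k <= m)%N -> (0 <= absz (k + m%:Z)%R < 0 + m.*2.+1)%N) => k; lia.
by move: k km; change (forall k : int, (absz k <= m)%N -> k = (absz (k + m%:Z)%R)%:Z - m%:Z) => k; lia.
Qed.

Lemma sub_symr m n : (m <= n)%N -> {subset symr m <= symr n}.
Proof. by move=> mn k; rewrite !mem_symr => /leq_trans; apply. Qed.

Lemma seq_symr (s : seq int) : exists m, {subset s <= symr m}.
Proof.
elim: s => [|k s [m IH]]; first by exists 0%N.
exists (maxn `|k|%N m) => j; rewrite inE mem_symr => /orP[/eqP -> |/IH].
  by rewrite leq_max leqnn.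
by rewrite mem_symr leq_max => ->; rewrite orbT.
Qed.

Lemma symr_perm m : perm_eq (symr m.+1) [:: m.+1%:Z, - m.+1%:Z & symr m].
Proof.
apply: uniq_perm; first exact: symr_uniq.
  rewrite 2!cons_uniq symr_uniq !inE !mem_symr andbT negb_or.
  by apply/andP; split; [apply/andP; split|]; lia.
move=> k; rewrite !inE !mem_symr; move: k.
by change (forall k : int, (absz k <= m.+1)%N = [|| k == m.+1%:Z, k == - m.+1%:Z | (absz k <= m)%N]) => k; lia.
Qed.

Section RealSums2.
Variable R : realType.
Implicit Types (f g : int -> R) (s t : seq int).

Lemma ler_sum_sub f s t : (forall k, 0 <= f k) -> uniq s -> uniq t ->
  {subset s <= t} -> \sum_(k <- s) f k <= \sum_(k <- t) f k.
Proof.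
move=> f0 us ut st.
rewrite [leRHS](bigID (mem s) xpredT) /= -[leLHS]addr0 lerD ?sumr_ge0 //.
rewrite -[leRHS]big_filter [leLHS](@perm_big _ _ _ _ s [seq i <- t | i \in s]) //.
apply: uniq_perm => //; first exact: filter_uniq.
by move=> k; rewrite mem_filter; case: (boolP (k \in s)) => // /st ->.
Qed.

Lemma sumle_symr f B : (forall k, 0 <= f k) ->
  (forall m, \sum_(k <- symr m) f k <= B) -> sumle f B.
Proof.
move=> f0 fB s us; have [m sm] := seq_symr s.
exact: le_trans (ler_sum_sub f0 us (symr_uniq m) sm) (fB m).
Qed.

Lemma sumle_inv_sq : sumle (fun k : int => (1 + k%:~R ^+ 2)^-1 : R) 5.
Proof.
apply: sumle_symr => [k|m]; first by rewrite invr_ge0 addr_ge0 ?sqr_ge0.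
(* The correction lets the induction close: it is exact at m = 0, and the increment 2/(1 + (m+1)^2)
   is at most 4/((m+1)(m+2)). This is the origin of the constant 5. *)
suff : \sum_(k <- symr m) (1 + k%:~R ^+ 2)^-1 <= 5 - 4 / (m%:R + 1) :> R.
  by move/le_trans; apply; rewrite lerBlDr lerDl divr_ge0 // addr_ge0.
elim: m => [|m IH].
  by rewrite symrE /= big_seq1 subr0 mulr0z expr0n /= !addr0 add0r divr1 invr1; lra.
rewrite (perm_big _ (symr_perm m)) 2!big_cons.
apply: le_trans (lerD (lexx _) (lerD (lexx _) IH)) _.
rewrite mulrNz sqrrN -[m.+1%:~R]/(m.+1%:R : R) -natr1.
have : 0 <= m%:R :> R by []. move: (m%:R : R) => x x0.
have h1 : 0 < (1 + (x + 1) ^+ 2) by nra.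
have h2 : 0 < (x + 1) by lra.
have h3 : 0 < (x + 1 + 1) by lra.
rewrite -subr_ge0.
have -> : 5 - 4 / (x + 1 + 1) - ((1 + (x + 1) ^+ 2)^-1 +
   ((1 + (x + 1) ^+ 2)^-1 + (5 - 4 / (x + 1)))) =
  (2 * x ^+ 2 + 2 * x + 4) / ((1 + (x + 1) ^+ 2) * (x + 1) * (x + 1 + 1)).
  by field; rewrite !gt_eqF.
rewrite divr_ge0 //; first by nra.
by rewrite !mulr_ge0 // ltW.
Qed.

End RealSums2.

Lemma sum_mem_sub (V : nmodType) (I : eqType) (F : I -> V) (s t : seq I) :
  uniq s -> uniq t -> {subset t <= s} ->
  \sum_(k <- s | k \in t) F k = \sum_(k <- t) F k.
Proof.
move=> us ut ts.
rewrite -[LHS]big_filter [LHS](@perm_big _ _ _ _ [seq k <- s | k \in t] t) //.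
apply: uniq_perm => // [|k]; first exact: filter_uniq.
by rewrite mem_filter; case: (boolP (k \in t)) => // /ts ->.
Qed.

(** * Absolutely summable complex families indexed by the integers *)

Section ComplexSums.
Variable R : realType.
Implicit Types (F G : int -> R[i]) (g : int -> R) (z : R[i]).

Lemma nc_ge0 z : 0 <= nc z.
Proof. by case: z => a b; rewrite /= sqrtr_ge0. Qed.

Lemma nc_sq z : nc z ^+ 2 = complex.Re z ^+ 2 + complex.Im z ^+ 2.
Proof. by case: z => a b; rewrite /= sqr_sqrtr // addr_ge0 ?sqr_ge0. Qed.

Lemma ncN z : nc (- z) = nc z.
Proof. by case: z => a b; rewrite /= !sqrrN. Qed.

Lemma nc_conj z : nc (z^*)%C = nc z.
Proof. by case: z => a b; rewrite /= !sqrrN. Qed.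

Lemma nc_real (x : R) : nc x%:C%C = `|x|.
Proof. by rewrite /= expr0n /= addr0 sqrtr_sqr. Qed.

Lemma nc_imag (x : R) : nc (0 +i* x)%C = `|x|.
Proof. by rewrite /= expr0n /= add0r sqrtr_sqr. Qed.

Lemma nc_norm z : (nc z)%:C%C = `|z|.
Proof. by []. Qed.

Lemma ncD (x y : R[i]) : nc (x + y) <= nc x + nc y.
Proof.
have := ler_normD x y.
by rewrite -!nc_norm -rmorphD /= lecR.
Qed.

Lemma ncB (x y : R[i]) : nc (x - y) <= nc x + nc y.
Proof. by rewrite -(ncN y) ncD. Qed.

Lemma nc_dist (x y : R[i]) : `|nc x - nc y| <= nc (x - y).
Proof.
rewrite ler_norml; apply/andP; split.
  by rewrite lerNl opprB lerBlDr -(ncN (x - y)) opprB -{1}(subrK x y) ncD.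
by rewrite lerBlDr -{1}(subrK y x) ncD.
Qed.

Lemma nc_distC (x y : R[i]) : nc (x - y) = nc (y - x).
Proof. by rewrite -ncN opprB. Qed.

Lemma nc_distD (y x z : R[i]) : nc (x - z) <= nc (x - y) + nc (y - z).
Proof. by rewrite -(subrKA y x (- z)) ncD. Qed.

Lemma Re_le_nc z : `|complex.Re z| <= nc z.
Proof. by case: z => a b /=; rewrite -sqrtr_sqr ler_wsqrtr // lerDl sqr_ge0. Qed.

Lemma Im_le_nc z : `|complex.Im z| <= nc z.
Proof. by case: z => a b /=; rewrite -sqrtr_sqr ler_wsqrtr // lerDr sqr_ge0. Qed.

Lemma nc_le_ReIm z : nc z <= `|complex.Re z| + `|complex.Im z|.
Proof.
rewrite -(@ler_pXn2r _ 2) ?nnegrE ?nc_ge0 ?addr_ge0 // nc_sq sqrrD.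
by rewrite !real_normK ?num_real // lerD2r lerDl mulrn_wge0 ?mulr_ge0.
Qed.

Lemma nc_eq0 z : nc z = 0 -> z = 0.
Proof. exact: ComplexField.Normc.eq0_normc. Qed.

Lemma ncM (x y : R[i]) : nc (x * y) = nc x * nc y.
Proof. exact: ComplexField.Normc.normcM. Qed.

Lemma nc_sum (I : Type) (s : seq I) (P : pred I) (F : I -> R[i]) :
  nc (\sum_(i <- s | P i) F i) <= \sum_(i <- s | P i) nc (F i).
Proof.
elim/big_rec2: _ => [|i y1 y2 _ IH]; first by rewrite ComplexField.Normc.normc0.
by apply: le_trans (ncD _ _) _; rewrite lerD2l.
Qed.

Lemma cReD (x y : R[i]) : complex.Re (x + y) = complex.Re x + complex.Re y.
Proof. by case: x y => [a b] [c d]. Qed.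
Lemma cImD (x y : R[i]) : complex.Im (x + y) = complex.Im x + complex.Im y.
Proof. by case: x y => [a b] [c d]. Qed.
Lemma cReN (x : R[i]) : complex.Re (- x) = - complex.Re x.
Proof. by case: x. Qed.
Lemma cImN (x : R[i]) : complex.Im (- x) = - complex.Im x.
Proof. by case: x. Qed.
Lemma cReM (x y : R[i]) : complex.Re (x * y) =
  complex.Re x * complex.Re y - complex.Im x * complex.Im y.
Proof. by case: x y => [a b] [c d]. Qed.
Lemma cImM (x y : R[i]) : complex.Im (x * y) =
  complex.Re x * complex.Im y + complex.Im x * complex.Re y.
Proof. by case: x y => [a b] [c d]. Qed.
Lemma eq_ReIm (x y : R[i]) : complex.Re x = complex.Re y ->
  complex.Im x = complex.Im y -> x = y.
Proof. by case: x y => [a b] [c d] /= -> ->. Qed.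
Lemma Re_sum (I : Type) (s : seq I) (P : pred I) (F : I -> R[i]) :
  complex.Re (\sum_(i <- s | P i) F i) = \sum_(i <- s | P i) complex.Re (F i).
Proof. by elim/big_rec2: _ => [//|i y1 y2 _ <-]; rewrite cReD. Qed.
Lemma nc_small z : (forall e : R, 0 < e -> nc z <= e) -> z = 0.
Proof.
move=> h; apply: nc_eq0; apply/eqP; rewrite eq_le nc_ge0 andbT.
by apply/ler_addgt0Pl => e e0; rewrite addr0 h.
Qed.

Definition psum F m := \sum_(k <- symr m) F k.

(* Limit of the symmetric partial sums, as in [fsum]; only meaningful if [summ F]. *)
Definition csum F : R[i] :=
  ((limn (fun n => complex.Re (psum F n))) +i*
   (limn (fun n => complex.Im (psum F n))))%C.

Definition summ F := exists B, sumle (fun k => nc (F k)) B.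

Lemma cauchy_nat_cvg (u : nat -> R) :
  (forall e, 0 < e -> exists m0, forall m, (m0 <= m)%N -> `|u m - u m0| <= e) ->
  cvgn u.
Proof.
move=> h; apply: cauchy_cvg; apply: cauchy_exP => e e0.
have [m0 hm] := h (e / 2) (divr_gt0 e0 (ltr0Sn _ 1)).
exists (u m0); exists m0 => // m /= /hm.
rewrite /ball /= distrC => /le_lt_trans; apply.
by rewrite ltr_pdivrMr // ltr_pMr // ltr1n.
Qed.

(** A finite set whose sum is within e of the supremum leaves at most e to everything outside it;
    [symr m0] is any symmetric range containing such a set. *)
Lemma sumle_tail g B : (forall k, 0 <= g k) -> sumle g B ->
  forall e : R, 0 < e -> exists m0, forall s, uniq s -> {subset symr m0 <= s} ->
    \sum_(k <- s | k \notin symr m0) g k <= e.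
Proof.
move=> g0 gB e e0.
pose S := [set x : R | exists2 s, uniq s & x = \sum_(k <- s) g k].
have hS : has_sup S.
  split; first by exists 0; exists [::] => //; rewrite big_nil.
  by exists B => x [s us ->]; exact: gB.
have [_ [s0 us0 ->] hs0] := sup_adherent e0 hS.
have [m0 sm0] := seq_symr s0.
exists m0 => s us ms.
have h1 : \sum_(k <- s) g k <= sup S by apply: sup_upper_bound => //; exists s.
have h2 : \sum_(k <- s0) g k <= \sum_(k <- symr m0) g k.
  exact: ler_sum_sub (symr_uniq m0) sm0.
move: h1; rewrite (bigID (mem (symr m0)) xpredT) /=.
have -> : \sum_(k <- s | k \in symr m0) g k = \sum_(k <- symr m0) g k.
  by apply: sum_mem_sub => //; exact: symr_uniq.
lra.
Qed.

(* The convergence is uniform over all [F] dominated by the same [g]. *)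
Lemma csum_dom g B : (forall k, 0 <= g k) -> sumle g B ->
  forall e : R, 0 < e -> exists m0, forall F, (forall k, nc (F k) <= g k) ->
   forall s, uniq s -> {subset symr m0 <= s} -> nc (\sum_(k <- s) F k - csum F) <= e.
Proof.
move=> g0 gB e e0.
have tail e' : 0 < e' -> exists m0, forall F, (forall k, nc (F k) <= g k) ->
   forall s, uniq s -> {subset symr m0 <= s} -> nc (\sum_(k <- s) F k - psum F m0) <= e'.
  move=> /(sumle_tail g0 gB)[m0 hm0]; exists m0 => F Fg s us ms.
  rewrite (bigID (mem (symr m0)) xpredT) /=.
  have -> : \sum_(k <- s | k \in symr m0) F k = psum F m0.
    by apply: sum_mem_sub => //; exact: symr_uniq.
  rewrite addrAC subrr add0r.
  apply: le_trans (nc_sum _ _ _) _; apply: le_trans (hm0 s us ms).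
  exact: ler_sum.
have [m0 hm0] := tail (e / 4) (divr_gt0 e0 (ltr0Sn _ 3)).
exists m0 => F Fg s us ms.
have cF (re : R[i] -> R) : (forall x y, re (x - y) = re x - re y) ->
    (forall x, `|re x| <= nc x) -> cvgn (fun n => re (psum F n)).
  move=> reB re_le; apply: cauchy_nat_cvg => e' /tail[m1 hm1].
  exists m1 => m m1m; rewrite -reB; apply: le_trans (re_le _) _.
  by apply: hm1 => //; [exact: symr_uniq|exact: sub_symr].
have lF (re : R[i] -> R) : (forall x y, re (x - y) = re x - re y) ->
    (forall x, `|re x| <= nc x) ->
    `|re (psum F m0) - limn (fun n => re (psum F n))| <= e / 4.
  move=> reB re_le.
  have hc : `|re (psum F m0) - re (psum F n)| @[n --> \oo] -->
     `|re (psum F m0) - limn (fun n => re (psum F n))|.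
    by apply: cvg_norm; apply: cvgB; [exact: cvg_cst|exact: cF].
  apply: (cvgr_to_le hc); exists m0 => // m /= m0m.
  rewrite -reB; apply: le_trans (re_le _) _; rewrite nc_distC.
  by apply: hm0 => //; [exact: symr_uniq|exact: sub_symr].
apply: le_trans (nc_distD (psum F m0) _ _) _.
have := hm0 F Fg s us ms.
have := nc_le_ReIm (psum F m0 - csum F).
have := lF (@complex.Re R) (fun x y => etrans (cReD _ _) (congr1 _ (cReN _))) Re_le_nc.
have := lF (@complex.Im R) (fun x y => etrans (cImD _ _) (congr1 _ (cImN _))) Im_le_nc.
rewrite cReD cReN cImD cImN /=; lra.
Qed.

(** Unconditional convergence: any finite set beyond [symr m0] is allowed, not only the symmetric
    ones of the definition. *)
Lemma csum_fin F : summ F -> forall e : R, 0 < e -> exists m0,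
  forall s, uniq s -> {subset symr m0 <= s} -> nc (\sum_(k <- s) F k - csum F) <= e.
Proof.
move=> [B FB] e e0; have [m0 hm0] := csum_dom (fun k => nc_ge0 (F k)) FB e0.
by exists m0 => s us ms; apply: hm0.
Qed.

Lemma csum_psum F : summ F -> forall e : R, 0 < e -> exists m0,
  forall m, (m0 <= m)%N -> nc (psum F m - csum F) <= e.
Proof.
move=> sF e /(csum_fin sF)[m0 hm0]; exists m0 => m m0m.
by apply: hm0; [exact: symr_uniq|exact: sub_symr].
Qed.

Lemma csum_uniq F z : summ F -> (forall e : R, 0 < e -> exists m0,
  forall m, (m0 <= m)%N -> nc (psum F m - z) <= e) -> csum F = z.
Proof.
move=> sF h; apply/eqP; rewrite -subr_eq0; apply/eqP; apply: nc_small => e e0.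
have e20 : 0 < e / 2 by rewrite divr_gt0.
have [m0 hm0] := h _ e20; have [m1 hm1] := csum_psum sF e20.
apply: le_trans (nc_distD (psum F (maxn m0 m1)) _ _) _.
rewrite nc_distC; have := hm0 _ (leq_maxl m0 m1); have := hm1 _ (leq_maxr m0 m1).
lra.
Qed.

Lemma summD F G : summ F -> summ G -> summ (fun k => F k + G k).
Proof.
move=> [B FB] [C GC]; exists (B + C); apply: sumle_le (sumleD FB GC) => k.
exact: ncD.
Qed.

Lemma summZ c F : summ F -> summ (fun k => c * F k).
Proof.
move=> [B FB]; exists (nc c * B); apply: sumle_le (sumleZ (nc_ge0 c) FB) => k.
by rewrite ncM.
Qed.

Lemma summ_inj F (h : int -> int) : injective h -> summ F -> summ (fun k => F (h k)).
Proof. by move=> ih [B FB]; exists B; exact: (sumle_inj ih FB). Qed.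

Lemma csumD F G : summ F -> summ G -> csum (fun k => F k + G k) = csum F + csum G.
Proof.
move=> sF sG; apply: csum_uniq => [|e e0]; first exact: summD.
have e20 : 0 < e / 2 by rewrite divr_gt0.
have [m0 hm0] := csum_psum sF e20; have [m1 hm1] := csum_psum sG e20.
exists (maxn m0 m1) => m; rewrite geq_max => /andP[/hm0 h0 /hm1 h1].
rewrite /psum big_split opprD addrACA; apply: le_trans (ncD _ _) _; move: h0 h1.
rewrite /psum; lra.
Qed.

Lemma csumZ c F : summ F -> csum (fun k => c * F k) = c * csum F.
Proof.
move=> sF; apply: csum_uniq => [|e e0]; first exact: summZ.
have e10 : 0 < e / (nc c + 1) by rewrite divr_gt0 // ltr_wpDl ?nc_ge0.
have [m0 hm0] := csum_psum sF e10.
exists m0 => m /hm0 h; rewrite /psum -mulr_sumr -mulrBr ncM.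
apply: le_trans (_ : (nc c + 1) * (e / (nc c + 1)) <= e).
  by rewrite ler_pM ?nc_ge0 // lerDl.
by rewrite mulrC divfK // gt_eqF // ltr_wpDl ?nc_ge0.
Qed.

Lemma csum_bound F B : sumle (fun k => nc (F k)) B -> nc (csum F) <= B.
Proof.
move=> FB; apply/ler_addgt0Pl => e e0.
have [m0 hm0] := csum_psum (ex_intro _ B FB) e0.
have := hm0 m0 (leqnn _); have := FB _ (symr_uniq m0).
have := nc_sum (symr m0) xpredT F.
have := nc_distD (psum F m0) (csum F) 0; rewrite !subr0 nc_distC /psum; lra.
Qed.

(** The image of a symmetric range under [h] is in general not symmetric, so the comparison goes
    through [csum_fin]. *)
Lemma csum_reindex F (h h' : int -> int) : cancel h h' -> cancel h' h -> summ F ->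
  csum (fun k => F (h k)) = csum F.
Proof.
move=> hK h'K sF; have ih := can_inj hK.
apply: csum_uniq => [|e e0]; first exact: summ_inj.
have [m0 hm0] := csum_fin sF e0.
have [m1 hm1] := seq_symr [seq h' k | k <- symr m0].
exists m1 => m m1m; rewrite /psum -(big_map h xpredT F).
apply: hm0; first by rewrite map_inj_uniq ?symr_uniq.
move=> k km0; rewrite -(h'K k) map_f //; apply: (sub_symr m1m); apply: hm1.
exact: map_f.
Qed.

Lemma eq_csum F G : F =1 G -> csum F = csum G.
Proof. by move=> FG; congr csum; apply: funext. Qed.

Lemma csum0 : csum (fun=> 0) = 0.
Proof.
have -> : (fun=> 0 : R[i]) = (fun k : int => 0 * 0 : R[i]) by apply/funext => k; rewrite mulr0.
rewrite csumZ ?mul0r //; exists 0 => s us; rewrite big1 // => i _.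
by rewrite ComplexField.Normc.normc0.
Qed.

Lemma psum_nc_cvg F : summ F -> nc (psum F m) @[m --> \oo] --> nc (csum F).
Proof.
move=> sF; apply/cvgrPdist_le => e e0.
have [m0 hm0] := csum_psum sF e0.
exists m0 => // m /= /hm0 h; rewrite distrC.
exact: le_trans (nc_dist _ _) h.
Qed.

Lemma fpartialE (u : distr R) n x :
  fpartial u n x = psum (fun k => u k * cis (k%:~R * x)) n.
Proof.
rewrite /fpartial /psum symrE big_map -(big_mkord xpredT
  (fun j => u (j%:Z - n%:Z) * cis ((j%:Z - n%:Z)%:~R * x))).
by rewrite /index_iota subn0.
Qed.

Lemma fsumE (u : distr R) x : fsum u x = csum (fun k => u k * cis (k%:~R * x)).
Proof.
rewrite /fsum /csum.
by congr (limn _ +i* limn _)%C; apply/funext => n; rewrite fpartialE.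
Qed.

Lemma nc_cis x : nc (cis x : R[i]) = 1.
Proof. by rewrite /= cos2Dsin2 sqrtr1. Qed.

End ComplexSums.

(** * Sobolev norms and convolutions *)

Section Weights.
Variable R : realType.
Implicit Types (s t : R) (k j : int) (u a b : distr R).

Definition wt s k : R := japanese k%:~R `^ s.

Lemma japanese_ge1 (x : R) : 1 <= japanese x.
Proof. by rewrite /japanese -[X in X <= _]sqrtr1 ler_wsqrtr // lerDl sqr_ge0. Qed.

Lemma japanese_gt0 (x : R) : 0 < japanese x.
Proof. exact: lt_le_trans ltr01 (japanese_ge1 x). Qed.

Lemma wt_gt0 s k : 0 < wt s k.
Proof. by rewrite /wt powR_gt0 ?japanese_gt0. Qed.
Hint Resolve wt_gt0 : core.

Lemma wt_ge0 s k : 0 <= wt s k.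
Proof. exact/ltW. Qed.
Hint Resolve wt_ge0 : core.

Lemma wt0 k : wt 0 k = 1.
Proof. by rewrite /wt powRr0. Qed.

Lemma wtD s t k : wt (s + t) k = wt s k * wt t k.
Proof. by rewrite /wt powRD //; apply/implyP => _; rewrite gt_eqF ?japanese_gt0. Qed.

Lemma wtN s k : wt (- s) k = (wt s k)^-1.
Proof. by rewrite /wt powRN. Qed.

Lemma wt_le s t k : s <= t -> wt s k <= wt t k.
Proof. by move=> st; rewrite /wt ler_powR ?japanese_ge1. Qed.

Lemma wt_ge1 s k : 0 <= s -> 1 <= wt s k.
Proof. by move=> s0; rewrite -(wt0 k) wt_le. Qed.

Lemma wt1_sq k : wt 1 k ^+ 2 = 1 + k%:~R ^+ 2.
Proof.
by rewrite /wt powRr1 ?(ltW (japanese_gt0 _)) // sqr_sqrtr // addr_ge0 ?sqr_ge0.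
Qed.

Lemma normz_le_wt1 k : `|k%:~R| <= wt 1 k.
Proof.
rewrite -(@ler_pXn2r _ 2) ?nnegrE // wt1_sq real_normK ?num_real //.
by rewrite lerDr.
Qed.

Lemma normz_powR_le_wt s k : 0 <= s -> `|k%:~R| `^ s <= wt s k.
Proof.
move=> s0; rewrite /wt ge0_ler_powR ?nnegrE ?(ltW (japanese_gt0 _)) //.
by have := normz_le_wt1 k; rewrite /wt powRr1 // (ltW (japanese_gt0 _)).
Qed.

(** The constant 2^(s/2) of Peetre's inequality, which comes from 1 + (x+y)^2 <= 2 (1 + x^2)(1 +
    y^2). *)
Definition peetre s : R := Num.sqrt 2 `^ s.

Lemma peetre_gt0 s : 0 < peetre s.
Proof. by rewrite /peetre powR_gt0 // sqrtr_gt0. Qed.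

Lemma wt_peetre s i j : 0 <= s -> wt s (i + j) <= peetre s * (wt s i * wt s j).
Proof.
move=> s0; rewrite /wt /peetre -!powRM ?mulr_ge0 ?sqrtr_ge0 //.
rewrite ge0_ler_powR ?nnegrE ?mulr_ge0 ?sqrtr_ge0 // /japanese.
rewrite -!sqrtrM ?addr_ge0 ?sqr_ge0 // ler_wsqrtr // rmorphD /=.
move: (i%:~R : R) (j%:~R : R) => x y; have : 0 <= (x - y) ^+ 2 by apply: sqr_ge0.
have : 0 <= x ^+ 2 * y ^+ 2 by rewrite mulr_ge0 ?sqr_ge0.
have := sqr_ge0 x; have := sqr_ge0 y; rewrite !sqrrD ?sqrrB; lra.
Qed.

(* [hb s u B] stands for [||u||_{H^s} <= B] and [hn s u] for the norm itself. *)
Definition hb s u (B : R) :=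
  0 <= B /\ sumle (fun k => (wt s k * nc (u k)) ^+ 2) (B ^+ 2).

Lemma esum_sumle (f : int -> R) (B : R) : (forall k, 0 <= f k) ->
  (\esum_(k in [set: int]) (f k)%:E <= B%:E)%E <-> sumle f B.
Proof.
move=> f0; split=> [h s us|h].
  rewrite -lee_fin; apply: le_trans h; apply: esum_ge.
  exists [set` s]; first by split=> //; apply/finite_seqP; exists s.
  by rewrite -fsbig_seq // sumEFin.
apply: ge_ereal_sup => _ [X [fX _] <-].
rewrite fsbig_finite //= sumEFin lee_fin; exact: h (finmap.fset_uniq _).
Qed.

Lemma HnormP s u (B : R) : 0 <= B -> (Hnorm s u <= B%:E)%E <-> hb s u B.
Proof.
move=> B0; have -> : B%:E = sqrte (B ^+ 2)%:E.
  by rewrite EFin_expe sqrte_sqr /= ger0_norm.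
rewrite /Hnorm lee_sqrt ?lee_fin ?sqr_ge0 // esum_sumle; last by move=> k; exact: sqr_ge0.
by split=> [|[]].
Qed.

Lemma Hnorm_ge0 s u : (0 <= Hnorm s u)%E.
Proof. exact: sqrte_ge0. Qed.

Lemma inHP s u : inH s u <-> exists B, hb s u B.
Proof.
split=> [h|[B hB]]; last first.
  by apply: le_lt_trans (ltry B); apply/HnormP => //; case: hB.
exists (fine (Hnorm s u)); apply/HnormP; first by rewrite fine_ge0 ?Hnorm_ge0.
by rewrite fineK // ge0_fin_numE ?Hnorm_ge0.
Qed.

Definition hn s u : R := fine (Hnorm s u).

Lemma hn_hb s u : inH s u -> hb s u (hn s u).
Proof.
move=> h; apply/HnormP; first by rewrite fine_ge0 ?Hnorm_ge0.
by rewrite fineK // ge0_fin_numE ?Hnorm_ge0.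
Qed.

Lemma hn_ge0 s u : 0 <= hn s u.
Proof. by rewrite fine_ge0 ?Hnorm_ge0. Qed.

Lemma hn_le s u B : hb s u B -> hn s u <= B.
Proof.
move=> hB; have B0 := hB.1; move/HnormP: hB => /(_ B0) h.
rewrite -lee_fin /hn fineK // ge0_fin_numE ?Hnorm_ge0 //; exact: le_lt_trans h (ltry _).
Qed.

Lemma Hnorm_ltP s u (e : R) : 0 < e ->
  (Hnorm s u < e%:E)%E -> hb s u e.
Proof. by move=> e0 /ltW h; apply/HnormP => //; exact: ltW. Qed.

Lemma hb_Hnorm_lt s u (e : R) : 0 < e -> hb s u (e / 2) -> (Hnorm s u < e%:E)%E.
Proof.
move=> e0 h; apply: (@le_lt_trans _ _ (e / 2)%:E).
  by apply/HnormP => //; case: h.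
by rewrite lte_fin ltr_pdivrMr // ltr_pMr // ltr1n.
Qed.

Lemma hbW s u B C : B <= C -> hb s u B -> hb s u C.
Proof.
move=> BC [B0 h]; split; first exact: le_trans BC.
by apply: sumleW h; rewrite ler_pXn2r ?nnegrE // (le_trans B0).
Qed.

Lemma hb_dom s t u u' B : 0 <= B ->
  (forall k, wt s k * nc (u k) <= wt t k * nc (u' k)) ->
  hb t u' B -> hb s u B.
Proof.
move=> B0 h [_ hB]; split=> //; apply: sumle_le hB => k.
by rewrite ler_pXn2r ?nnegrE ?mulr_ge0 ?nc_ge0.
Qed.

Lemma hb_mono s t u B : s <= t -> hb t u B -> hb s u B.
Proof.
move=> st h; apply: (hb_dom h.1 _ h).
by move=> k; rewrite ler_wpM2r ?nc_ge0 // wt_le.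
Qed.

Lemma inH_mono s t u : s <= t -> inH t u -> inH s u.
Proof. by move=> st /inHP[B /(hb_mono st) h]; apply/inHP; exists B. Qed.

Lemma hbD s u u' B C : hb s u B -> hb s u' C -> hb s (dist_add u u') (B + C).
Proof.
move=> [B0 hB] [C0 hC]; split; first exact: addr_ge0.
move=> r ur; apply: le_trans (sum_sqD B0 C0 (hB r ur) (hC r ur)).
apply: ler_sum => k _; rewrite ler_pXn2r ?nnegrE ?addr_ge0 ?mulr_ge0 ?nc_ge0 //.
by rewrite -mulrDr ler_wpM2l // ncD.
Qed.

Lemma hbZ s u c B : hb s u B -> hb s (dist_scale c u) (nc c * B).
Proof.
move=> [B0 hB]; split; first by rewrite mulr_ge0 ?nc_ge0.
rewrite exprMn; apply: sumle_le (sumleZ (sqr_ge0 (nc c)) hB) => k.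
by rewrite -exprMn /dist_scale ncM mulrCA.
Qed.

Lemma hbB s u u' B C : hb s u B -> hb s u' C -> hb s (dist_sub u u') (B + C).
Proof.
move=> h h'; rewrite (_ : dist_sub u u' = dist_add u (dist_scale (- 1) u')).
  have := hbD h (hbZ (- 1) h').
  by rewrite ncN ComplexField.Normc.normc1 mul1r.
by apply/funext => k; rewrite /dist_sub /dist_add /dist_scale mulN1r.
Qed.

Lemma inHD s u u' : inH s u -> inH s u' -> inH s (dist_add u u').
Proof. by move=> /inHP[B h] /inHP[C h']; apply/inHP; exists (B + C); exact: hbD. Qed.

Lemma inHB s u u' : inH s u -> inH s u' -> inH s (dist_sub u u').
Proof. by move=> /inHP[B h] /inHP[C h']; apply/inHP; exists (B + C); exact: hbB. Qed.

Lemma inHZ s u c : inH s u -> inH s (dist_scale c u).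
Proof. by move=> /inHP[B h]; apply/inHP; exists (nc c * B); exact: hbZ. Qed.

Lemma hb_fmult s t (m : R -> R[i]) c u B : 0 <= c ->
  (forall k, nc (m k%:~R) <= c * wt t k) ->
  hb (s + t) u B -> hb s (fmult m u) (c * B).
Proof.
move=> c0 hm [B0 hB]; split; first by rewrite mulr_ge0.
rewrite exprMn; apply: sumle_le (sumleZ (sqr_ge0 c) hB) => k.
rewrite -exprMn ler_pXn2r ?nnegrE ?mulr_ge0 ?nc_ge0 // /fmult ncM wtD.
rewrite (_ : c * _ = wt s k * ((c * wt t k) * nc (u k))); last by ring.
by rewrite ler_wpM2l // ler_wpM2r ?nc_ge0.
Qed.

Lemma hb_dx s u B : hb (s + 1) u B -> hb s (dx u) B.
Proof.
move=> h; rewrite -[B]mul1r; apply: hb_fmult h => // k.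
by rewrite nc_imag mul1r normz_le_wt1.
Qed.

Lemma hb_absD s (al : R) u B : 0 <= al -> hb (s + al) u B -> hb s (absD al u) B.
Proof.
move=> al0 h; rewrite -[B]mul1r; apply: hb_fmult h => // k.
by rewrite nc_real ger0_norm ?powR_ge0 // mul1r normz_powR_le_wt.
Qed.

Lemma sumle_wtN1 : sumle (fun k => wt (- 1) k ^+ 2) (Num.sqrt 5 ^+ 2).
Proof.
rewrite sqr_sqrtr //; apply: sumle_le (@sumle_inv_sq R) => k.
by rewrite wtN exprVn wt1_sq.
Qed.

(** Sobolev embedding into a weighted Wiener algebra, by Cauchy-Schwarz against the weight of order
    -1. A whole derivative is spent so that the elementary series [sumle_inv_sq] suffices. *)
Lemma hb_l1 s u B : hb (s + 1) u B ->
  sumle (fun k => wt s k * nc (u k)) (Num.sqrt 5 * B).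
Proof.
move=> [B0 hB]; apply: sumle_le (sumle_cs (sqrtr_ge0 5) B0 sumle_wtN1 hB) => k.
by rewrite mulrA -wtD addrCA addNr addr0.
Qed.

Lemma hb0_term u B k : hb 0 u B -> nc (u k) <= B.
Proof.
move=> [B0 hB]; have := sumle_term k hB.
by rewrite wt0 mul1r ler_pXn2r ?nnegrE ?nc_ge0.
Qed.

Lemma hb_term s u B k : hb s u B -> nc (u k) <= wt (- s) k * B.
Proof.
move=> [B0 hB]; have := sumle_term k hB.
rewrite ler_pXn2r ?nnegrE ?mulr_ge0 ?nc_ge0 // => h.
by rewrite wtN -ler_pdivrMl ?invr_gt0 // invrK.
Qed.

Definition fconv a b : distr R := fun k => csum (fun j => b j * a (k - j)).

(** Duality of H^s and H^(-s): Peetre's inequality moves the weight from k-j to j at the price of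
    the weight at k. Each coefficient of a product thus makes sense even if one factor has negative
    order, as happens for W(v) (V_2)_x. *)
Lemma conv_sumle s a b A B k : 0 <= s -> hb s a A -> hb (- s) b B ->
  sumle (fun j => nc (b j * a (k - j))) (peetre s * wt s k * (A * B)).
Proof.
move=> s0 [A0 hA] [B0 hB].
have hA' := sumle_inj (@subn_inj k) hA.
have := sumleZ _ (sumle_cs B0 A0 hB hA').
move=> /(_ (peetre s * wt s k)); rewrite [B * A]mulrC => /(_ _)h.
apply: sumle_le (h _); last by rewrite mulr_ge0 // (ltW (peetre_gt0 _)).
move=> j; rewrite ncM -mulrA.
have hp : wt s j <= peetre s * (wt s k * wt s (k - j)).
  have := wt_peetre k (j - k) s0; rewrite addrC subrK.
  rewrite (_ : wt s (j - k) = wt s (k - j)) //.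
  by rewrite /wt /japanese -(opprB k j) rmorphN /= sqrrN.
have -> : peetre s * wt s k * (wt (- s) j * (nc (b j) * (wt s (k - j) * nc (a (k - j)))))
  = (peetre s * (wt s k * wt s (k - j))) * wt (- s) j * (nc (b j) * nc (a (k - j))).
  by ring.
rewrite wtN; by rewrite ler_peMl ?mulr_ge0 ?nc_ge0 // ler_pdivlMr // mul1r.
Qed.

Lemma conv_summ s a b k : 0 <= s -> inH s a -> inH (- s) b ->
  summ (fun j => b j * a (k - j)).
Proof.
move=> s0 /inHP[A hA] /inHP[B hB].
by exists (peetre s * wt s k * (A * B)); exact: conv_sumle.
Qed.

Lemma conv_coef s a b A B k : 0 <= s -> hb s a A -> hb (- s) b B ->
  nc (fconv a b k) <= peetre s * wt s k * (A * B).
Proof. by move=> s0 hA hB; apply: csum_bound; exact: conv_sumle. Qed.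

Lemma convDl s a a' b : 0 <= s -> inH s a -> inH s a' -> inH (- s) b ->
  fconv (dist_add a a') b = dist_add (fconv a b) (fconv a' b).
Proof.
move=> s0 ha ha' hb'; apply/funext => k; rewrite /dist_add /fconv.
rewrite -csumD; try exact: (@conv_summ s).
by apply: eq_csum => j; rewrite mulrDr.
Qed.

Lemma convDr s a b b' : 0 <= s -> inH s a -> inH (- s) b -> inH (- s) b' ->
  fconv a (dist_add b b') = dist_add (fconv a b) (fconv a b').
Proof.
move=> s0 ha hb1 hb2; apply/funext => k; rewrite /dist_add /fconv.
rewrite -csumD; try exact: (@conv_summ s).
by apply: eq_csum => j; rewrite mulrDl.
Qed.

Lemma convZl s c a b : 0 <= s -> inH s a -> inH (- s) b ->
  fconv (dist_scale c a) b = dist_scale c (fconv a b).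
Proof.
move=> s0 ha hb1; apply/funext => k; rewrite /dist_scale /fconv.
rewrite -csumZ; last exact: (@conv_summ s).
by apply: eq_csum => j; rewrite mulrCA.
Qed.

Lemma convZr s c a b : 0 <= s -> inH s a -> inH (- s) b ->
  fconv a (dist_scale c b) = dist_scale c (fconv a b).
Proof.
move=> s0 ha hb1; apply/funext => k; rewrite /dist_scale /fconv.
rewrite -csumZ; last exact: (@conv_summ s).
by apply: eq_csum => j; rewrite mulrA.
Qed.

Lemma dist_subE u u' : dist_sub u u' = dist_add u (dist_scale (- 1) u').
Proof. by apply/funext => k; rewrite /dist_sub /dist_add /dist_scale mulN1r. Qed.

Lemma convBl s a a' b : 0 <= s -> inH s a -> inH s a' -> inH (- s) b ->
  fconv (dist_sub a a') b = dist_sub (fconv a b) (fconv a' b).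
Proof.
move=> s0 ha ha' hb'; rewrite !dist_subE (@convDl s) //; last exact: inHZ.
by rewrite (@convZl s).
Qed.

Lemma convBr s a b b' : 0 <= s -> inH s a -> inH (- s) b -> inH (- s) b' ->
  fconv a (dist_sub b b') = dist_sub (fconv a b) (fconv a b').
Proof.
move=> s0 ha ha' hb'; rewrite !dist_subE (@convDr s) //; last exact: inHZ.
by rewrite (@convZr s).
Qed.

Lemma conv_comm s a b : 0 <= s -> inH s a -> inH (- s) b -> fconv a b = fconv b a.
Proof.
move=> s0 ha hb1; apply/funext => k; rewrite /fconv.
rewrite -(@csum_reindex R (fun j => b j * a (k - j)) (fun j => k - j) (fun j => k - j)).
- by apply: eq_csum => j; rewrite opprB addrCA subrr addr0 mulrC.
- by move=> j; rewrite opprB addrCA subrr addr0.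
- by move=> j; rewrite opprB addrCA subrr addr0.
- exact: (@conv_summ s).
Qed.

(** Peetre's inequality distributes the weight over the two factors, after which Young's inequality
    applies to the weighted sequences. The inner sum is truncated to [symr m] and the bound survives
    the limit by [sumle_lim]. *)
Lemma hb_conv_l1 s a b A B : 0 <= s ->
  sumle (fun k => wt s k * nc (a k)) A -> hb s b B ->
  hb s (fconv a b) (peetre s * (A * B)).
Proof.
move=> s0 hA [B0 hB]; have A0 := sumle_ge0 hA.
split; first by rewrite !mulr_ge0 // ltW ?peetre_gt0.
have hb0 : hb 0 b B by apply: hb_mono (conj B0 hB).
have ha0 : sumle (fun k => nc (a k)) A.
  by apply: sumle_le hA => k; rewrite ler_peMl ?nc_ge0 ?wt_ge1.
have sm k : summ (fun j => b j * a (k - j)).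
  exists (B * A) => r ur.
  apply: (@le_trans _ _ (\sum_(j <- r) B * nc (a (k - j)))).
    by apply: ler_sum => j _; rewrite ncM ler_wpM2r ?nc_ge0 // (hb0_term _ hb0).
  by rewrite -mulr_sumr ler_wpM2l // (sumle_inj (@subn_inj k) ha0).
apply: (@sumle_lim _ (fun m k => (wt s k * nc (psum (fun j => b j * a (k - j)) m)) ^+ 2)).
  move=> k; rewrite expr2; under eq_fun do rewrite expr2.
  by apply: cvgM; apply: cvgM; try exact: cvg_cst; exact: psum_nc_cvg.
move=> m r ur.
rewrite exprMn -ler_pdivrMl ?exprn_gt0 ?peetre_gt0 // mulr_sumr.
apply: le_trans (young_finite (f := fun j => wt s j * nc (b j))
  (g := fun k => wt s k * nc (a k)) B0 _ hA hB ur (symr_uniq m)); last first.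
  by move=> k; rewrite mulr_ge0 ?nc_ge0.
apply: ler_sum => k _; rewrite ler_pdivrMl ?exprn_gt0 ?peetre_gt0 // -exprMn.
rewrite ler_pXn2r ?nnegrE ?mulr_ge0 ?nc_ge0 ?(ltW (peetre_gt0 _)) //; last first.
  by apply: sumr_ge0 => j _; rewrite !mulr_ge0 ?nc_ge0.
apply: le_trans (ler_wpM2l _ (nc_sum _ _ _)) _ => //.
rewrite !mulr_sumr; apply: ler_sum => j _; rewrite ncM.
have := wt_peetre (k - j) j s0; rewrite subrK => h.
rewrite (_ : peetre s * _ = (peetre s * (wt s (k - j) * wt s j)) * (nc (b j) * nc (a (k - j)))); last by ring.
by rewrite ler_wpM2r // mulr_ge0 ?nc_ge0.
Qed.

Definition cC s : R := peetre s * Num.sqrt 5.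

Lemma cC_ge0 s : 0 <= cC s.
Proof. by rewrite mulr_ge0 ?sqrtr_ge0 ?(ltW (peetre_gt0 _)). Qed.

(** The first factor enters through its weighted l^1 norm and pays the extra derivative; the second
    keeps its order, which suits the form a u_x. *)
Lemma hb_conv s a b A B : 0 <= s -> hb (s + 1) a A -> hb s b B ->
  hb s (fconv a b) (cC s * (A * B)).
Proof.
move=> s0 hA hB; have := hb_conv_l1 s0 (hb_l1 hA) hB.
by rewrite /cC !mulrA.
Qed.

(** The extra derivative now falls on the second factor. In W(V_j) v_x the first factor is thereby
    measured in L^2, by the energy, and v_x in H^1, by M. *)
Lemma hb_conv0r a b A B : hb 0 a A -> hb 1 b B -> hb 0 (fconv a b) (cC 0 * (A * B)).
Proof.
move=> hA hB; rewrite (@conv_comm 0) //.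
- by rewrite [A * B]mulrC; apply: hb_conv => //; rewrite add0r.
- by apply/inHP; exists A.
- by rewrite oppr0; apply/inHP; exists B; exact: hb_mono hB.
Qed.

End Weights.
#[global] Hint Resolve wt_gt0 wt_ge0 : core.

Section IntegrableReal.
Context d (T : measurableType d) (R : realType) (mu : {measure set T -> \bar R}).
Variable D : set T.
Hypothesis mD : measurable D.

Lemma integrable_EFinZ (k : R) (h : T -> R) :
  mu.-integrable D (EFin \o h) -> mu.-integrable D (EFin \o (fun x => k * h x)).
Proof. by move=> hh; have := integrableZl mD k hh; apply: eq_integrable. Qed.

Lemma integrable_EFinD (g h : T -> R) :
  mu.-integrable D (EFin \o g) -> mu.-integrable D (EFin \o h) ->
  mu.-integrable D (EFin \o (fun x => g x + h x)).
Proof. by move=> hg hh; have := integrableD mD hg hh; apply: eq_integrable. Qed.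

Lemma integrable_EFinB (g h : T -> R) :
  mu.-integrable D (EFin \o g) -> mu.-integrable D (EFin \o h) ->
  mu.-integrable D (EFin \o (fun x => g x - h x)).
Proof. by move=> hg hh; have := integrableB mD hg hh; apply: eq_integrable. Qed.

End IntegrableReal.

(** * Fourier coefficients of products *)

Section Period.
Variable R : realType.
Implicit Types (f g : R -> R[i]) (u b : distr R).
Local Notation mu := (@lebesgue_measure R).
Local Notation D := (`[0, 2 * pi]%classic : set R).

Lemma twopi_gt0 : 0 < 2 * pi :> R.
Proof. by rewrite mulr_gt0 // pi_gt0. Qed.

Lemma mD : measurable D.
Proof. exact: measurable_itv. Qed.
Hint Resolve mD : core.

Lemma muD : mu D = (2 * pi)%:E.
Proof. by rewrite lebesgue_measure_itv /= lte_fin twopi_gt0 oppr0 adde0. Qed.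

Definition cint f := mu.-integrable D (EFin \o (fun x => complex.Re (f x))) /\
  mu.-integrable D (EFin \o (fun x => complex.Im (f x))).

Definition cmeas f := measurable_fun D (fun x => complex.Re (f x)) /\
  measurable_fun D (fun x => complex.Im (f x)).

(** Bounded measurable functions. Unlike [cint] this class is stable under products, so Fourier
    coefficients of products can be expanded term by term. *)
Definition bm f := cmeas f /\ exists c, forall x, D x -> nc (f x) <= c.

Lemma bnd_integrable (h : R -> R) (c : R) : measurable_fun D h ->
  (forall x, D x -> `|h x| <= c) -> mu.-integrable D (EFin \o h).
Proof.
move=> mh hc; apply: measurable_bounded_integrable => //.
  by have := muD => /= ->; rewrite ltry.
by exists c; split; [exact: num_real|move=> x cx y Dy; exact: le_trans (hc y Dy) (ltW cx)].
Qed.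

Lemma bm_cint f : bm f -> cint f.
Proof.
move=> [[mr mi] [c hc]]; split; apply: (@bnd_integrable _ c) => // x Dx.
  by apply: le_trans (Re_le_nc _) (hc x Dx).
by apply: le_trans (Im_le_nc _) (hc x Dx).
Qed.

Lemma bmD f g : bm f -> bm g -> bm (fun x => f x + g x).
Proof.
move=> [[f1 f2] [c hc]] [[g1 g2] [d hd]]; split.
  split; [rewrite (_ : (fun x => _) = (fun x => complex.Re (f x) + complex.Re (g x)))|
          rewrite (_ : (fun x => _) = (fun x => complex.Im (f x) + complex.Im (g x)))];
  try exact: measurable_funD.
    by apply/funext => x; rewrite cReD.
  by apply/funext => x; rewrite cImD.
by exists (c + d) => x Dx; apply: le_trans (ncD _ _) _; rewrite lerD ?hc ?hd.
Qed.

Lemma bmM f g : bm f -> bm g -> bm (fun x => f x * g x).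
Proof.
move=> [[f1 f2] [c hc]] [[g1 g2] [d hd]]; split.
  split.
    rewrite (_ : (fun x => _) = (fun x => complex.Re (f x) * complex.Re (g x) -
      complex.Im (f x) * complex.Im (g x))); last by apply/funext => x; rewrite cReM.
    by apply: measurable_funB; exact: measurable_funM.
  rewrite (_ : (fun x => _) = (fun x => complex.Re (f x) * complex.Im (g x) +
      complex.Im (f x) * complex.Re (g x))); last by apply/funext => x; rewrite cImM.
  by apply: measurable_funD; exact: measurable_funM.
by exists (c * d) => x Dx; rewrite ncM ler_pM ?nc_ge0 ?hc ?hd.
Qed.

Lemma bm_cst c : bm (fun=> c).
Proof. by split; [split; exact: measurable_cst|exists (nc c)]. Qed.

Lemma bm_real (h : R -> R) (c : R) : measurable_fun D h ->
  (forall x, D x -> `|h x| <= c) -> bm (fun x => (h x)%:C%C).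
Proof.
move=> mh hc; split; first by split => //; exact: measurable_cst.
by exists c => x Dx; rewrite nc_real hc.
Qed.

Lemma bm_conj f : bm f -> bm (fun x => (f x)^*%C).
Proof.
move=> [[f1 f2] [c hc]]; split; last by exists c => x Dx; rewrite nc_conj hc.
split; first by rewrite (_ : (fun x => _) = fun x => complex.Re (f x)) //;
  apply/funext => x; case: (f x).
rewrite (_ : (fun x => _) = (fun x => - complex.Im (f x))).
  exact: measurable_funN.
by apply/funext => x; case: (f x).
Qed.

Lemma continuous_measD (h : R -> R) : continuous h -> measurable_fun D h.
Proof. by move=> ch; apply: measurable_funTS; exact: continuous_measurable_fun. Qed.

Lemma bm_cis (c : R) : bm (fun x => cis (c * x)).
Proof.
split; last by exists 1 => x _; rewrite nc_cis.
split => /=; apply: continuous_measD => x; apply: continuous_comp.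
- by apply: cvgM; [exact: cvg_cst|exact: cvg_id].
- exact: continuous_cos.
- by apply: cvgM; [exact: cvg_cst|exact: cvg_id].
- exact: continuous_sin.
Qed.

Lemma bm_sum (I : Type) (s : seq I) (F : I -> R -> R[i]) :
  (forall i, bm (F i)) -> bm (fun x => \sum_(i <- s) F i x).
Proof.
move=> hF; elim: s => [|i s IH].
  by under eq_fun do rewrite big_nil; exact: bm_cst.
by under eq_fun do rewrite big_cons; exact: bmD.
Qed.

Lemma eq_cintegral f g : (forall x, D x -> f x = g x) -> cintegral D f = cintegral D g.
Proof.
by move=> fg; rewrite /cintegral; congr (_ +i* _)%C; congr fine;
  apply: eq_integral => x /set_mem Dx; rewrite fg.
Qed.

Lemma cintegralD f g : cint f -> cint g ->
  cintegral D (fun x => f x + g x) = cintegral D f + cintegral D g.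
Proof.
move=> [f1 f2] [g1 g2]; rewrite /cintegral.
have -> : (fun x => complex.Re (f x + g x)) =
  (fun x => complex.Re (f x) + complex.Re (g x)) by apply/funext => x; rewrite cReD.
have -> : (fun x => complex.Im (f x + g x)) =
  (fun x => complex.Im (f x) + complex.Im (g x)) by apply/funext => x; rewrite cImD.
by rewrite !RintegralD.
Qed.

Lemma cintegralZ c f : cint f -> cintegral D (fun x => c * f x) = c * cintegral D f.
Proof.
move=> [f1 f2]; case: c => a b; rewrite /cintegral.
have -> : (fun x => complex.Re ((a +i* b)%C * f x)) =
  (fun x => a * complex.Re (f x) - b * complex.Im (f x)).
  by apply/funext => x; rewrite cReM.
have -> : (fun x => complex.Im ((a +i* b)%C * f x)) =
  (fun x => a * complex.Im (f x) + b * complex.Re (f x)).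
  by apply/funext => x; rewrite cImM.
rewrite RintegralB ?RintegralD //; try exact: integrable_EFinZ.
by rewrite !RintegralZl.
Qed.

Lemma cintD f g : cint f -> cint g -> cint (fun x => f x + g x).
Proof.
move=> [f1 f2] [g1 g2]; split.
  rewrite (_ : (fun x => _) = (fun x => complex.Re (f x) + complex.Re (g x))).
    exact: integrable_EFinD.
  by apply/funext => x; rewrite cReD.
rewrite (_ : (fun x => _) = (fun x => complex.Im (f x) + complex.Im (g x))).
  exact: integrable_EFinD.
by apply/funext => x; rewrite cImD.
Qed.

Lemma cintegral_sum (I : Type) (s : seq I) (F : I -> R -> R[i]) :
  (forall i, cint (F i)) ->
  cintegral D (fun x => \sum_(i <- s) F i x) = \sum_(i <- s) cintegral D (F i).
Proof.
move=> hF.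
suff [] : cint (fun x => \sum_(i <- s) F i x) /\ cintegral D (fun x => \sum_(i <- s) F i x) = \sum_(i <- s) cintegral D (F i) by [].
elim: s => [|i s [IH1 IH2]].
  split; first by under eq_fun do rewrite big_nil; exact: bm_cint (bm_cst _).
  rewrite big_nil.
  have := cintegralZ 0 (bm_cint (bm_cst 0)).
  rewrite [RHS]mul0r => h0; apply: etrans h0.
  by apply: eq_cintegral => x _; rewrite big_nil [RHS]mul0r.
split; first by under eq_fun do rewrite big_cons; exact: cintD.
rewrite big_cons -IH2 -cintegralD //; congr cintegral; apply/funext => x.
by rewrite big_cons.
Qed.

Lemma cintegral_bound f (e : R) : cint f -> (forall x, D x -> nc (f x) <= e) ->
  nc (cintegral D f) <= 2 * (2 * pi) * e.
Proof.
move=> [f1 f2] hf; apply: le_trans (nc_le_ReIm _) _.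
have ei : mu.-integrable D (EFin \o cst e).
  by apply: (@bnd_integrable _ `|e|); [exact: measurable_cst|].
have ce : \int[mu]_(x in D) e = 2 * pi * e.
  rewrite Rintegral_cst; last exact: mD.
  by have := muD => /= ->; rewrite mulrC.
have hr (h : R -> R) : mu.-integrable D (EFin \o h) ->
  (forall x, D x -> `|h x| <= e) -> `|\int[mu]_(x in D) h x| <= 2 * pi * e.
  move=> hi hh; apply: le_trans (le_normr_Rintegral _ hi) _ => //.
  rewrite -ce; apply: le_Rintegral => //; exact: (integrable_norm hi).
rewrite /cintegral /= (_ : 2 * (2 * pi) * e = 2 * pi * e + 2 * pi * e); last by ring.
rewrite lerD // hr // => x Dx.
  by apply: le_trans (Re_le_nc _) (hf x Dx).
by apply: le_trans (Im_le_nc _) (hf x Dx).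
Qed.

Lemma cisM (x y : R) : cis x * cis y = cis (x + y) :> R[i].
Proof.
apply: eq_ReIm; first by rewrite cReM /= cosD.
by rewrite cImM /= sinD addrC.
Qed.

Lemma cis0 : cis 0 = 1 :> R[i].
Proof. by rewrite /cis cos0 sin0. Qed.

Lemma cis_conj (x : R) : (cis x)^*%C = cis (- x) :> R[i].
Proof. by rewrite /cis cosN sinN. Qed.

Lemma cint_fcoef f k : bm f -> cint (fun x => f x * cis (- (k%:~R * x))).
Proof.
move=> bf; apply: bm_cint; apply: bmM => //.
have := bm_cis (- k%:~R); congr bm; apply/funext => x; by rewrite mulNr.
Qed.

Lemma fcoefD f g k : bm f -> bm g ->
  fcoef (fun x => f x + g x) k = fcoef f k + fcoef g k.
Proof.
move=> bf bg; rewrite /fcoef -mulrDr -cintegralD; try exact: cint_fcoef.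
by congr (_ * _); apply: eq_cintegral => x _; rewrite mulrDl.
Qed.

Lemma fcoefZ c f k : bm f -> fcoef (fun x => c * f x) k = c * fcoef f k.
Proof.
move=> bf; rewrite /fcoef [RHS]mulrCA -(cintegralZ c (cint_fcoef k bf)).
by congr (_ * _); apply: eq_cintegral => x _; rewrite -mulrA.
Qed.

Lemma fcoef_sum (I : Type) (s : seq I) (F : I -> R -> R[i]) k :
  (forall i, bm (F i)) ->
  fcoef (fun x => \sum_(i <- s) F i x) k = \sum_(i <- s) fcoef (F i) k.
Proof.
move=> hF; rewrite /fcoef -mulr_sumr -cintegral_sum; last by move=> i; exact: cint_fcoef.
by congr (_ * _); apply: eq_cintegral => x _; rewrite mulr_suml.
Qed.

Lemma eq_fcoef f g k : (forall x, D x -> f x = g x) -> fcoef f k = fcoef g k.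
Proof. by move=> fg; rewrite /fcoef; congr (_ * _); apply: eq_cintegral => x Dx; rewrite fg. Qed.

Lemma fcoef_cis f j k : fcoef (fun x => f x * cis (j%:~R * x)) k = fcoef f (k - j).
Proof.
rewrite /fcoef; congr (_ * _); apply: eq_cintegral => x _.
by rewrite -mulrA cisM rmorphB /= mulrBl opprB.
Qed.

Lemma fcoef_bound f k (e : R) : bm f -> (forall x, D x -> nc (f x) <= e) ->
  nc (fcoef f k) <= 2 * e.
Proof.
move=> bf hf; rewrite /fcoef ncM nc_real ger0_norm; last first.
  by rewrite invr_ge0 (ltW twopi_gt0).
rewrite ler_pdivrMl ?twopi_gt0 //.
apply: le_trans (cintegral_bound (cint_fcoef k bf) (e := e) _) _.
  by move=> x Dx; rewrite ncM nc_cis mulr1 hf.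
by rewrite le_eqVlt; apply/orP; left; apply/eqP; ring.
Qed.

Lemma bm_psum b n : bm (fun x => psum (fun k => b k * cis (k%:~R * x)) n).
Proof. by apply: bm_sum => k; apply: bmM; [exact: bm_cst|exact: bm_cis]. Qed.

Lemma bm_fpartial b n : bm (fpartial b n).
Proof. by have := bm_psum b n; congr bm; apply/funext => x; rewrite fpartialE. Qed.

Lemma fcoef_fpartial f b n k : bm f ->
  fcoef (fun x => f x * fpartial b n x) k = psum (fun j => b j * fcoef f (k - j)) n.
Proof.
move=> bf; rewrite (@eq_fcoef _ (fun x => \sum_(j <- symr n) (b j * (f x * cis (j%:~R * x))))).
  rewrite fcoef_sum => [|j]; last first.
    by apply: bmM; [exact: bm_cst|apply: bmM => //; exact: bm_cis].
  apply: eq_bigr => j _; rewrite fcoefZ ?fcoef_cis //.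
  by apply: bmM => //; exact: bm_cis.
by move=> x _; rewrite fpartialE /psum mulr_sumr; apply: eq_bigr => j _; rewrite mulrCA.
Qed.

Definition l1 b := exists B, sumle (fun k => nc (b k)) B.

Lemma fsum_unif b : l1 b -> forall e : R, 0 < e -> exists m0, forall m, (m0 <= m)%N ->
  forall x, nc (fpartial b m x - fsum b x) <= e.
Proof.
move=> [B hB] e e0; have [m0 hm0] := csum_dom (fun k => nc_ge0 (b k)) hB e0.
exists m0 => m m0m x; rewrite fpartialE fsumE; apply: hm0.
- by move=> k; rewrite ncM nc_cis mulr1.
- exact: symr_uniq.
- exact: sub_symr.
Qed.

Lemma bm_fsum b : l1 b -> bm (fsum b).
Proof.
move=> lb; have [B hB] := lb; split; last first.
  exists B => x _; rewrite fsumE; apply: csum_bound; apply: sumle_le hB => k.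
  by rewrite ncM nc_cis mulr1.
have mr (re : R[i] -> R) : (forall x y, re (x - y) = re x - re y) ->
    (forall x, `|re x| <= nc x) -> (forall n, measurable_fun D (fun x => re (fpartial b n x))) ->
    measurable_fun D (fun x => re (fsum b x)).
  move=> reB re_le mre.
  apply: (measurable_fun_cvg (h := fun n x => re (fpartial b n x))) => // x Dx.
  apply/cvgrPdist_le => e e0; have [m0 hm0] := fsum_unif lb e0.
  exists m0 => // m /= m0m; rewrite distrC -reB; exact: le_trans (re_le _) (hm0 m m0m x).
split; apply: mr.
- by move=> x y; rewrite cReD cReN.
- exact: Re_le_nc.
- by move=> n; have [[]] := bm_fpartial b n.
- by move=> x y; rewrite cImD cImN.
- exact: Im_le_nc.
- by move=> n; have [[]] := bm_fpartial b n.
Qed.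

(** The partial sums of an l^1 Fourier series converge uniformly, and multiplication by the bounded
    [f] preserves this. The coefficients of the truncated products are the partial sums of the
    convolution. *)
Lemma fcoef_fsum f b : bm f -> l1 b ->
  fcoef (fun x => f x * fsum b x) = fconv (fcoef f) b.
Proof.
move=> bf lb; apply/funext => k; have [B hB] := lb.
have [_ [c hc]] := bf.
have c0 : 0 <= c by apply: le_trans (nc_ge0 _) (hc 0 _); rewrite /= in_itv /= lexx (ltW twopi_gt0).
rewrite /fconv; apply/esym/csum_uniq => [|e e0].
  exists (B * (2 * c)) => r ur.
  apply: le_trans (_ : \sum_(j <- r) nc (b j) * (2 * c) <= _).
    by apply: ler_sum => j _; rewrite ncM ler_wpM2l ?nc_ge0 // fcoef_bound.
  by rewrite -mulr_suml ler_wpM2r ?hB // mulr_ge0.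
have e1 : 0 < e / (2 * (c + 1)) by rewrite divr_gt0 // mulr_gt0 // ltr_wpDl.
have [m0 hm0] := fsum_unif lb e1.
exists m0 => m m0m; rewrite -fcoef_fpartial //.
have -> : fcoef (fun x => f x * fpartial b m x) k - fcoef (fun x => f x * fsum b x) k
  = fcoef (fun x => f x * (fpartial b m x - fsum b x)) k.
  rewrite -[- _]mulN1r -fcoefZ -?fcoefD.
  - by apply: eq_fcoef => x _; rewrite mulN1r mulrBr.
  - by apply: bmM => //; exact: bm_fpartial.
  - by apply: bmM; [exact: bm_cst|apply: bmM => //; exact: bm_fsum].
  - by apply: bmM => //; exact: bm_fsum.
apply: le_trans (@fcoef_bound _ _ (c * (e / (2 * (c + 1)))) _ _) _.
- apply: bmM => //; apply: bmD; first exact: bm_fpartial.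
  have := bmM (bm_cst (- 1)) (bm_fsum lb); congr bm; apply/funext => x.
  by rewrite mulN1r.
- by move=> x Dx; rewrite ncM ler_pM ?nc_ge0 ?hc ?hm0.
rewrite (_ : 2 * _ = e * (c / (c + 1))); last by field; rewrite gt_eqF // ltr_wpDl.
by rewrite ler_piMr ?(ltW e0) // ler_pdivrMr ?ltr_wpDl // mul1r lerDl.
Qed.

End Period.
#[global] Hint Resolve mD : core.

Lemma perm_symr_opp n : perm_eq (symr n) [seq - k | k <- symr n].
Proof.
apply: uniq_perm; first exact: symr_uniq.
  by rewrite map_inj_uniq ?symr_uniq //; exact: oppr_inj.
have h (k : int) : (k \in symr n) = (k \in [seq - k | k <- symr n]).
  rewrite -[in RHS](opprK k) mem_map; last exact: oppr_inj.
  by rewrite !mem_symr abszN.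
exact: h.
Qed.

Section FourierFacts.
Variable R : realType.
Implicit Types (f g : R -> R[i]) (h : R -> R) (u a b : distr R) (x : R).
Local Notation mu := (@lebesgue_measure R).
Local Notation D := (`[0, 2 * pi]%classic : set R).

Lemma continuous_bounded_itv (h : R -> R) (a b : R) : a <= b -> {within `[a, b], continuous h} ->
  exists c, forall x, a <= x <= b -> `|h x| <= c.
Proof.
move=> ab ch.
have cn : {within `[a, b], continuous (fun x => `|h x|)}.
  by move=> x; apply: (continuous_comp (ch x)); exact: norm_continuous.
have [c _ hc] := EVT_max ab cn; exists `|h c| => x xab; apply: hc.
by rewrite in_itv.
Qed.

Lemma FTC_period (F h : R -> R) : (forall x, is_derive x 1 F (h x)) ->
  continuous h -> F 0 = F (2 * pi) -> \int[mu]_(x in D) h x = 0.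
Proof.
move=> dF ch F0.
have cF : continuous F by move=> x; apply/differentiable_continuous/derivable1_diffP/ex_derive.
rewrite /Rintegral (@continuous_FTC2 _ h F) ?twopi_gt0 //.
- by rewrite F0 subee.
- exact: continuous_subspaceT.
- split.
  + by move=> x _; exact: ex_derive.
  + exact/cvg_at_right_filter/cF.
  + exact/cvg_at_left_filter/cF.
- by move=> x _; rewrite derive1E; exact: derive_val.
Qed.

Lemma bm_cont h : continuous h -> bm (fun x => (h x)%:C%C).
Proof.
move=> ch.
have [c hc] := continuous_bounded_itv (ltW (twopi_gt0 R)) (continuous_subspaceT ch).
apply: (@bm_real _ _ c); first exact: continuous_measD.
by move=> x; rewrite /= in_itv => /hc.
Qed.

(** Integration by parts, carried out on h cos and h sin because the fundamental theorem used is a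
    real one. The boundary terms cancel since h takes equal values at both ends and the frequency is
    an integer. *)
Lemma fcoef_derive h (h' : R -> R) (k : int) : (forall x, is_derive x 1 h (h' x)) -> continuous h' ->
  h 0 = h (2 * pi) ->
  fcoef (fun x => (h' x)%:C%C) k = (0 +i* k%:~R)%C * fcoef (fun x => (h x)%:C%C) k.
Proof.
move=> dh ch' h0.
have ch : continuous h by move=> x; apply/differentiable_continuous/derivable1_diffP/ex_derive.
pose c x : R := cos (- (k%:~R * x)); pose s x : R := sin (- (k%:~R * x)).
have dc x : is_derive x 1 c (k%:~R * s x).
  rewrite /c; have H : is_derive x 1 (fun x : R => - (k%:~R * x)) (- k%:~R).
    by apply: is_deriveN; rewrite -[X in is_derive _ _ _ X]mulr1; apply: is_deriveZ.
  have H2 := @is_derive1_comp R cos (fun x => - (k%:~R * x)) x _ _ (is_derive_cos _) H.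
  by apply: (is_derive_eq H2); rewrite /s mulrNN mulrC.
have ds x : is_derive x 1 s (- (k%:~R * c x)).
  rewrite /s; have H : is_derive x 1 (fun x : R => - (k%:~R * x)) (- k%:~R).
    by apply: is_deriveN; rewrite -[X in is_derive _ _ _ X]mulr1; apply: is_deriveZ.
  have H2 := @is_derive1_comp R sin (fun x => - (k%:~R * x)) x _ _ (is_derive_sin _) H.
  by apply: (is_derive_eq H2); rewrite /c mulrN mulrC.
have cc : continuous c by move=> x; apply/differentiable_continuous/derivable1_diffP/ex_derive.
have cs : continuous s by move=> x; apply/differentiable_continuous/derivable1_diffP/ex_derive.
have k2 : cos (- (k%:~R * (2 * pi))) = 1 :> R /\ sin (- (k%:~R * (2 * pi))) = 0 :> R.
  have P n : cos (n%:R * (2 * pi)) = 1 :> R /\ sin (n%:R * (2 * pi)) = 0 :> R.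
    elim: n => [|n [IH1 IH2]]; first by rewrite mul0r cos0 sin0.
    have c2 (y : R) : cos (y + 2 * pi) = cos y by rewrite mulr_natl cosD2pi.
    have s2 (y : R) : sin (y + 2 * pi) = sin y by rewrite mulr_natl sinD2pi.
    by rewrite -natr1 mulrDl mul1r c2 s2.
  case: k {c s dc ds cc cs} => n.
    by have [h1 h2] := P n; rewrite cosN sinN h1 h2 oppr0.
  by have [h1 h2] := P n.+1; rewrite NegzE mulrNz mulNr opprK.
have I1 : \int[mu]_(x in D) (h' x * c x + k%:~R * (h x * s x)) = 0.
  apply: (@FTC_period (fun x => h x * c x)).
  - move=> x; apply: (is_derive_eq (is_deriveM (dh x) (dc x))).
    by rewrite /GRing.scale /=; ring.
  - move=> x; apply: cvgD; first by apply: cvgM; [exact: ch'|exact: cc].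
    by apply: cvgM; [exact: cvg_cst|apply: cvgM; [exact: ch|exact: cs]].
  - by rewrite /c mulr0 oppr0 cos0 k2.1 h0.
have I2 : \int[mu]_(x in D) (h' x * s x - k%:~R * (h x * c x)) = 0.
  apply: (@FTC_period (fun x => h x * s x)).
  - move=> x; apply: (is_derive_eq (is_deriveM (dh x) (ds x))).
    by rewrite /GRing.scale /=; ring.
  - move=> x; apply: cvgB; first by apply: cvgM; [exact: ch'|exact: cs].
    by apply: cvgM; [exact: cvg_cst|apply: cvgM; [exact: ch|exact: cc]].
  - by rewrite /s mulr0 oppr0 sin0 k2.2 !mulr0.
have int (g1 g2 : R -> R) : continuous g1 -> continuous g2 ->
    mu.-integrable D (EFin \o (fun x => g1 x * g2 x)).
  move=> c1 c2; apply: continuous_compact_integrable; first exact: segment_compact.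
  by apply: continuous_subspaceT => x; apply: cvgM; [exact: c1|exact: c2].
rewrite RintegralD ?RintegralZl in I1 => //; try exact: int; last first.
  by apply: integrable_EFinZ => //; exact: int.
rewrite RintegralB ?RintegralZl in I2 => //; try exact: int; last first.
  by apply: integrable_EFinZ => //; exact: int.
rewrite /fcoef [RHS]mulrCA; congr (_ * _); apply: eq_ReIm.
  rewrite cReM /cintegral /= mul0r sub0r.
  have -> : (fun x => complex.Re ((h' x)%:C%C * cis (- (k%:~R * x)))) = (fun x => h' x * c x).
    by apply/funext => x; rewrite cReM /= mul0r subr0.
  have -> : (fun x => complex.Im ((h x)%:C%C * cis (- (k%:~R * x)))) = (fun x => h x * s x).
    by apply/funext => x; rewrite cImM /= mul0r addr0.
  by apply/eqP; rewrite -addr_eq0; apply/eqP.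
rewrite cImM /cintegral /= mul0r add0r.
have -> : (fun x => complex.Im ((h' x)%:C%C * cis (- (k%:~R * x)))) = (fun x => h' x * s x).
  by apply/funext => x; rewrite cImM /= mul0r addr0.
have -> : (fun x => complex.Re ((h x)%:C%C * cis (- (k%:~R * x)))) = (fun x => h x * c x).
  by apply/funext => x; rewrite cReM /= mul0r subr0.
by apply/eqP; rewrite -subr_eq0; apply/eqP.
Qed.

Definition delta : distr R := fun k => (k == 0)%:R.

(** Orthogonality of the exponentials without computing an integral: for k nonzero, [fcoef_derive]
    applied to the constant 1 says that ik times the coefficient is the coefficient of 0. *)
Lemma fcoef1 : fcoef (fun=> 1) = delta.
Proof.
apply/funext => k; rewrite /delta.
have [->|k0] := eqVneq k 0.
  rewrite /fcoef /cintegral mulr0z.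
  have -> : (fun x : R => complex.Re (1 * cis (- (0 * x)))) = (fun=> 1 : R).
    by apply/funext => x; rewrite mul0r oppr0 cis0 mulr1.
  have -> : (fun x : R => complex.Im (1 * cis (- (0 * x)))) = (fun=> 0 : R).
    by apply/funext => x; rewrite mul0r oppr0 cis0 mulr1.
  rewrite !Rintegral_cst; [|exact: mD..]; have := muD R => /= ->.
  rewrite mul0r mul1r /=; apply: eq_ReIm.
    by rewrite cReM /= mul0r subr0 mulVf // gt_eqF ?twopi_gt0.
  by rewrite cImM /= mulr0 mul0r addr0.
have E : fcoef (fun x : R => (0 : R)%:C%C) k =
    (0 +i* k%:~R)%C * fcoef (fun x : R => (1 : R)%:C%C) k.
  apply: (@fcoef_derive (fun=> 1) (fun=> 0)) => [x|]; last by [].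
  exact: cvg_cst.
have z : fcoef (fun=> 0) k = 0 :> R[i].
  have := @fcoefZ R 0 (fun=> 0) k (bm_cst _); rewrite [RHS]mul0r => h0; apply: etrans h0.
  by apply: eq_fcoef => x _; rewrite [RHS]mul0r.
have H : (0 +i* k%:~R)%C * fcoef (fun=> 1) k = 0 :> R[i] by rewrite -[RHS]z [RHS]E.
apply/eqP; move/eqP: H; rewrite mulf_eq0 => /orP[/eqP[] /eqP|//].
by rewrite intr_eq0 (negbTE k0).
Qed.

Lemma fconv_delta b : l1 b -> fconv delta b = b.
Proof.
move=> lb; apply/funext => k; rewrite /fconv.
apply: csum_uniq => [|e e0].
  have [B hB] := lb; exists B; apply: sumle_le hB => j.
  rewrite ncM /delta; case: (_ == _); rewrite ?mulr1n ?mulr0n.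
    by rewrite ComplexField.Normc.normc1 mulr1.
  by rewrite ComplexField.Normc.normc0 mulr0 nc_ge0.
exists (absz k) => m km; rewrite /psum (bigD1_seq k) ?symr_uniq ?mem_symr //=.
rewrite big1 ?addr0 => [|j jk]; last by rewrite /delta subr_eq0 eq_sym (negbTE jk) mulr0.
by rewrite /delta subrr eqxx mulr1 subrr ComplexField.Normc.normc0 ltW.
Qed.

Lemma fcoef_fsum_id b : l1 b -> fcoef (fsum b) = b.
Proof.
move=> lb; have := fcoef_fsum (bm_cst 1) lb; rewrite fcoef1 fconv_delta // => h.
by apply: etrans h; apply/funext => k; apply: eq_fcoef => x _; rewrite [RHS]mul1r.
Qed.

Lemma fcoef_fsumM a b : l1 a -> l1 b ->
  fcoef (fun x => fsum a x * fsum b x) = fconv a b.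
Proof. by move=> la lb; rewrite fcoef_fsum ?fcoef_fsum_id //; exact: bm_fsum. Qed.

Lemma cconjM (z w : R[i]) : (z * w)^*%C = z^*%C * w^*%C.
Proof. by case: z w => [p q] [r t]; apply: eq_ReIm => /=; ring. Qed.

Lemma fpartial_conj u n x : (fpartial u n x)^*%C = fpartial (dist_conj u) n x.
Proof.
rewrite !fpartialE /psum rmorph_sum /=.
have -> : \sum_(k <- symr n) dist_conj u k * cis (k%:~R * x) =
    \sum_(k <- [seq - k | k <- symr n]) dist_conj u k * cis (k%:~R * x).
  by apply: perm_big; exact: perm_symr_opp.
rewrite big_map; apply: eq_bigr => k _.
have E (j : int) : (u j * cis (j%:~R * x))^*%C = dist_conj u (- j) * cis ((- j)%:~R * x).
  by rewrite cconjM /dist_conj opprK cis_conj mulrNz mulNr.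
exact: E.
Qed.

Lemma psum_opp (F : int -> R[i]) n : psum F n = psum (fun k => F (- k)) n.
Proof.
rewrite /psum -(big_map -%R xpredT F); by apply: perm_big; exact: perm_symr_opp.
Qed.

(** Reads a Toeplitz form as the mean of f |u_n|^2. For f >= 0 this gives the sign of the damping
    form ([fcoef_pos]), for f = 1 Parseval's identity ([L2normsq_fpartial]). *)
Lemma fcoef_quad f u n : bm f ->
  fcoef (fun x => f x * (fpartial u n x)^*%C * fpartial u n x) 0 =
  \sum_(j <- symr n) \sum_(k <- symr n) u j * ((u k)^*%C * fcoef f (k - j)).
Proof.
move=> bf; rewrite fcoef_fpartial; last first.
  by apply: bmM => //; exact: bm_conj (bm_fpartial _ _).
apply: eq_bigr => j _.
have -> : fcoef (fun x => f x * (fpartial u n x)^*%C) (0 - j) =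
    fcoef (fun x => f x * fpartial (dist_conj u) n x) (0 - j).
  by apply: eq_fcoef => x _; rewrite fpartial_conj.
rewrite fcoef_fpartial // psum_opp /psum -mulr_sumr; congr (_ * _).
have E (k : int) : dist_conj u (- k) * fcoef f (0 - j - - k) = (u k)^*%C * fcoef f (k - j).
  by rewrite /dist_conj !opprK sub0r addrC.
by apply: eq_bigr => k _; exact: E.
Qed.

Lemma fcoef_pos h u n : continuous h -> (forall x, 0 <= h x) ->
  0 <= complex.Re (\sum_(j <- symr n) \sum_(k <- symr n)
     u j * ((u k)^*%C * fcoef (fun x => (h x)%:C%C) (k - j))).
Proof.
move=> ch h0; rewrite -fcoef_quad; last exact: bm_cont.
rewrite /fcoef cReM /= mul0r subr0 mulr_ge0 ?invr_ge0 ?(ltW (twopi_gt0 _)) //.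
apply: Rintegral_ge0 => x _; rewrite mulr0z mul0r oppr0 cis0 mulr1 -mulrA cReM /= mul0r subr0.
rewrite mulr_ge0 //; case: (fpartial u n x) => p q /=.
by rewrite mulNr opprK -!expr2 addr_ge0 ?sqr_ge0.
Qed.

Lemma fcoef_real_conj h k : continuous h ->
  fcoef (fun x => (h x)%:C%C) (- k) = (fcoef (fun x => (h x)%:C%C) k)^*%C.
Proof.
move=> ch; have [c1 c2] := cint_fcoef k (bm_cont ch).
rewrite /fcoef rmorphM /= [(_^-1 +i* - 0)%C](_ : _ = ((2 * pi)^-1)%:C%C); last by rewrite oppr0.
congr (_ * _); rewrite /cintegral /=; congr (_ +i* _)%C.
  apply: eq_Rintegral => x _; by rewrite /= mulrNz mulNr opprK cosN !mul0r.
rewrite -mulN1r -RintegralZl //.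
apply: eq_Rintegral => x _; rewrite /= mulrNz mulNr opprK sinN !mul0r !addr0.
by rewrite mulN1r mulrN opprK.
Qed.

End FourierFacts.

(** * Decay of the Fourier coefficients of a smooth periodic function *)

Section CutoffDecay.
Variable R : realType.
Implicit Types (h : R -> R).

Lemma derive1_periodic h p : (forall x, h (x + p) = h x) ->
  forall x, derive1 h (x + p) = derive1 h x.
Proof.
move=> hp x; rewrite /derive1.
have -> : (fun y : R => y^-1 *: (h (y + (x + p)) - h (x + p))) =
  (fun y => y^-1 *: (h (y + x) - h x)) by apply/funext => y; rewrite addrA !hp.
by [].
Qed.

Lemma derive1n_periodic h p n : (forall x, h (x + p) = h x) ->
  forall x, derive1n n h (x + p) = derive1n n h x.
Proof. by move=> hp; elim: n => [//|n IH] x; rewrite !derive1nS; exact: derive1_periodic. Qed.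

Lemma smooth_continuous (n : nat) h : smooth h -> continuous (derive1n n h).
Proof. by move=> sh x; apply/differentiable_continuous/derivable1_diffP/sh. Qed.

Lemma fcoef_derive1n h n k : smooth h -> (forall x, h (x + 2 * pi) = h x) ->
  fcoef (fun x => (derive1n n h x)%:C%C) k =
  (0 +i* k%:~R)%C ^+ n * fcoef (fun x => (h x)%:C%C) k.
Proof.
move=> sh ph; elim: n => [|n IH]; first by rewrite expr0 mul1r.
rewrite exprS -mulrA -IH; apply: fcoef_derive.
- by move=> x; rewrite derive1nS derive1E; apply: derivableP; exact: sh.
- exact: smooth_continuous.
- by have := derive1n_periodic n ph 0; rewrite add0r.
Qed.

(** Four derivatives: two pay for the weight of order 2 and two for summability. With y = k^2, the
    inequality (1+y)^2 <= 2 (1+y^2) turns the bounds on the coefficients of h and of its fourth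
    derivative into the constant below, and [sumle_inv_sq] supplies the 5. *)
Lemma smooth_fcoef_l1 h : smooth h -> (forall x, h (x + 2 * pi) = h x) ->
  exists C, sumle (fun k => wt 2 k * nc (fcoef (fun x => (h x)%:C%C) k)) C.
Proof.
move=> sh ph.
have bnd n : exists c, forall k, nc (fcoef (fun x => (derive1n n h x)%:C%C) k) <= 2 * c.
  have [_ [c hc]] := bm_cont (@smooth_continuous n _ sh).
  exists c => k; apply: fcoef_bound => //; exact: bm_cont (@smooth_continuous n _ sh).
have [c0 h0] := bnd 0%N; have [c4 h4] := bnd 4%N.
exists ((4 * (`|c0| + `|c4|)) * 5).
apply: sumle_le (sumleZ _ (@sumle_inv_sq R)) => [k|]; last by rewrite mulr_ge0 ?addr_ge0.
have w2 : wt 2 k = (1 + k%:~R ^+ 2) :> R.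
  by rewrite -wt1_sq expr2 -wtD; congr wt; ring.
rewrite w2; have := h4 k; rewrite fcoef_derive1n // ncM; have := h0 k.
have -> : nc ((0 +i* k%:~R)%C ^+ 4) = (k%:~R ^+ 2) ^+ 2 :> R.
  rewrite (exprM _ 2 2) expr2.
  have -> : (0 +i* k%:~R)%C ^+ 2 = (- (k%:~R ^+ 2))%:C%C :> R[i].
    by apply: eq_ReIm; rewrite expr2 ?cReM ?cImM /= ?mul0r ?mulr0 ?sub0r ?addr0 // -expr2.
  by rewrite -rmorphM nc_real mulrNN -expr2 ger0_norm ?sqr_ge0.
rewrite [derive1n 0 h]/=.
move: (nc _) (nc_ge0 (fcoef (fun x => (h x)%:C%C) k)) => X X0.
have : 0 <= k%:~R ^+ 2 :> R by apply: sqr_ge0.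
move: (k%:~R ^+ 2 : R) => y y0 e1 e2.
rewrite ler_pdivlMr; last by lra.
have := ler_norm c0; have := ler_norm c4.
have : 0 <= (1 - y) ^+ 2 by apply: sqr_ge0.
move=> H; have : 0 <= (1 - y) ^+ 2 * X by apply: mulr_ge0.
by rewrite sqrrB; nra.
Qed.

End CutoffDecay.

Lemma EFin_cvg (R : realType) (u : nat -> R) (l : R) :
  u n @[n --> \oo] --> l -> (u n)%:E @[n --> \oo] --> l%:E.
Proof. by move=> h; apply/fine_cvgP; split; [exact: nearW|exact: h]. Qed.

(** * Riesz-Fischer *)

Section SquareIntegrable.
Context d (T : measurableType d) (R : realType) (mu : {measure set T -> \bar R}).
Variable D : set T.
Hypothesis mD : measurable D.
Implicit Types f g : T -> R.

Definition Q f : \bar R := (\int[mu]_(x in D) ((f x) ^+ 2)%:E)%E.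

Lemma measurable_sq f : measurable_fun D f -> measurable_fun D (fun x => ((f x) ^+ 2)%:E).
Proof. by move=> mf; apply/measurable_EFinP; exact: measurable_funX. Qed.

Lemma Q_ge0 f : (0 <= Q f)%E.
Proof. by apply: integral_ge0 => x _; rewrite lee_fin sqr_ge0. Qed.

Lemma Q_le f g : measurable_fun D f -> measurable_fun D g ->
  (forall x, D x -> f x ^+ 2 <= g x ^+ 2) -> (Q f <= Q g)%E.
Proof.
move=> mf mg fg; apply: ge0_le_integral => //.
- by move=> x _; rewrite lee_fin sqr_ge0.
- exact: measurable_sq.
- exact: measurable_sq.
Qed.

Lemma Q_combine f g (h : T -> R) (a b : R) : 0 <= a -> 0 <= b ->
  measurable_fun D f -> measurable_fun D g -> measurable_fun D h ->
  (forall x, D x -> f x ^+ 2 <= a * g x ^+ 2 + b * h x ^+ 2) ->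
  (Q f <= a%:E * Q g + b%:E * Q h)%E.
Proof.
move=> a0 b0 mf mg mh fgh; rewrite /Q.
rewrite -!ge0_integralZl_EFin //; try exact: measurable_sq;
  try by move=> x _; rewrite lee_fin sqr_ge0.
rewrite -ge0_integralD //; try (by move=> x _; rewrite -EFinM lee_fin mulr_ge0 ?sqr_ge0);
  try (by apply: measurable_funeM; exact: measurable_sq).
apply: ge0_le_integral => //.
- by move=> x _; rewrite lee_fin sqr_ge0.
- exact: measurable_sq.
- by apply: emeasurable_funD; apply: measurable_funeM; exact: measurable_sq.
Qed.

(* [|f| <= k f^2 + 1/k] *)
Lemma L1_le_L2 f (k e : R) : 0 < k -> measurable_fun D f -> (Q f <= e%:E)%E ->
  (\int[mu]_(x in D) `|f x|%:E <= (k * e)%:E + k^-1%:E * mu D)%E.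
Proof.
move=> k0 mf Qe.
apply: (@le_trans _ _ (\int[mu]_(x in D) (k%:E * ((f x) ^+ 2)%:E + k^-1%:E))%E).
  apply: ge0_le_integral => //.
  - by apply/measurable_EFinP; exact: measurableT_comp.
  - by apply: emeasurable_funD => //; apply: measurable_funeM; exact: measurable_sq.
  move=> x _; rewrite -EFinM -EFinD lee_fin.
  have [x1|x1] := lerP `|f x| k^-1.
    by apply: le_trans x1 _; rewrite lerDr mulr_ge0 ?sqr_ge0 ?ltW.
  have : 1 <= k * `|f x| by rewrite -ler_pdivrMl // mulr1 ltW.
  move=> h; apply: (@le_trans _ _ (k * f x ^+ 2)); last by rewrite lerDl invr_ge0 ltW.
  by rewrite -[f x ^+ 2]real_normK ?num_real // expr2 mulrA ler_peMl.
rewrite ge0_integralD //.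
- rewrite integral_cst // ge0_integralZl_EFin //; try exact: measurable_sq.
  + by rewrite leeD2r // EFinM lee_pmul2l.
  + by move=> x _; rewrite lee_fin sqr_ge0.
  + exact: ltW.
- by move=> x _; rewrite -EFinM lee_fin mulr_ge0 ?sqr_ge0 ?ltW.
- by apply: measurable_funeM; exact: measurable_sq.
- by move=> x _; rewrite lee_fin invr_ge0 ltW.
Qed.

Hypothesis finD : (mu D < +oo)%E.

Lemma L2_integrable f : measurable_fun D f -> (Q f < +oo)%E ->
  mu.-integrable D (EFin \o f).
Proof.
move=> mf Qf; apply/integrableP; split; first exact/measurable_EFinP.
have Qfin : Q f \is a fin_num by rewrite ge0_fin_numE ?Q_ge0.
have := L1_le_L2 ltr01 mf (e := fine (Q f)); rewrite fineK // => /(_ (lexx _)).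
rewrite invr1 mul1e => h; apply: le_lt_trans h _.
by rewrite lte_add_pinfty // ltry.
Qed.

Variable r : nat -> T -> R.
Hypothesis mr : forall n, measurable_fun D (r n).
Hypothesis cr : forall e : R, 0 < e -> exists m0, forall m n, (m0 <= m)%N -> (m0 <= n)%N ->
  (Q (fun x => (r m x - r n x)%R) <= e%:E)%E.

Let mB m n : measurable_fun D (fun x => r m x - r n x).
Proof. exact: measurable_funB. Qed.

(* A subsequence with [sum_i |r (n i.+1) - r (n i)|] integrable converges almost
   everywhere; Fatou's lemma identifies its limit with the mean-square limit. *)
Lemma L2_complete : exists f, measurable_fun D f /\
  forall e : R, 0 < e -> exists m0, forall m, (m0 <= m)%N ->
    (Q (fun x => (r m x - f x)%R) <= e%:E)%E.
Proof.
have p2 i : 0 < (2^-1 : R) ^+ i by rewrite exprn_gt0.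
(* The rate is 4^(-i): [L1_le_L2] with k = 2^i turns it into an L^1 bound c 2^(-i) with c = 1 +
   mu(D). *)
have /choice[N hN] : forall i : nat, exists m0 : nat, forall m n, (m0 <= m)%N -> (m0 <= n)%N ->
    (Q (fun x => (r m x - r n x)%R) <= ((2^-1) ^+ i * (2^-1) ^+ i)%:E)%E.
  by move=> i; apply: cr; rewrite mulr_gt0.
(* A running sum of successors is increasing and dominates both [N i] and i. *)
pose n i := (\sum_(j < i.+1) (N j).+1)%N.
have nS i : n i.+1 = (n i + (N i.+1).+1)%N by rewrite /n big_ord_recr.
have nN i : (N i <= n i)%N by case: i => [|i]; [rewrite /n big_ord1|rewrite nS addnS ltnW // ltnS leq_addl].
have ni i : (i <= n i)%N by elim: i => // i IH; rewrite nS addnS ltnS (leq_trans IH) ?leq_addr.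
pose dd i x := `|r (n i.+1) x - r (n i) x|.
have mdd i : measurable_fun D (dd i) by apply: measurableT_comp => //; exact: mB.
pose S x := (\sum_(0 <= i <oo) (dd i x)%:E)%E.
have mS : measurable_fun D S.
  apply: ge0_emeasurable_sum => [k x _ _|k _]; first by rewrite lee_fin normr_ge0.
  exact/measurable_EFinP.
have muDfin : mu D \is a fin_num by rewrite ge0_fin_numE.
pose c := 1 + fine (mu D).
have Idd i : (\int[mu]_(x in D) (dd i x)%:E <= (c * (2^-1) ^+ i)%:E)%E.
  have k0 : 0 < (2 : R) ^+ i by rewrite exprn_gt0.
  have nNS : (N i <= n i.+1)%N by rewrite nS (leq_trans (nN i)) ?leq_addr.
  apply: le_trans (L1_le_L2 k0 (mB (n i.+1) (n i)) (hN i _ _ nNS (nN i))) _.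
  rewrite -(fineK muDfin) -EFinM -EFinD lee_fin /c mulrDl mul1r exprVn.
  by rewrite mulrA mulfV ?gt_eqF // mul1r [X in _ + X]mulrC.
have c0 : 0 <= c by rewrite addr_ge0 // fine_ge0.
have IS : (\int[mu]_(x in D) S x < +oo)%E.
  rewrite integral_nneseries //; last first.
  - by move=> k x _; rewrite lee_fin normr_ge0.
  - by move=> k; exact/measurable_EFinP.
  apply: (@le_lt_trans _ _ (c * 2)%:E); last exact: ltry.
  apply: lime_le.
    by apply: is_cvg_nneseries => k _ _; apply: integral_ge0 => x _; rewrite lee_fin normr_ge0.
  apply: nearW => m; apply: (@le_trans _ _ (\sum_(0 <= i < m) (c * (2^-1) ^+ i)%:E)%E).
    by apply: lee_sum => i _; exact: Idd.
  rewrite sumEFin lee_fin -mulr_sumr ler_wpM2l //.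
  suff -> : \sum_(0 <= i < m) (2^-1 : R) ^+ i = 2 - 2 * (2^-1) ^+ m.
    by rewrite lerBlDr lerDl mulr_ge0 // ltW.
  elim: m => [|m IH]; first by rewrite big_nil expr0 mulr1 subrr.
  by rewrite big_nat_recr //= IH exprS; field.
have iS : mu.-integrable D S.
  apply/integrableP; split => //.
  rewrite (eq_integral S) // => x _; rewrite gee0_abs //.
  by apply: nneseries_ge0 => k _ _; rewrite lee_fin normr_ge0.
(* The upper limit is defined and measurable everywhere; where [S x] is infinite, on a null set, its
   value is irrelevant. *)
pose f x := fine (limn_esup (fun i => (r (n i) x)%:E)).
have cvx x : S x \is a fin_num -> r (n i) x @[i --> \oo] --> f x.
  move=> Sx.
  have cr' : cvgn (fun i => r (n i) x).
    pose v i := r (n i.+1) x - r (n i) x.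
    have : cvgn (series v).
      apply: normed_cvg; apply: nondecreasing_is_cvgn.
        apply/nondecreasing_seqP => m.
        by rewrite /= /series /= big_nat_recr //= lerDl normr_ge0.
      exists (fine (S x)) => _ [m _ <-]; rewrite -lee_fin fineK // /series /= -sumEFin.
      by apply: nneseries_lim_ge => k _ _; rewrite lee_fin normr_ge0.
    have -> : series v = fun m => r (n m) x - r (n 0%N) x.
      by apply/funext => m; rewrite /series /= telescope_sumr.
    move=> h; have -> : (fun i => r (n i) x) = (fun i => (r (n i) x - r (n 0%N) x) + r (n 0%N) x).
      by apply/funext => i; rewrite subrK.
    by apply: is_cvgD => //; exact: is_cvg_cst.
  suff -> : f x = limn (fun i => r (n i) x) by [].
  have h : (r (n i) x)%:E @[i --> \oo] --> (limn (fun i => r (n i) x))%:E.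
    exact: EFin_cvg cr'.
  by rewrite /f (cvg_limn_einf_sup h).2.
have mf : measurable_fun D f.
  apply: (measurableT_comp (fine_measurable measurableT)).
  by apply: measurable_fun_limn_esup => i; exact/measurable_EFinP.
exists f; split => // e e0; have [m0 hm0] := cr e0.
exists m0 => m m0m.
(* The shift by m0 keeps every index within the range where the Cauchy estimate for e holds, so each
   integral in Fatou's lemma is at most e. *)
pose G j x := ((r m x - r (n (m0 + j)%N) x) ^+ 2)%:E.
have mG j : measurable_fun D (G j) by apply: measurable_sq; exact: mB.
have G0 j x : (0 <= G j x)%E by rewrite lee_fin sqr_ge0.
apply: (@le_trans _ _ (\int[mu]_(x in D) limn_einf (G^~ x))%E).
  apply: ae_ge0_le_integral => //.
  - by move=> x _; rewrite lee_fin sqr_ge0.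
  - by apply: measurable_sq; exact: measurable_funB.
  - move=> x _; rewrite limn_einf_lim; apply: lime_ge; first exact: is_cvg_einfs.
    by apply: nearW => j; apply: le_ereal_inf_tmp => _ [k _ <-]; exact: G0.
  - have -> : (fun x => limn_einf (G^~ x)) = (fun x => - limn_esup (fun j => - G j x))%E.
      by apply/funext => x; rewrite -[LHS]oppeK -limn_esupN.
    apply: measurableT_comp => //; apply: measurable_fun_limn_esup => j.
    by apply: measurableT_comp.
  have := integrable_ae mD iS; apply: filterS => x Sx Dx; have {Sx} cx := cvx x (Sx Dx).
  have h : G j x @[j --> \oo] --> ((r m x - f x) ^+ 2)%:E.
    have h1 : (r m x - r (n (m0 + j)%N) x) ^+ 2 @[j --> \oo] --> (r m x - f x) ^+ 2.
      have h2 : r m x - r (n (m0 + j)%N) x @[j --> \oo] --> r m x - f x.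
        apply: cvgB; first exact: cvg_cst.
        move: cx; rewrite -(cvg_shiftn m0) => cx; by under eq_fun do rewrite addnC; exact: cx.
      by rewrite expr2; under eq_fun do rewrite expr2; apply: cvgM; exact: h2.
    exact: EFin_cvg h1.
  by rewrite (cvg_limn_einf_sup h).1.
apply: le_trans (fatou mu mD mG (fun j x _ => G0 j x)) _.
rewrite limn_einf_lim; apply: lime_le; first exact: is_cvg_einfs.
apply: nearW => j; apply: (@le_trans _ _ (\int[mu]_(x in D) G j x)%E).
  by apply: ereal_inf_lbound; exists j => //=.
by apply: hm0 => //; apply: leq_trans (ni _); rewrite leq_addr.
Qed.

End SquareIntegrable.

Section RieszFischer.
Variable R : realType.
Implicit Types (f g : R -> R[i]) (u w : distr R).
Local Notation mu := (@lebesgue_measure R).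
Local Notation D := (`[0, 2 * pi]%classic : set R).

Lemma hn_sumle u : inH 0 u -> sumle (fun k => nc (u k) ^+ 2) (hn 0 u ^+ 2).
Proof.
by move=> /hn_hb[_ h]; apply: sumle_le h => k; rewrite wt0 mul1r.
Qed.

Lemma hb0_sumle u B : 0 <= B -> sumle (fun k => nc (u k) ^+ 2) (B ^+ 2) -> hb 0 u B.
Proof. by move=> B0 h; split => //; apply: sumle_le h => k; rewrite wt0 mul1r. Qed.

Lemma hn_sq_le u B : sumle (fun k => nc (u k) ^+ 2) B -> hn 0 u ^+ 2 <= B.
Proof.
move=> h; have B0 := sumle_ge0 h.
rewrite -(sqr_sqrtr B0) ler_pXn2r ?nnegrE ?hn_ge0 ?sqrtr_ge0 //.
by apply/hn_le/hb0_sumle; rewrite ?sqrtr_ge0 // sqr_sqrtr.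
Qed.

Lemma hn_psum u : inH 0 u -> forall e : R, 0 < e -> exists m0,
  hn 0 u ^+ 2 <= \sum_(k <- symr m0) nc (u k) ^+ 2 + e.
Proof.
move=> /hn_sumle h e e0.
have [m0 hm0] := sumle_tail (fun k => sqr_ge0 (nc (u k))) h e0.
exists m0; apply: hn_sq_le => s us.
have [m1 sm1] := seq_symr s.
have h1 := ler_sum_sub (fun k => sqr_ge0 (nc (u k))) us (symr_uniq _)
  (fun k ks => sub_symr (leq_maxr m0 m1) (sm1 k ks)).
apply: le_trans h1 _; rewrite (bigID (mem (symr m0)) xpredT) /=.
have ms := sub_symr (leq_maxl m0 m1).
rewrite sum_mem_sub ?symr_uniq // lerD2l; apply: hm0 => //; exact: symr_uniq.
Qed.

Lemma L2normsqE f : cmeas f -> L2normsq f =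
  (Q mu D (fun x => complex.Re (f x)) + Q mu D (fun x => complex.Im (f x)))%E.
Proof.
move=> [mr mi]; rewrite /Q -ge0_integralD //; try (by apply: measurable_sq);
  try by move=> x _; rewrite lee_fin sqr_ge0.
by rewrite /L2normsq; apply: eq_integral => x _; rewrite nc_sq EFinD.
Qed.

Lemma cmeasB f g : cmeas f -> cmeas g -> cmeas (fun x => f x - g x).
Proof.
move=> [f1 f2] [g1 g2]; split.
  rewrite (_ : (fun x => _) = (fun x => complex.Re (f x) - complex.Re (g x))).
    exact: measurable_funB.
  by apply/funext => x; rewrite cReD cReN.
rewrite (_ : (fun x => _) = (fun x => complex.Im (f x) - complex.Im (g x))).
  exact: measurable_funB.
by apply/funext => x; rewrite cImD cImN.
Qed.

Lemma cmeas_nc f : cmeas f -> measurable_fun D (fun x => nc (f x)).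
Proof.
move=> [mr mi].
have -> : (fun x => nc (f x)) = (fun x => Num.sqrt (complex.Re (f x) ^+ 2 + complex.Im (f x) ^+ 2)).
  by apply/funext => x; rewrite -nc_sq sqrtr_sqr ger0_norm ?nc_ge0.
apply: (@measurableT_comp _ _ _ _ _ _ (@Num.sqrt R)).
  by apply: continuous_measurable_fun; exact: sqrt_continuous.
by apply: measurable_funD; exact: measurable_funX.
Qed.

Lemma L2normsq_Q f : L2normsq f = Q mu D (fun x => nc (f x)).
Proof. by []. Qed.

Lemma L2normsq_ge0 f : (0 <= L2normsq f)%E.
Proof. exact: Q_ge0. Qed.

Lemma L2normsq_combine f g h (a b : R) : 0 <= a -> 0 <= b ->
  cmeas f -> cmeas g -> cmeas h ->
  (forall x, nc (f x) ^+ 2 <= a * nc (g x) ^+ 2 + b * nc (h x) ^+ 2) ->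
  (L2normsq f <= a%:E * L2normsq g + b%:E * L2normsq h)%E.
Proof.
move=> a0 b0 mf mg mh fgh; rewrite !L2normsq_Q.
by apply: Q_combine => //; exact: cmeas_nc.
Qed.

(** Young's inequality with a free parameter. The leading factor 1 + d can be brought close to 1,
    the error z - w being made small afterwards, which gives equality of norms in the limit. *)
Lemma nc_sq_weighted (z w : R[i]) (d : R) : 0 < d ->
  nc z ^+ 2 <= (1 + d) * nc w ^+ 2 + (1 + d^-1) * nc (z - w) ^+ 2.
Proof.
move=> d0; have h : nc z <= nc w + nc (z - w).
  by have := ncD w (z - w); rewrite addrC subrK.
apply: (@le_trans _ _ ((nc w + nc (z - w)) ^+ 2)).
  by rewrite ler_pXn2r ?nnegrE ?addr_ge0 ?nc_ge0.
move: (nc w) (nc (z - w)) => a b.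
rewrite -subr_ge0.
have -> : (1 + d) * a ^+ 2 + (1 + d^-1) * b ^+ 2 - (a + b) ^+ 2 = d^-1 * (d * a - b) ^+ 2.
  by field; rewrite gt_eqF.
by rewrite mulr_ge0 ?sqr_ge0 // invr_ge0 ltW.
Qed.

Lemma L2normsq_fpartial u n :
  L2normsq (fpartial u n) = (2 * pi * \sum_(k <- symr n) nc (u k) ^+ 2)%:E.
Proof.
have bP := bm_fpartial u n.
have H : complex.Re (fcoef (fun x => 1 * (fpartial u n x)^*%C * fpartial u n x) 0) =
   \sum_(k <- symr n) nc (u k) ^+ 2.
  rewrite (@fcoef_quad _ (fun=> 1)); last exact: bm_cst.
  rewrite Re_sum; apply: eq_big_seq => j jn.
  rewrite (bigD1_seq j) ?symr_uniq //= big1 ?addr0 => [|k kj].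
    rewrite fcoef1 /delta subrr eqxx mulr1 nc_sq; case: (u j) => p q.
    by rewrite cReM /=; ring.
  by rewrite fcoef1 /delta subr_eq0 (negbTE kj) mulr0 mulr0.
rewrite -H /fcoef cReM /= mul0r subr0 mulrA mulfV ?gt_eqF ?twopi_gt0 // mul1r.
have [_ [c hc]] := bP.
have I : mu.-integrable D (EFin \o (fun x => nc (fpartial u n x) ^+ 2)).
  apply: (@bnd_integrable _ _ (c ^+ 2)).
    by apply: measurable_funX; apply: cmeas_nc; case: bP.
  move=> x Dx; rewrite ger0_norm ?sqr_ge0 // ler_pXn2r ?nnegrE ?nc_ge0 ?hc //.
  exact: le_trans (nc_ge0 _) (hc x Dx).
rewrite /Rintegral fineK; last first.
  rewrite (@eq_integral _ _ _ mu D (fun x => (nc (fpartial u n x) ^+ 2)%:E)).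
    exact: integrable_fin_num.
  move=> x _; rewrite /= mulr0z mul0r oppr0 cis0 mulr1 mul1r nc_sq.
  by case: (fpartial u n x) => p q; rewrite cReM /=; congr EFin; ring.
rewrite /L2normsq; apply: eq_integral => x _.
rewrite /= mulr0z mul0r oppr0 cis0 mulr1 mul1r nc_sq.
by case: (fpartial u n x) => p q; rewrite cReM /=; congr EFin; ring.
Qed.

Lemma L2normsq_fpartialB u m n : (n <= m)%N ->
  L2normsq (fun x => fpartial u m x - fpartial u n x) =
  (2 * pi * \sum_(k <- symr m | k \notin symr n) nc (u k) ^+ 2)%:E.
Proof.
move=> nm; pose w : distr R := fun k => if k \in symr n then 0 else u k.
have -> : (fun x => fpartial u m x - fpartial u n x) = fpartial w m.
  apply/funext => x; rewrite !fpartialE /psum.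
  rewrite (bigID (mem (symr n)) xpredT) /= sum_mem_sub ?symr_uniq //; last exact: sub_symr.
  rewrite addrAC subrr add0r [RHS](bigID (mem (symr n)) xpredT) /=.
  rewrite [X in _ = X + _]big1 ?add0r => [|k kn]; last by rewrite /w kn mul0r.
  by apply: eq_bigr => k /negbTE kn; rewrite /w kn.
rewrite L2normsq_fpartial (bigID (mem (symr n)) xpredT) /=.
rewrite big1 ?add0r => [|k kn]; last by rewrite /w kn ComplexField.Normc.normc0 expr0n.
by congr (_ * _)%:E; apply: eq_bigr => k /negbTE kn; rewrite /w kn.
Qed.

(* [f] is the mean-square limit of the Fourier series of [u]. *)
Definition RF f u := inL2 f /\ forall e : R, 0 < e -> exists m0, forall m, (m0 <= m)%N ->
  (L2normsq (fun x => (f x - fpartial u m x)%R) <= e%:E)%E.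

Lemma cmeas_fpartial u n : cmeas (fpartial u n).
Proof. by case: (bm_fpartial u n). Qed.

Lemma muD_fin : (mu D < +oo)%E.
Proof. by have := muD R => /= ->; exact: ltry. Qed.

(** By Parseval the partial sums are Cauchy in mean square; real and imaginary parts are completed
    separately by [L2_complete] and reassembled. *)
Lemma RF_exists u : inH 0 u -> exists f, RF f u.
Proof.
move=> hu.
have cau (e : R) : 0 < e -> exists m0, forall m n, (m0 <= m)%N -> (m0 <= n)%N ->
    (L2normsq (fun x => (fpartial u m x - fpartial u n x)%R) <= e%:E)%E.
  move=> e0; have e1 : 0 < e / (2 * pi) by rewrite divr_gt0 ?twopi_gt0.
  have [m0 hm0] := sumle_tail (fun k => sqr_ge0 (nc (u k))) (hn_sumle hu) e1.
  have key m n : (m0 <= n)%N -> (n <= m)%N ->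
      (L2normsq (fun x => (fpartial u m x - fpartial u n x)%R) <= e%:E)%E.
    move=> m0n nm; rewrite L2normsq_fpartialB // lee_fin mulrC -ler_pdivlMr ?twopi_gt0 //.
    apply: le_trans (hm0 (symr m) (symr_uniq _) (sub_symr (leq_trans m0n nm))).
    rewrite -[leLHS]big_filter -[leRHS]big_filter; apply: ler_sum_sub.
    - by move=> k; exact: sqr_ge0.
    - by rewrite filter_uniq ?symr_uniq.
    - by rewrite filter_uniq ?symr_uniq.
    move=> k; rewrite !mem_filter => /andP[kn ->]; rewrite andbT.
    by apply: contra kn; exact: sub_symr.
  exists m0 => m n m0m m0n; have [nm|/ltnW mn] := leqP n m; first exact: key.
  have := key n m m0m mn; congr (_ <= _)%E; apply: eq_integral => x _.
  by rewrite nc_distC.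
have part (re : R[i] -> R) : (forall x y, re (x - y) = re x - re y) ->
    (forall x, `|re x| <= nc x) -> (forall n, measurable_fun D (fun x => re (fpartial u n x))) ->
    exists h : R -> R, measurable_fun D h /\
      forall e : R, 0 < e -> exists m0, forall m, (m0 <= m)%N ->
        (Q mu D (fun x => (re (fpartial u m x) - h x)%R) <= e%:E)%E.
  move=> reB re_le mre.
  apply: (L2_complete (mu := mu) _ muD_fin mre) => // e /cau[m0 hm0].
  exists m0 => m n m0m m0n; apply: le_trans (hm0 m n m0m m0n).
  rewrite L2normsq_Q; apply: Q_le => //; try (by apply: measurable_funB; exact: mre);
    try (by apply: cmeas_nc; apply: cmeasB; exact: cmeas_fpartial).
  by move=> x _; rewrite -reB -(real_normK (num_real (re _))) ler_pXn2r ?nnegrE ?nc_ge0.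
have [p [mp hp]] := part (@complex.Re R) (fun x y => etrans (cReD _ _) (congr1 _ (cReN _)))
  (@Re_le_nc R) (fun n => (cmeas_fpartial u n).1).
have [q [mq hq]] := part (@complex.Im R) (fun x y => etrans (cImD _ _) (congr1 _ (cImN _)))
  (@Im_le_nc R) (fun n => (cmeas_fpartial u n).2).
pose f x : R[i] := (p x +i* q x)%C.
have mf : cmeas f by [].
have cv (e : R) : 0 < e -> exists m0, forall m, (m0 <= m)%N ->
  (L2normsq (fun x => (f x - fpartial u m x)%R) <= e%:E)%E.
  move=> e0; have e2 : 0 < e / 2 by rewrite divr_gt0.
  have [m0 hm0] := hp _ e2; have [m1 hm1] := hq _ e2.
  exists (maxn m0 m1) => m; rewrite geq_max => /andP[/hm0 h0 /hm1 h1].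
  rewrite L2normsqE; last by apply: cmeasB => //; exact: cmeas_fpartial.
  rewrite [e]splitr EFinD; apply: leeD.
    apply: le_trans h0; apply: Q_le => //.
    - by case: (cmeasB mf (cmeas_fpartial u m)).
    - by apply: measurable_funB => //; exact: (cmeas_fpartial u m).1.
    - by move=> x _; rewrite cReD cReN /= -sqrrN opprB.
  apply: le_trans h1; apply: Q_le => //.
  - by case: (cmeasB mf (cmeas_fpartial u m)).
  - by apply: measurable_funB => //; exact: (cmeas_fpartial u m).2.
  - by move=> x _; rewrite cImD cImN /= -sqrrN opprB.
exists f; split => //; split; [by case: mf|by case: mf|].
have [m0 hm0] := cv 1 ltr01.
have h := L2normsq_combine (f := f) (g := fpartial u m0) (h := fun x => f x - fpartial u m0 x)
  (a := 1 + 1) (b := 1 + 1^-1) _ _ mf (cmeas_fpartial u m0) (cmeasB mf (cmeas_fpartial u m0))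
  (fun x => nc_sq_weighted _ _ ltr01).
apply: le_lt_trans (h _ _) _; rewrite ?addr_ge0 ?invr_ge0 //.
rewrite lte_add_pinfty //; first by rewrite L2normsq_fpartial -EFinM ltry.
apply: lte_mul_pinfty => //; try (by rewrite ?lee_fin ?addr_ge0 ?invr_ge0).
exact: le_lt_trans (hm0 m0 (leqnn _)) (ltry _).
Qed.

Lemma RFB f g u w : RF f u -> RF g w -> RF (fun x => f x - g x) (dist_sub u w).
Proof.
move=> [[f1 f2 f3] hf] [[g1 g2 g3] hg].
have mf : cmeas f by []. have mg : cmeas g by [].
have mfg := cmeasB mf mg.
have sq2 (a b : R[i]) : nc (a - b) ^+ 2 <= 2 * nc a ^+ 2 + 2 * nc b ^+ 2.
  have h : nc (a - b) ^+ 2 <= (nc a + nc b) ^+ 2.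
    by rewrite ler_pXn2r ?nnegrE ?addr_ge0 ?nc_ge0 ?ncB.
  by have := sqr_ge0 (nc a - nc b); nra.
split.
  split; [by case: mfg|by case: mfg|].
  have h := L2normsq_combine (f := fun x => f x - g x) (g := f) (h := g) (a := 2) (b := 2)
    _ _ mfg mf mg (fun x => sq2 _ _).
  apply: le_lt_trans (h _ _) _ => //.
  by rewrite lte_add_pinfty // lte_mul_pinfty.
move=> e e0; have e4 : 0 < e / 4 by rewrite divr_gt0.
have [m0 hm0] := hf _ e4; have [m1 hm1] := hg _ e4.
exists (maxn m0 m1) => m; rewrite geq_max => /andP[/hm0 h0 /hm1 h1].
have -> : (fun x => f x - g x - fpartial (dist_sub u w) m x) =
   (fun x => (f x - fpartial u m x) - (g x - fpartial w m x)).
  apply/funext => x; rewrite !fpartialE /psum /dist_sub.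
  under eq_bigr do rewrite mulrBl.
  by rewrite sumrB; ring.
have h := L2normsq_combine (f := fun x => (f x - fpartial u m x) - (g x - fpartial w m x))
  (g := fun x => f x - fpartial u m x) (h := fun x => g x - fpartial w m x) (a := 2) (b := 2)
    _ _ (cmeasB (cmeasB mf (cmeas_fpartial _ _)) (cmeasB mg (cmeas_fpartial _ _)))
    (cmeasB mf (cmeas_fpartial _ _)) (cmeasB mg (cmeas_fpartial _ _)) (fun x => sq2 _ _).
apply: le_trans (h _ _) _ => //.
have -> : e%:E = (2%:E * (e / 4)%:E + 2%:E * (e / 4)%:E)%E.
  by rewrite -!EFinM -EFinD; congr EFin; field.
by apply: leeD; rewrite lee_pmul2l.
Qed.

Lemma RF_L2normsq f u : inH 0 u -> RF f u -> L2normsq f = (2 * pi * hn 0 u ^+ 2)%:E.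
Proof.
move=> hu [[f1 f2 f3] hf]; have mf : cmeas f by [].
have tp := twopi_gt0 R.
have Af : L2normsq f \is a fin_num by rewrite ge0_fin_numE ?L2normsq_ge0.
rewrite -(fineK Af); congr EFin; set A := fine _.
have AE : L2normsq f = A%:E by rewrite fineK.
have A0 : 0 <= A by rewrite fine_ge0 ?L2normsq_ge0.
pose B := 2 * pi * hn 0 u ^+ 2.
have B0 : 0 <= B by rewrite mulr_ge0 ?sqr_ge0 ?(ltW tp).
have ineq1 (d e : R) : 0 < d -> 0 < e -> A <= (1 + d) * B + (1 + d^-1) * e.
  move=> d0 e0; have [m0 hm0] := hf _ e0.
  have := L2normsq_combine (a := 1 + d) (b := 1 + d^-1) _ _ mf (cmeas_fpartial u m0)
    (cmeasB mf (cmeas_fpartial u m0)) (fun x => nc_sq_weighted _ _ d0).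
  have d1 : 0 <= 1 + d by lra.
  have d2 : 0 <= 1 + d^-1 by rewrite addr_ge0 // invr_ge0 ltW.
  move=> /(_ d1 d2); rewrite AE L2normsq_fpartial => h.
  rewrite -lee_fin; apply: le_trans h _; rewrite !EFinD !EFinM.
  apply: leeD.
    rewrite -!EFinM lee_fin ler_wpM2l // ler_wpM2l ?(ltW tp) //.
    exact: hn_sumle (symr_uniq _).
  by apply: lee_wpmul2l; rewrite ?lee_fin ?hm0.
have ineq2 (d e : R) : 0 < d -> 0 < e -> B <= (1 + d) * A + (1 + d^-1) * e + e.
  move=> d0 e0; have [m0 hm0] := hf _ e0.
  have e1 : 0 < e / (2 * pi) by rewrite divr_gt0.
  have [m1 hm1] := hn_psum hu e1.
  pose m := maxn m0 m1.
  have := L2normsq_combine (a := 1 + d) (b := 1 + d^-1) _ _ (cmeas_fpartial u m) mf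
    (cmeasB (cmeas_fpartial u m) mf) (fun x => nc_sq_weighted _ _ d0).
  have d1 : 0 <= 1 + d by lra.
  have d2 : 0 <= 1 + d^-1 by rewrite addr_ge0 // invr_ge0 ltW.
  move=> /(_ d1 d2); rewrite AE L2normsq_fpartial => h.
  have h2 : (L2normsq (fun x => fpartial u m x - f x)%R <= e%:E)%E.
    have := hm0 m (leq_maxl _ _); congr (_ <= _)%E; apply: eq_integral => x _.
    by rewrite nc_distC.
  have h3 : 2 * pi * (\sum_(k <- symr m) nc (u k) ^+ 2) <= (1 + d) * A + (1 + d^-1) * e.
    rewrite -lee_fin; apply: le_trans h _; rewrite !EFinD !EFinM leeD2l //.
    by apply: lee_wpmul2l; rewrite ?lee_fin.
  apply: (@le_trans _ _ (2 * pi * (\sum_(k <- symr m) nc (u k) ^+ 2) + e)); last by rewrite lerD2r.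
  have -> : e = 2 * pi * (e / (2 * pi)) by rewrite mulrC divfK // gt_eqF.
  rewrite -mulrDr /B ler_wpM2l ?(ltW tp) //; apply: le_trans hm1 _; rewrite lerD2r.
  apply: ler_sum_sub; rewrite ?symr_uniq //; first by move=> k; exact: sqr_ge0.
  exact: sub_symr (leq_maxr _ _).
(* Removes both parameters at once: d is taken so small that d y <= e/2, and then e' so that all
   error terms together make e/2. *)
have lim (x y c : R) : 0 <= y -> 0 <= c -> (forall d e, 0 < d -> 0 < e ->
    x <= (1 + d) * y + (1 + d^-1) * e + c * e) -> x <= y.
  move=> y0 c0 h; apply/ler_addgt0Pl => e e0.
  pose d := e / (2 * (y + 1)).
  have d0 : 0 < d by rewrite divr_gt0 // mulr_gt0 // ltr_wpDl.
  pose e' := e / 2 / (1 + d^-1 + c).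
  have q0 : 0 < 1 + d^-1 + c by rewrite ltr_pwDl // addr_gt0 // invr_gt0.
  have e'0 : 0 < e' by rewrite divr_gt0 // divr_gt0.
  apply: le_trans (h d e' d0 e'0) _.
  have -> : (1 + d) * y + (1 + d^-1) * e' + c * e' = y + d * y + (1 + d^-1 + c) * e' by ring.
  have -> : (1 + d^-1 + c) * e' = e / 2 by rewrite /e' mulrC divfK // gt_eqF.
  have : d * y <= e / 2.
    rewrite /d (_ : e / (2 * (y + 1)) * y = (e / 2) * (y / (y + 1))).
      by rewrite ler_piMr ?divr_ge0 ?(ltW e0) // ler_pdivrMr ?ltr_wpDl // mul1r lerDl.
    by field; rewrite gt_eqF // ltr_wpDl.
  lra.
apply/eqP; rewrite eq_le; apply/andP; split.
  by apply: (lim A B 0) => // d e d0 e0; rewrite mul0r addr0 ineq1.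
by apply: (lim B A 1) => // d e d0 e0; rewrite mul1r ineq2.
Qed.

(** Continuity of a Fourier coefficient in L^2, with the parameter of [L1_le_L2] left free. The
    factor 2 accounts for the real and imaginary parts. *)
Lemma fcoef_L2_bound f k (e d : R) : cmeas f -> 0 < d -> (L2normsq f <= e%:E)%E ->
  cint (fun x => f x * cis (- (k%:~R * x))) /\
  nc (fcoef f k) <= 2 * (2 * pi)^-1 * (d * e + d^-1 * (2 * pi)).
Proof.
move=> mf d0 Lf.
pose g x : R[i] := f x * cis (- (k%:~R * x)).
have bc : bm (fun x => cis (- (k%:~R * x)) : R[i]).
  by have := bm_cis (- k%:~R : R); congr bm; apply/funext => x; rewrite mulNr.
have mg : cmeas g.
  have [[b1 b2] _] := bc; have [m1 m2] := mf; split.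
    rewrite (_ : (fun x => _) = (fun x => complex.Re (f x) * complex.Re (cis (- (k%:~R * x))) -
      complex.Im (f x) * complex.Im (cis (- (k%:~R * x))))); last by apply/funext => x; rewrite cReM.
    by apply: measurable_funB; exact: measurable_funM.
  rewrite (_ : (fun x => _) = (fun x => complex.Re (f x) * complex.Im (cis (- (k%:~R * x))) +
      complex.Im (f x) * complex.Re (cis (- (k%:~R * x))))); last by apply/funext => x; rewrite cImM.
  by apply: measurable_funD; exact: measurable_funM.
have part (re : R[i] -> R) : (forall x, `|re x| <= nc x) -> measurable_fun D (fun x => re (g x)) ->
    mu.-integrable D (EFin \o (fun x => re (g x))) /\
    `|\int[mu]_(x in D) re (g x)| <= d * e + d^-1 * (2 * pi).
  move=> re_le mre.
  have Qre : (Q mu D (fun x => re (g x)) <= e%:E)%E.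
    apply: le_trans Lf; rewrite L2normsq_Q; apply: Q_le => //; first exact: cmeas_nc.
    move=> x _; rewrite -(real_normK (num_real (re _))) ler_pXn2r ?nnegrE ?nc_ge0 //.
    by apply: le_trans (re_le _) _; rewrite /g ncM nc_cis mulr1.
  have I : mu.-integrable D (EFin \o (fun x => re (g x))).
    by apply: L2_integrable => //; [exact: muD_fin|exact: le_lt_trans Qre (ltry _)].
  split => //; apply: le_trans (le_normr_Rintegral _ I) _ => //.
  have h := @L1_le_L2 _ _ _ mu D (measurable_itv _) (fun x => re (g x)) d e d0 mre Qre.
  rewrite -lee_fin /Rintegral fineK.
    apply: le_trans h _; have := muD R => /= ->.
    by rewrite -EFinM -EFinD.
  by have := integrable_fin_num _ (integrable_norm I); apply.
have [i1 b1] := part _ (@Re_le_nc R) mg.1.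
have [i2 b2] := part _ (@Im_le_nc R) mg.2.
split => //; rewrite /fcoef ncM nc_real ger0_norm ?invr_ge0 ?(ltW (twopi_gt0 R)) //.
rewrite [2 / _]mulrC -mulrA ler_wpM2l ?invr_ge0 ?(ltW (twopi_gt0 R)) //.
apply: le_trans (nc_le_ReIm _) _; apply: (@le_trans _ _ ((d * e + d^-1 * (2 * pi)) + (d * e + d^-1 * (2 * pi)))).
  exact: (lerD b1 b2).
by rewrite [leRHS]mulr_natl mulr2n.
Qed.

Lemma RF_fcoef f u : RF f u -> fcoef f = u.
Proof.
move=> [[f1 f2 f3] hf]; have mf : cmeas f by [].
apply/funext => k; apply/eqP; rewrite -subr_eq0; apply/eqP; apply: nc_small => e e0.
have tp := twopi_gt0 R.
(* With this d and the next e', each of the two terms of [fcoef_L2_bound] contributes exactly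
   e/2. *)
pose d := 4 / e.
have d0 : 0 < d by rewrite divr_gt0.
pose e' := e * (2 * pi) / 4 / d.
have e'0 : 0 < e' by rewrite !divr_gt0 ?mulr_gt0 ?pi_gt0.
have [m0 hm0] := hf _ e'0.
pose m := maxn m0 (absz k).
have uE : u k = fcoef (fpartial u m) k.
  have := fcoef_fpartial u m k (bm_cst 1).
  rewrite fcoef1 => h; have {h} -> : fcoef (fpartial u m) k = psum (fun j => u j * delta R (k - j)) m.
    rewrite -h; apply: eq_fcoef => x _; by rewrite mul1r.
  rewrite /psum (bigD1_seq k) ?symr_uniq ?mem_symr ?leq_maxr //=.
  rewrite big1 ?addr0 => [|j jk]; last by rewrite /delta subr_eq0 eq_sym (negbTE jk) mulr0.
  by rewrite /delta subrr eqxx mulr1.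
have mfm := cmeasB mf (cmeas_fpartial u m).
have [c1 b1] := fcoef_L2_bound k mfm d0 (hm0 m (leq_maxl _ _)).
have c2 : cint (fun x => fpartial u m x * cis (- (k%:~R * x))) by apply: cint_fcoef; exact: bm_fpartial.
have -> : fcoef f k - u k = fcoef (fun x => f x - fpartial u m x) k.
  rewrite uE /fcoef -mulrBr; congr (_ * _); apply/eqP; rewrite subr_eq -cintegralD //; apply/eqP.
  by apply: eq_cintegral => x _; rewrite -mulrDl subrK.
apply: le_trans b1 _; rewrite le_eqVlt; apply/orP; left; apply/eqP.
have -> : d * e' = e * (2 * pi) / 4 by rewrite /e' mulrC divfK // gt_eqF.
have -> : d^-1 = e / 4 by rewrite /d invf_div.
move: (2 * pi) tp => P P0.
by field; rewrite gt_eqF.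
Qed.

End RieszFischer.

(** * Test functions and weak derivatives in time *)

Section Derivatives.
Variable R : realType.
Implicit Types (f g : R -> R) (x l e t : R) (n m : nat).
Local Notation mu := (@lebesgue_measure R).

Lemma is_derive_epsP f x l : is_derive x 1 f l <->
  forall e, 0 < e -> exists2 d : R, 0 < d & forall h, h != 0 -> `|h| < d ->
    `|h^-1 * (f (x + h) - f x) - l| <= e.
Proof.
have E : (fun h : R => h^-1 *: (f (h *: 1 + x) - f x)) = (fun h => h^-1 * (f (x + h) - f x)).
  by apply/funext => h; rewrite /GRing.scale /= mulr1 [h + x]addrC.
split=> [[dx dv] e e0|H].
  have : h^-1 * (f (x + h) - f x) @[h --> 0^'] --> l.
    by move: dx; rewrite /derivable E -dv /derive E.
  move/cvgrPdist_le => /(_ e e0); rewrite near_withinE => -[d /= d0 hd].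
  exists d => // h h0 hd'; rewrite distrC; apply: hd => //.
  by rewrite /ball /= sub0r normrN.
have C : h^-1 * (f (x + h) - f x) @[h --> 0^'] --> l.
  apply/cvgrPdist_le => e e0; have [d d0 hd] := H e e0.
  rewrite near_withinE; exists d => //= h; rewrite /ball /= sub0r normrN => hd' h0.
  by rewrite distrC hd.
apply: DeriveDef; first by rewrite /derivable E; exact: cvgP C.
by rewrite /derive E; exact: cvg_lim C.
Qed.

Lemma is_derive_local f g x l (d : R) : 0 < d ->
  (forall y, `|y - x| < d -> f y = g y) -> is_derive x 1 g l -> is_derive x 1 f l.
Proof.
move=> d0 fg /is_derive_epsP H; apply/is_derive_epsP => e /H[d' d'0 hd'].
exists (Num.min d d'); first by rewrite lt_min d0.
move=> h h0; rewrite lt_min => /andP[hd hd2].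
by rewrite !fg ?subrr ?normr0 // ?hd' // addrC addKr.
Qed.

Lemma is_derive_cont f x l : is_derive x 1 f l -> {for x, continuous f}.
Proof. by move=> h; apply/differentiable_continuous/derivable1_diffP/ex_derive. Qed.

(** Differentiability n times, with the recursion passing to the derivative of f first. Closure
    under products, inverses and affine substitutions is then a plain induction; [smooth] iterates
    on the outside. *)
Fixpoint nsm n f : Prop :=
  if n is n'.+1 then (forall x, derivable f x 1) /\ nsm n' (derive1 f) else True.

Lemma nsm_smooth f : (forall n, nsm n f) -> smooth f.
Proof.
move=> h n; move: (h n.+1); elim: n f {h} => [|n IH] f; first by case.
by move=> [df /IH]; rewrite derive1Sn.
Qed.

Lemma nsmI n f g : (forall x, is_derive x 1 f (g x)) -> nsm n g -> nsm n.+1 f.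
Proof.
move=> dfg ng; split; first by move=> x; exact: ex_derive.
rewrite (_ : derive1 f = g) //.
by apply/funext => x; rewrite derive1E; exact: derive_val.
Qed.

Lemma nsm_der n f x : nsm n.+1 f -> is_derive x 1 f (derive1 f x).
Proof. by move=> [df _]; rewrite derive1E; apply: derivableP. Qed.

Lemma nsmS n f : nsm n.+1 f -> nsm n f.
Proof. by elim: n f => [//|n IH] f [df /IH]. Qed.

Lemma nsm_cst n (c : R) : nsm n (fun=> c).
Proof.
elim: n c => [//|n IH] c; apply: (@nsmI _ _ (fun=> 0)) => // x.
Qed.

Lemma nsmD n f g : nsm n f -> nsm n g -> nsm n (fun x => f x + g x).
Proof.
elim: n f g => [//|n IH] f g nf ng.
apply: (@nsmI _ _ (fun x => derive1 f x + derive1 g x)).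
  by move=> x; exact: (is_deriveD (nsm_der x nf) (nsm_der x ng)).
by apply: IH; [case: nf|case: ng].
Qed.

Lemma nsmM n f g : nsm n f -> nsm n g -> nsm n (fun x => f x * g x).
Proof.
elim: n f g => [//|n IH] f g nf ng.
apply: (@nsmI _ _ (fun x => f x * derive1 g x + g x * derive1 f x)).
  by move=> x; exact: (is_deriveM (nsm_der x nf) (nsm_der x ng)).
by apply: nsmD; apply: IH; [exact: nsmS|case: ng|exact: nsmS|case: nf].
Qed.

Lemma nsmV n f : (forall x, f x != 0) -> nsm n f -> nsm n (fun x => (f x)^-1).
Proof.
move=> f0; elim: n => [//|n IH] nf.
apply: (@nsmI _ _ (fun x => (- 1) * ((f x)^-1 * (f x)^-1 * derive1 f x))).
  move=> x; have H := is_deriveV (f0 x) (nsm_der x nf).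
  apply: (is_derive_eq H); rewrite /GRing.scale /= -exprVn expr2; ring.
apply: nsmM; first exact: nsm_cst.
apply: nsmM; last by case: nf.
by apply: nsmM; apply: IH; exact: nsmS.
Qed.

Lemma nsm_affine n f (a b : R) : nsm n f -> nsm n (fun x => f (a * x + b)).
Proof.
elim: n f => [//|n IH] f nf.
apply: (@nsmI _ _ (fun x => derive1 f (a * x + b) * a)).
  move=> x.
  have d : is_derive x 1 (fun x => a * x + b) a.
    have H := is_deriveD (is_deriveZ a (is_derive_id x (1 : R))) (is_derive_cst b x (1 : R)).
    by apply: (is_derive_eq H); rewrite addr0 /GRing.scale /= mulr1.
  exact: (@is_derive1_comp R f (fun x => a * x + b) x _ _ (nsm_der _ nf) d).
by apply: nsmM; [apply: IH; case: nf|exact: nsm_cst].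
Qed.

(** The flat function exp(-1/t) multiplied by t^(-m). The powers make the family stable: each
    derivative is a linear combination of members ([is_derive_em]), so smoothness follows by
    induction. *)
Definition em m (t : R) : R := if 0 < t then (t^-1) ^+ m * expR (- t^-1) else 0.

Lemma em_ge0 m t : 0 <= em m t.
Proof.
rewrite /em; case: ifP => // t0.
by rewrite mulr_ge0 ?expR_ge0 // exprn_ge0 // invr_ge0 ltW.
Qed.

Lemma em_gt0 t : 0 < t -> 0 < em 0 t.
Proof. by move=> t0; rewrite /em t0 expr0 mul1r expR_gt0. Qed.

Lemma em0 m t : t <= 0 -> em m t = 0.
Proof. by rewrite leNgt /em => /negbTE ->. Qed.

(* From [exp (1/t) >= (1/t)^(m+2) / (m+2)!]. *)
Lemma em_small m t : 0 < t -> em m t <= (m.+2)`!%:R * t ^+ 2.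
Proof.
move=> t0; rewrite /em t0.
have it0 : 0 <= t^-1 by rewrite invr_ge0 ltW.
have := expR_ge1Dxn m.+1 it0 => h.
have {}h : t^-1 ^+ m.+2 / (m.+2)`!%:R <= expR t^-1.
  by apply: le_trans h; rewrite lerDr.
have f0 : 0 < (m.+2)`!%:R :> R by rewrite ltr0n fact_gt0.
rewrite expRN -ler_pdivrMr ?exprn_gt0 // ler_pdivrMr ?exprn_gt0 //.
rewrite ler_pdivrMr ?expR_gt0 //.
have -> : (t^-1) ^+ m = (t^-1) ^+ m.+2 * t ^+ 2.
  by rewrite -addn2 exprD -mulrA -exprMn mulVf ?gt_eqF // expr1n mulr1.
move: h; rewrite ler_pdivrMr // => h.
by rewrite [leRHS]mulrAC ler_wpM2r ?sqr_ge0 // mulrC.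
Qed.

Lemma is_derive_em m t : is_derive t 1 (em m) (- m%:R * em m.+1 t + em m.+2 t).
Proof.
have [t0|t0|->] := ltgtP t 0.
- rewrite !em0 ?(ltW t0) // mulr0 addr0.
  apply: (@is_derive_local _ (cst 0) _ _ (- t)); first by rewrite oppr_gt0.
  move=> y; rewrite ltr_norml opprK => /andP[_ h].
  by rewrite em0 //; move: h; rewrite ltrBlDr addNr => /ltW.
- apply: (@is_derive_local _ (fun t => (t^-1) ^+ m * expR (- t^-1)) _ _ t) => //.
    move=> y; rewrite ltr_norml => /andP[h _].
    by rewrite /em; move: h; rewrite ltrBrDl subrr => ->.
  have tn0 : t != 0 by rewrite gt_eqF.
  have dV : is_derive t 1 (fun t : R => t^-1) (- (t^-1 * t^-1)).
    have H := @is_deriveV _ (@id R) t 1 1 tn0 (is_derive_id _ _).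
    by apply: (is_derive_eq H); rewrite /GRing.scale /= mulr1 -exprVn expr2.
  have dX : is_derive t 1 (fun t : R => t^-1 ^+ m) (- m%:R * t^-1 ^+ m.+1).
    elim: m => [|m IH].
      rewrite oppr0 mul0r; exact: (is_derive_cst (1 : R) t (1 : R)).
    have -> : (fun t : R => t^-1 ^+ m.+1) = (fun t => t^-1 * t^-1 ^+ m).
      by apply/funext => y; rewrite exprS.
    apply: (is_derive_eq (is_deriveM dV IH)).
    by rewrite /GRing.scale /= -natr1 !exprS; ring.
  have dE : is_derive t 1 (fun t : R => expR (- t^-1)) (expR (- t^-1) * (t^-1 * t^-1)).
    have dN : is_derive t 1 (fun t : R => - t^-1) (t^-1 * t^-1).
      by have := is_deriveN dV; rewrite opprK.
    exact: (@is_derive1_comp R expR (fun t => - t^-1) t _ _ (is_derive_expR _) dN).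
  apply: (is_derive_eq (is_deriveM dX dE)).
  by rewrite /em t0 /GRing.scale /= !exprS; ring.
(* At the origin flatness decides: [em_small] bounds the function by (m+2)! h^2, so the difference
   quotient is of order h. *)
rewrite !em0 // mulr0 addr0; apply/is_derive_epsP => e e0.
exists (e / (m.+2)`!%:R); first by rewrite divr_gt0 // ltr0n fact_gt0.
move=> h h0 hd; rewrite add0r (em0 m (lexx 0)) !subr0.
have [hn|hp] := lerP h 0; first by rewrite em0 // mulr0 normr0 ltW.
rewrite ger0_norm ?mulr_ge0 ?invr_ge0 ?em_ge0 ?(ltW hp) //.
apply: (@le_trans _ _ ((m.+2)`!%:R * h)).
  by rewrite mulrC ler_pdivrMr // -mulrA -expr2; exact: em_small.
rewrite mulrC -ler_pdivlMr ?ltr0n ?fact_gt0 //; apply: ltW.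
by move: hd; rewrite ger0_norm // ltW.
Qed.

Lemma nsm_em n m : nsm n (em m).
Proof.
elim: n m => [//|n IH] m.
apply: (nsmI (@is_derive_em m)); apply: nsmD; last exact: IH.
by apply: nsmM; [exact: nsm_cst|exact: IH].
Qed.

(* A smooth step: [0] for [t <= 0] and [1] for [t >= 1]. *)
Definition step (t : R) : R := em 0 t * (em 0 t + em 0 (- 1 * t + 1))^-1.

Lemma step_den t : 0 < em 0 t + em 0 (- 1 * t + 1).
Proof.
have [t0|t0] := ltP 0 t; first by rewrite ltr_pwDl ?em_gt0 ?em_ge0.
rewrite ltr_wpDl ?em_ge0 ?em_gt0 //; lra.
Qed.

Lemma nsm_step n : nsm n step.
Proof.
apply: nsmM; first exact: nsm_em.
apply: nsmV; first by move=> x; rewrite gt_eqF ?step_den.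
by apply: nsmD; [exact: nsm_em|apply: nsm_affine; exact: nsm_em].
Qed.

Lemma step0 t : t <= 0 -> step t = 0.
Proof. by move=> t0; rewrite /step em0 // mul0r. Qed.

Lemma step1 t : 1 <= t -> step t = 1.
Proof.
move=> t1; rewrite /step [em 0 (- 1 * t + 1)]em0; last by lra.
by rewrite addr0 mulfV // gt_eqF // em_gt0; lra.
Qed.

Definition dstep t := derive1 step t.

Lemma is_derive_step t : is_derive t 1 step (dstep t).
Proof. exact: nsm_der (nsm_step 1). Qed.

Lemma step_nd s t : s <= t -> step s <= step t.
Proof.
have emnd a b : a <= b -> em 0 a <= em 0 b.
  move=> ab; have [a0|a0] := lerP a 0; first by rewrite em0 ?em_ge0.
  have b0 : 0 < b by apply: lt_le_trans ab.
  by rewrite /em a0 b0 !expr0 !mul1r ler_expR lerN2 lef_pV2.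
move=> st; rewrite /step.
rewrite ler_pdivrMr ?step_den // mulrAC ler_pdivlMr ?step_den //.
have := emnd _ _ st; have : em 0 (- 1 * t + 1) <= em 0 (- 1 * s + 1) by apply: emnd; lra.
have := em_ge0 0 s; have := em_ge0 0 (- 1 * t + 1); have := em_ge0 0 t.
move: (em 0 s) (em 0 t) (em 0 (- 1 * t + 1)) (em 0 (- 1 * s + 1)) => a b c d; nra.
Qed.

Lemma dstep_ge0 t : 0 <= dstep t.
Proof.
rewrite leNgt; apply/negP => d0.
have /is_derive_epsP := is_derive_step t.
move=> /(_ (- dstep t / 2)); rewrite divr_gt0 ?oppr_gt0 // => /(_ isT)[d dp hd].
have h0 : 0 < d / 2 by rewrite divr_gt0.
have := hd (d / 2); rewrite gt_eqF // gtr0_norm // => /(_ isT).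
have -> : d / 2 < d by lra.
move=> /(_ isT); rewrite ler_norml => /andP[_].
have : 0 <= (d / 2)^-1 * (step (t + d / 2) - step t).
  by rewrite mulr_ge0 ?invr_ge0 ?(ltW h0) // subr_ge0 step_nd //; lra.
lra.
Qed.

Lemma dstep_out t : ~~ (0 <= t <= 1) -> dstep t = 0.
Proof.
rewrite negb_and -!ltNge => /orP[t0|t1].
  have H : is_derive t 1 step 0.
    apply: (@is_derive_local _ (cst 0) _ _ (- t)); first by rewrite oppr_gt0.
      move=> y; rewrite ltr_norml opprK => /andP[_ h].
      by rewrite step0 //; move: h; rewrite ltrBlDr addNr => /ltW.
  by rewrite /dstep derive1E; exact: derive_val.
have H : is_derive t 1 step 0.
  apply: (@is_derive_local _ (cst 1) _ _ (t - 1)); first by lra.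
    by move=> y; rewrite ltr_norml => /andP[h _]; rewrite step1 //; lra.
by rewrite /dstep derive1E; exact: derive_val.
Qed.

Lemma continuous_dstep : continuous dstep.
Proof.
move=> t; have h : nsm 1 dstep by case: (nsm_step 2).
exact: is_derive_cont (nsm_der t h).
Qed.

End Derivatives.

(** * Integration by parts in time and the du Bois-Reymond lemma *)

Section TimeIntegrals.
Variable R : realType.
Implicit Types (f g k phi : R -> R) (t s e d T : R).
Local Notation mu := (@lebesgue_measure R).

Lemma within_itv_eps f T : (forall t, 0 <= t <= T -> forall e, 0 < e -> exists2 d, 0 < d &
    forall t', 0 <= t' <= T -> `|t' - t| < d -> `|f t' - f t| <= e) ->
  {within `[0, T], continuous f}.
Proof.
move=> H; apply/subspace_continuousP => t /=; rewrite in_itv /= => tT.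
apply/cvgrPdist_le => e e0; have [d d0 hd] := H t tT e e0.
rewrite near_withinE; exists d => //= t' td; rewrite in_itv /= => t'T.
by rewrite distrC; apply: hd => //; rewrite distrC.
Qed.

Lemma within_itv_interior f T t : {within `[0, T], continuous f} -> 0 < t < T ->
  {for t, continuous f}.
Proof.
move=> cf /[dup] tT /andP[t0 tT'].
have [h _ _] := (continuous_within_itvP f (lt_trans t0 tT')).1 cf.
by apply: h; rewrite in_itv.
Qed.

Lemma within_integrable f T : {within `[0, T], continuous f} ->
  mu.-integrable `[0, T] (EFin \o f).
Proof. by move=> cf; apply: continuous_compact_integrable => //; exact: segment_compact. Qed.

Lemma is_derive_primitive f T t : {within `[0, T], continuous f} -> 0 < t < T ->
  is_derive t 1 (fun x => \int[mu]_(y in `[0, x]) f y) (f t).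
Proof.
move=> cf tT; have /andP[t0 tT'] := tT.
have [h1 h2] := continuous_FTC1_closed tT' (within_integrable cf) t0 (within_itv_interior cf tT).
by apply: DeriveDef; [exact: h1|rewrite -derive1E].
Qed.

(** Nothing is assumed on the integrability of [dg], so it is never integrated. The function phi g
    minus the primitive of phi' g + phi k has nonpositive derivative and equals 0 at time 0; the
    mean value theorem shows that the primitive is nonnegative at T. *)
Lemma ibp_le T phi g (dg : R -> R) k : 0 < T -> testfun T phi ->
  {within `[0, T], continuous g} -> {within `[0, T], continuous k} ->
  (forall t, 0 < t < T -> is_derive t 1 g (dg t)) ->
  (forall t, 0 < t < T -> phi t * dg t <= phi t * k t) ->
  - (\int[mu]_(t in `[0, T]) (derive1 phi t * g t)) <=
  \int[mu]_(t in `[0, T]) (phi t * k t).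
Proof.
move=> T0 [sphi [a [b [a0 bT pout]]]] cg ck dg' hk.
have cp : continuous phi by exact: (@smooth_continuous _ 0 _ sphi).
have cp' : continuous (derive1 phi) by exact: (@smooth_continuous _ 1 _ sphi).
have c1 : {within `[0, T], continuous (fun t => derive1 phi t * g t)}.
  by move=> t; apply: cvgM; [exact: (continuous_subspaceT cp')|exact: cg].
have c2 : {within `[0, T], continuous (fun t => phi t * k t)}.
  by move=> t; apply: cvgM; [exact: (continuous_subspaceT cp)|exact: ck].
pose q t := derive1 phi t * g t + phi t * k t.
have cq : {within `[0, T], continuous q} by move=> t; apply: cvgD; [exact: c1|exact: c2].
pose P t := \int[mu]_(y in `[0, t]) q y.
pose H t := phi t * g t - P t.
have cP : {within `[0, T], continuous P}.
  exact: (parameterized_integral_continuous (ltW T0) (within_integrable cq)).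
have cH : {within `[0, T], continuous H}.
  move=> t; apply: cvgB; last exact: cP.
  by apply: cvgM; [exact: (continuous_subspaceT cp)|exact: cg].
have dH t : t \in `]0, T[%R -> is_derive t 1 H (phi t * dg t - phi t * k t).
  rewrite in_itv /= => tT.
  have dphi : is_derive t 1 phi (derive1 phi t).
    by rewrite derive1E; apply: derivableP; exact: (sphi 0%N).
  apply: (is_derive_eq (is_deriveB (is_deriveM dphi (dg' t tT)) (is_derive_primitive cq tT))).
  by rewrite /q /GRing.scale /=; ring.
have [c] := MVT T0 dH cH; rewrite in_itv /= subr0 => cT E.
have p0 : phi 0 = 0 by apply: pout; rewrite negb_and -ltNge a0.
have pT : phi T = 0 by apply: pout; rewrite negb_and -!ltNge bT orbT.
have P0 : P 0 = 0 by rewrite /P set_itv1 Rintegral_set1.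
move: E; rewrite /H p0 pT P0 !mul0r !sub0r oppr0 subr0 => E.
have : P T >= 0.
  rewrite -oppr_le0 E pmulr_lle0 // subr_le0; exact: hk.
rewrite /P /q RintegralD //; try exact: within_integrable.
by lra.
Qed.

Lemma ibp_eq T phi g k : 0 < T -> testfun T phi ->
  {within `[0, T], continuous g} -> {within `[0, T], continuous k} ->
  (forall t, 0 < t < T -> is_derive t 1 g (k t)) ->
  \int[mu]_(t in `[0, T]) (phi t * k t) = - (\int[mu]_(t in `[0, T]) (derive1 phi t * g t)).
Proof.
move=> T0 tphi cg ck dg; apply/eqP; rewrite eq_le; apply/andP; split; last first.
  exact: (ibp_le T0 tphi cg ck dg).
have cp' : continuous (derive1 phi) by case: tphi => sphi _; exact: (@smooth_continuous _ 1 _ sphi).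
have cp : continuous phi by case: tphi => sphi _; exact: (@smooth_continuous _ 0 _ sphi).
have ngc : {within `[0, T], continuous (fun t => - g t)} by move=> t; apply: cvgN; exact: cg.
have nkc : {within `[0, T], continuous (fun t => - k t)} by move=> t; apply: cvgN; exact: ck.
have := @ibp_le T phi (fun t => - g t) (fun t => - k t) (fun t => - k t) T0 tphi ngc nkc
  (fun t tT => is_deriveN (dg t tT)) (fun t tT => lexx _).
have -> : (fun t => derive1 phi t * - g t) = (fun t => (-1) * (derive1 phi t * g t)).
  by apply/funext => t; ring.
have -> : (fun t => phi t * - k t) = (fun t => (-1) * (phi t * k t)).
  by apply/funext => t; ring.
rewrite !RintegralZl //.
- by rewrite !mulN1r opprK lerNr.
- apply: within_integrable => t; apply: cvgM; [exact: (continuous_subspaceT cp)|exact: ck].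
- apply: within_integrable => t; apply: cvgM; [exact: (continuous_subspaceT cp')|exact: cg].
Qed.

(** A one-sided mollifier: the derivative of a rescaled [step], of mass 1 and supported in
    [s, s + d]. *)
Definition bump s d t := d^-1 * dstep (d^-1 * t + - (d^-1 * s)).

Lemma bump_ge0 s d t : 0 < d -> 0 <= bump s d t.
Proof. by move=> d0; rewrite mulr_ge0 ?dstep_ge0 // invr_ge0 ltW. Qed.

Lemma bump_out s d t : 0 < d -> ~~ (s <= t <= s + d) -> bump s d t = 0.
Proof.
move=> d0 h; rewrite /bump dstep_out ?mulr0 //; apply: contra h.
have -> : d^-1 * t + - (d^-1 * s) = (t - s) / d by rewrite -mulrN -mulrDr mulrC.
rewrite ler_pdivlMr // ler_pdivrMr // mul0r mul1r.
by move=> /andP[h1 h2]; apply/andP; split; lra.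
Qed.

Lemma continuous_bump s d : continuous (bump s d).
Proof.
move=> t; apply: cvgM; first exact: cvg_cst.
apply: (@continuous_comp _ _ _ (fun t => d^-1 * t + - (d^-1 * s)) (@dstep R)).
  by apply: cvgD; [apply: cvgM; [exact: cvg_cst|exact: cvg_id]|exact: cvg_cst].
exact: continuous_dstep.
Qed.

Lemma is_derive_stepd s d t :
  is_derive t 1 (fun t => step (d^-1 * t + - (d^-1 * s))) (bump s d t).
Proof.
have dl : is_derive t 1 (fun x => d^-1 * x + - (d^-1 * s)) d^-1.
  have H := is_deriveD (is_deriveZ d^-1 (is_derive_id t (1 : R)))
     (is_derive_cst (- (d^-1 * s)) t (1 : R)).
  by apply: (is_derive_eq H); rewrite addr0 /GRing.scale /= mulr1.
have H := @is_derive1_comp R (@step R) _ t _ _ (is_derive_step _) dl.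
by apply: (is_derive_eq H); rewrite /bump mulrC.
Qed.

Lemma stepd0 s d t : 0 < d -> t <= s -> step (d^-1 * t + - (d^-1 * s)) = 0.
Proof.
move=> d0 ts; apply: step0; rewrite -mulrN -mulrDr pmulr_rle0 ?invr_gt0 //; lra.
Qed.

Lemma stepd1 s d t : 0 < d -> s + d <= t -> step (d^-1 * t + - (d^-1 * s)) = 1.
Proof.
move=> d0 ts; apply: step1; rewrite -mulrN -mulrDr mulrC ler_pdivlMr //; lra.
Qed.

Lemma bump_int T s d : 0 < d -> 0 < s -> s + d < T ->
  \int[mu]_(t in `[0, T]) bump s d t = 1.
Proof.
move=> d0 s0 sT; have T0 : 0 < T by lra.
pose F t := step (d^-1 * t + - (d^-1 * s)).
have cF : continuous F by move=> t; exact: is_derive_cont (is_derive_stepd s d t).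
rewrite /Rintegral (@continuous_FTC2 _ (bump s d) F) //.
- have -> : F T = 1 by apply: stepd1 => //; lra.
  have -> : F 0 = 0 by apply: stepd0 => //; lra.
  by rewrite oppe0 adde0.
- exact: continuous_subspaceT (@continuous_bump s d).
- split.
  + by move=> t _; rewrite /F; have := is_derive_stepd s d t => ?; exact: ex_derive.
  + exact/cvg_at_right_filter/cF.
  + exact/cvg_at_left_filter/cF.
- by move=> t _; rewrite derive1E /F; have := is_derive_stepd s d t => ?; exact: derive_val.
Qed.

Lemma bump_avg T s d h c e : 0 < d -> 0 < s -> s + d < T ->
  {within `[0, T], continuous h} -> (forall t, s <= t <= s + d -> `|h t - c| <= e) ->
  `|\int[mu]_(t in `[0, T]) (bump s d t * h t) - c| <= e.
Proof.
move=> d0 s0 sT ch hc; have T0 : 0 < T by lra.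
have cb := continuous_subspaceT (A := `[0, T]) (@continuous_bump s d).
have i1 : mu.-integrable `[0, T] (EFin \o (fun t => bump s d t * h t)).
  by apply: within_integrable => t; apply: cvgM; [exact: cb|exact: ch].
have i2 : mu.-integrable `[0, T] (EFin \o (fun t => c * bump s d t)).
  by apply: within_integrable => t; apply: cvgM; [exact: cvg_cst|exact: cb].
have ib : mu.-integrable `[0, T] (EFin \o bump s d) by exact: within_integrable.
have -> : c = \int[mu]_(t in `[0, T]) (c * bump s d t) by rewrite RintegralZl // bump_int // mulr1.
rewrite -RintegralB //.
have i3 : mu.-integrable `[0, T] (EFin \o (fun t => bump s d t * h t - c * bump s d t)).
  by apply: integrable_EFinB.
apply: le_trans (le_normr_Rintegral _ i3) _ => //.
have <- : \int[mu]_(t in `[0, T]) (e * bump s d t) = e by rewrite RintegralZl // bump_int // mulr1.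
apply: le_Rintegral => //.
- exact: (integrable_norm i3).
- exact: integrable_EFinZ.
move=> t _ /=; rewrite [c * _]mulrC -mulrBr normrM ger0_norm ?bump_ge0 // mulrC.
have [st|st] := boolP (s <= t <= s + d); first by rewrite ler_wpM2r ?bump_ge0 ?hc.
by rewrite bump_out // !mulr0.
Qed.

(** The two steps cancel beyond s2 + d, whence compact support; the derivative is the difference of
    two bumps. *)
Lemma testfun_step T s1 s2 d : 0 < d -> 0 < s1 -> s1 <= s2 -> s2 + d < T ->
  testfun T (fun t => step (d^-1 * t + - (d^-1 * s1)) - step (d^-1 * t + - (d^-1 * s2))).
Proof.
move=> d0 s10 s12 s2T; split.
  apply: nsm_smooth => n.
  have -> : (fun t => step (d^-1 * t + - (d^-1 * s1)) - step (d^-1 * t + - (d^-1 * s2))) =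
    (fun t => step (d^-1 * t + - (d^-1 * s1)) + (-1) * step (d^-1 * t + - (d^-1 * s2))).
    by apply/funext => t; rewrite mulN1r.
  apply: nsmD; first by apply: nsm_affine; exact: nsm_step.
  by apply: nsmM; [exact: nsm_cst|apply: nsm_affine; exact: nsm_step].
exists s1, (s2 + d); split => // t; rewrite negb_and -!ltNge => /orP[h|h].
  by rewrite !stepd0 ?subrr //; lra.
by rewrite !stepd1 ?subrr //; lra.
Qed.

(** Testing against the difference of two steps equates the averages of h over short intervals to
    the right of s1 and s2; continuity turns averages into values. *)
Lemma du_bois_reymond T h : 0 < T -> {within `[0, T], continuous h} ->
  (forall phi, testfun T phi -> \int[mu]_(t in `[0, T]) (derive1 phi t * h t) = 0) ->
  forall s1 s2, 0 < s1 < T -> 0 < s2 < T -> h s1 = h s2.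
Proof.
move=> T0 ch H.
suff key s1 s2 : 0 < s1 < T -> 0 < s2 < T -> s1 <= s2 -> h s1 = h s2.
  move=> s1 s2 h1 h2; have [s12|/ltW s21] := lerP s1 s2; first exact: key.
  by apply/esym; exact: key.
move=> h1 h2 s12; apply/eqP; rewrite -subr_eq0 -normr_le0.
apply/ler_addgt0Pl => e e0; rewrite addr0.
have near s : 0 < s < T -> exists2 d, 0 < d & forall t, `|t - s| < d -> `|h t - h s| <= e / 2.
  move=> sT; have /cvgrPdist_le/(_ (e / 2)) := within_itv_interior ch sT.
  rewrite divr_gt0 // => /(_ isT)[d /= d0 hd]; exists d => // t td.
  by rewrite distrC; apply: hd; rewrite /ball /= distrC.
have [d1 d10 hd1] := near s1 h1; have [d2 d20 hd2] := near s2 h2.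
(* Short enough for both moduli of continuity, and for the later bump to end before T. *)
pose d := Num.min (Num.min (d1 / 2) (d2 / 2)) ((T - s2) / 2).
have d0 : 0 < d by rewrite !lt_min !divr_gt0 //; lra.
have dd1 : d < d1.
  by apply: (@le_lt_trans _ _ (d1 / 2)); [rewrite /d !ge_min lexx|lra].
have dd2 : d < d2.
  by apply: (@le_lt_trans _ _ (d2 / 2)); [rewrite /d !ge_min lexx orbT|lra].
have dT : d <= (T - s2) / 2 by rewrite /d ge_min lexx orbT.
have e1 : `|\int[mu]_(t in `[0, T]) (bump s1 d t * h t) - h s1| <= e / 2.
  apply: bump_avg => //; [lra|lra|] => t ht; apply: hd1; rewrite ger0_norm; lra.
have e2 : `|\int[mu]_(t in `[0, T]) (bump s2 d t * h t) - h s2| <= e / 2.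
  apply: bump_avg => //; [lra|lra|] => t ht; apply: hd2; rewrite ger0_norm; lra.
have s2T : s2 + d < T by lra.
have s10 : 0 < s1 by lra.
have := H _ (testfun_step d0 s10 s12 s2T).
have -> : (fun t => derive1 (fun t => step (d^-1 * t + - (d^-1 * s1)) -
     step (d^-1 * t + - (d^-1 * s2))) t * h t) =
    (fun t => bump s1 d t * h t - bump s2 d t * h t).
  apply/funext => t; rewrite -mulrBl; congr (_ * _); rewrite derive1E.
  have D : is_derive t 1 (fun t => step (d^-1 * t + - (d^-1 * s1)) -
      step (d^-1 * t + - (d^-1 * s2))) (bump s1 d t - bump s2 d t).
    exact: is_deriveB (is_derive_stepd s1 d t) (is_derive_stepd s2 d t).
  exact: derive_val.
have ii s : mu.-integrable `[0, T] (EFin \o (fun t => bump s d t * h t)).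
  apply: within_integrable => t; apply: cvgM; last exact: ch.
  exact: (continuous_subspaceT (@continuous_bump s d)).
rewrite RintegralB // => /eqP; rewrite subr_eq0 => /eqP E.
move: e1 e2; rewrite E; move: (\int[mu]_(t in _) _) => I e1 e2.
have -> : h s1 - h s2 = (I - h s2) - (I - h s1) by ring.
by apply: le_trans (ler_normB _ _) _; rewrite [e]splitr lerD.
Qed.

(** f minus a primitive of g has zero weak derivative, hence is constant inside the interval by
    [du_bois_reymond]; f inherits the classical derivative of the primitive. *)
Lemma weak_derive T f g : 0 < T -> {within `[0, T], continuous f} ->
  {within `[0, T], continuous g} ->
  (forall phi, testfun T phi -> \int[mu]_(t in `[0, T]) (phi t * g t) =
     - \int[mu]_(t in `[0, T]) (derive1 phi t * f t)) ->
  forall t, 0 < t < T -> is_derive t 1 f (g t).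
Proof.
move=> T0 cf cg H t tT.
pose G t := \int[mu]_(y in `[0, t]) g y.
have cG : {within `[0, T], continuous G}.
  exact: (parameterized_integral_continuous (ltW T0) (within_integrable cg)).
have dG s : 0 < s < T -> is_derive s 1 G (g s) by exact: is_derive_primitive.
pose h t := f t - G t.
have ch : {within `[0, T], continuous h} by move=> s; apply: cvgB; [exact: cf|exact: cG].
have K : forall s1 s2, 0 < s1 < T -> 0 < s2 < T -> h s1 = h s2.
  apply: (du_bois_reymond T0 ch) => phi tphi.
  have cp' : continuous (derive1 phi) by case: tphi => sphi _; exact: (@smooth_continuous _ 1 _ sphi).
  have -> : (fun t => derive1 phi t * h t) = (fun t => derive1 phi t * f t - derive1 phi t * G t).
    by apply/funext => s; rewrite mulrBr.
  rewrite RintegralB //.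
  - apply/eqP; rewrite subr_eq0 -eqr_opp -H //; apply/eqP; exact: ibp_eq.
  - apply: within_integrable => s; apply: cvgM; [exact: (continuous_subspaceT cp')|exact: cf].
  - apply: within_integrable => s; apply: cvgM; [exact: (continuous_subspaceT cp')|exact: cG].
pose d := Num.min t (T - t).
have d0 : 0 < d by rewrite lt_min; apply/andP; split; lra.
have dt : d <= t by rewrite ge_min lexx.
have dT : d <= T - t by rewrite ge_min lexx orbT.
apply: (@is_derive_local _ f (fun s => G s + h t) _ _ d) => //.
  move=> y; rewrite ltr_norml => yd.
  by rewrite (K t y) /h; [rewrite addrC subrK|lra|lra].
by apply: (is_derive_eq (is_deriveD (dG t tT) (is_derive_cst (h t) t (1 : R)))); rewrite addr0.
Qed.

Lemma MVT_sym f (df : R -> R) t r : 0 < r -> (forall s, `|s - t| < r -> is_derive s 1 f (df s)) ->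
  forall h, h != 0 -> `|h| < r -> exists2 s, `|s - t| < `|h| & f (t + h) - f t = df s * h.
Proof.
move=> r0 dfr h h0 hr.
have cont a b : (forall s, a <= s <= b -> `|s - t| < r) -> {within `[a, b], continuous f}.
  move=> ab; apply: continuous_in_subspaceT => s /set_mem /=; rewrite in_itv /= => /ab /dfr.
  exact: is_derive_cont.
have [hn|hp|h00] := ltgtP h 0; last by rewrite h00 eqxx in h0.
  rewrite ltr0_norm // in hr *.
  have ab : t + h < t by lra.
  have hd s : s \in `]t + h, t[%R -> is_derive s 1 f (df s).
    by rewrite in_itv /= => hs; apply: dfr; rewrite ltr_norml; lra.
  have cc : {within `[t + h, t], continuous f}.
    by apply: cont => s hs; rewrite ltr_norml; lra.
  have [c] := MVT ab hd cc.
  rewrite in_itv /= => cth E; exists c; first by rewrite ltr_norml; lra.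
  by rewrite -[LHS]opprB E; ring.
rewrite gtr0_norm // in hr *.
have ab : t < t + h by lra.
have hd s : s \in `]t, t + h[%R -> is_derive s 1 f (df s).
  by rewrite in_itv /= => hs; apply: dfr; rewrite ltr_norml; lra.
have cc : {within `[t, t + h], continuous f}.
  by apply: cont => s hs; rewrite ltr_norml; lra.
have [c] := MVT ab hd cc.
rewrite in_itv /= => cth E; exists c; first by rewrite ltr_norml; lra.
by rewrite E; ring.
Qed.

End TimeIntegrals.

(** * Derivatives of coefficients, strong derivatives in H^s and the Leibniz rule *)

Section ComplexDerivatives.
Variable R : realType.
Implicit Types (t e d h T s : R) (u w a b : R -> distr R) (f g : R -> R[i]) (z l : R[i]).

Definition dC f t l := is_derive t 1 (fun x => complex.Re (f x)) (complex.Re l) /\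
  is_derive t 1 (fun x => complex.Im (f x)) (complex.Im l).

Lemma dC_eps f t l : (forall e, 0 < e -> exists2 d, 0 < d & forall h, h != 0 -> `|h| < d ->
    nc ((h^-1)%:C%C * (f (t + h) - f t) - l) <= e) -> dC f t l.
Proof.
move=> H; split; apply/is_derive_epsP => e /H[d d0 hd]; exists d => // h h0 /(hd h h0) E.
  apply: le_trans E; apply: le_trans (Re_le_nc _).
  by rewrite cReD cReN cReM cReD cReN /= mul0r subr0.
apply: le_trans E; apply: le_trans (Im_le_nc _).
by rewrite cImD cImN cImM cImD cImN /= mul0r addr0.
Qed.

Lemma dC_eq f t l l' : dC f t l -> l = l' -> dC f t l'.
Proof. by move=> h <-. Qed.

Lemma dC_ext f g t l : f =1 g -> dC g t l -> dC f t l.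
Proof. by move=> fg; rewrite (_ : f = g) //; exact/funext. Qed.

Lemma dC_cst z t : dC (fun=> z) t 0.
Proof. by split; exact: is_derive_cst. Qed.

Lemma dC_add f g t l z : dC f t l -> dC g t z -> dC (fun x => f x + g x) t (l + z).
Proof.
move=> [f1 f2] [g1 g2]; split.
  rewrite cReD (_ : (fun x => _) = (fun x => complex.Re (f x) + complex.Re (g x))).
    exact: is_deriveD.
  by apply/funext => x; rewrite cReD.
rewrite cImD (_ : (fun x => _) = (fun x => complex.Im (f x) + complex.Im (g x))).
  exact: is_deriveD.
by apply/funext => x; rewrite cImD.
Qed.

Lemma dC_scale f t l z : dC f t l -> dC (fun x => z * f x) t (z * l).
Proof.
move=> [f1 f2]; split.
  rewrite cReM (_ : (fun x => _) = (fun x => complex.Re z * complex.Re (f x) -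
     complex.Im z * complex.Im (f x))); last by apply/funext => x; rewrite cReM.
  exact: (is_deriveB (is_deriveZ (complex.Re z) f1) (is_deriveZ (complex.Im z) f2)).
rewrite cImM (_ : (fun x => _) = (fun x => complex.Re z * complex.Im (f x) +
     complex.Im z * complex.Re (f x))); last by apply/funext => x; rewrite cImM.
exact: (is_deriveD (is_deriveZ (complex.Re z) f2) (is_deriveZ (complex.Im z) f1)).
Qed.

Lemma dC_sum (I : Type) (r : seq I) (F : I -> R -> R[i]) (G : I -> R[i]) t :
  (forall i, dC (F i) t (G i)) ->
  dC (fun x => \sum_(i <- r) F i x) t (\sum_(i <- r) G i).
Proof.
move=> H; elim: r => [|i r IH].
  by rewrite big_nil; apply: dC_ext (dC_cst 0 t) => x; rewrite big_nil.
by rewrite big_cons; apply: dC_ext (dC_add (H i) IH) => x; rewrite big_cons.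
Qed.

Lemma dC_id z t : dC (fun x => x%:C%C * z) t z.
Proof.
split.
  rewrite (_ : (fun x => _) = (fun x => complex.Re z * x)).
    apply: (is_derive_eq (is_deriveZ (complex.Re z) (is_derive_id t (1 : R)))).
    by rewrite /GRing.scale /= mulr1.
  by apply/funext => x; rewrite cReM /= mul0r subr0 mulrC.
rewrite (_ : (fun x => _) = (fun x => complex.Im z * x)).
  apply: (is_derive_eq (is_deriveZ (complex.Im z) (is_derive_id t (1 : R)))).
  by rewrite /GRing.scale /= mulr1.
by apply/funext => x; rewrite cImM /= mul0r addr0 mulrC.
Qed.

Lemma dC_sq f t l : dC f t l -> is_derive t 1 (fun x => nc (f x) ^+ 2)
  (2 * complex.Re ((f t)^*%C * l)).
Proof.
move=> [f1 f2].
have -> : (fun x => nc (f x) ^+ 2) = (fun x => complex.Re (f x) * complex.Re (f x) +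
   complex.Im (f x) * complex.Im (f x)) by apply/funext => x; rewrite nc_sq !expr2.
apply: (is_derive_eq (is_deriveD (is_deriveM f1 f1) (is_deriveM f2 f2))).
by rewrite /GRing.scale /= cReM; case: (f t) => p q /=; ring.
Qed.

Lemma open_itvP (p q : R) t : (`]p, q[ : set R) t <-> p < t < q.
Proof. by rewrite /= in_itv. Qed.

Lemma has_deriv_dC s (p q : R) u w t k : p < t < q -> has_deriv_H s `]p, q[ u w ->
  dC (fun x => u x k) t (w t k).
Proof.
move=> tpq H; apply: dC_eps => e e0.
have e1 : 0 < e / wt (- s) k by rewrite divr_gt0 ?wt_gt0.
have [d d0 hd] := H t ((open_itvP p q t).2 tpq) _ e1.
pose d' := Num.min d (Num.min (t - p) (q - t)).
have d'd : d' <= d by rewrite ge_min lexx.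
have d'1 : d' <= t - p by rewrite /d' !ge_min lexx orbT.
have d'2 : d' <= q - t by rewrite /d' !ge_min lexx !orbT.
exists d'; first by rewrite !lt_min d0; apply/andP; split => //; apply/andP; split; lra.
move=> h h0 hd'.
have I : p < t + h < q.
  by move: hd'; rewrite ltr_norml => /andP[]; move: (d') d'1 d'2 => D; lra.
have /Hnorm_ltP := hd h h0 (lt_le_trans hd' d'd) ((open_itvP p q (t + h)).2 I).
move=> /(_ e1) /(hb_term k) E; apply: le_trans E _.
by rewrite mulrC divfK // gt_eqF // wt_gt0.
Qed.

(** A mean value inequality in H^s. On each finite set of frequencies the remainder X is paired with
    itself, which reduces matters to one real function; the resulting bound does not depend on the
    finite set, so it bounds the full norm. *)
Lemma strong_deriv s (p q : R) u w :
  (forall t k, p < t < q -> dC (fun x => u x k) t (w t k)) ->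
  contH s `]p, q[ w -> has_deriv_H s `]p, q[ u w.
Proof.
move=> du [inw cw] t /[dup] It /(open_itvP p q t).1 tpq e e0.
have e4 : 0 < e / 4 by rewrite divr_gt0 ?wt_gt0.
have [d d0 hd] := cw t It _ e4.
pose d' := Num.min d (Num.min (t - p) (q - t)).
have d'd : d' <= d by rewrite ge_min lexx.
have d'1 : d' <= t - p by rewrite /d' !ge_min lexx orbT.
have d'2 : d' <= q - t by rewrite /d' !ge_min lexx !orbT.
have d'0 : 0 < d' by rewrite !lt_min d0; apply/andP; split => //; apply/andP; split; lra.
exists d' => // h h0 hd' _.
apply: hb_Hnorm_lt => //.
set X := dist_sub _ _.
split; first by rewrite divr_ge0 ?ltW.
move=> r ur.
(* With these weights the increment of the real part of [psi] over h is h times the weighted square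
   sum S of X. Its derivative involves w(y) - w(t), so Cauchy-Schwarz gives S <= sqrt(S) e/4. *)
pose c k := ((wt s k) ^+ 2)%:C%C * (X k)^*%C.
pose psi x := \sum_(k <- r) c k * (u x k + (- 1) * (x%:C%C * w t k)).
have Ix y : `|y - t| < d' -> p < y < q.
  by rewrite ltr_norml => /andP[]; move: (d') d'1 d'2 => D; lra.
have dpsi y : `|y - t| < d' -> dC psi y (\sum_(k <- r) c k * (w y k + (- 1) * w t k)).
  move=> yd; apply: dC_sum => k; apply: dC_scale; apply: dC_add; first exact: du (Ix y yd).
  exact: dC_scale (dC_id _ _).
have [y yt E] := MVT_sym d'0 (fun y yd => (dpsi y yd).1) h0 hd'.
have yd : `|y - t| < d by apply: lt_trans yt _; apply: lt_le_trans hd' d'd.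
have hw : hb s (dist_sub (w y) (w t)) (e / 4).
  apply: Hnorm_ltP => //; apply: hd => //; apply/open_itvP; apply: Ix; exact: lt_trans hd'.
set S := \sum_(k <- r) _.
have S0 : 0 <= S by apply: sumr_ge0 => k _; exact: sqr_ge0.
have ES : S = complex.Re (\sum_(k <- r) c k * (w y k + (- 1) * w t k)).
  apply: (mulIf h0); rewrite -E /psi -cReN -cReD -sumrB Re_sum mulr_suml.
  apply: eq_bigr => k _.
  have -> : c k * (u (t + h) k + -1 * ((t + h)%:C%C * w t k)) -
     c k * (u t k + -1 * (t%:C%C * w t k)) = c k * (h%:C%C * X k).
    have hh : h%:C%C * (h^-1)%:C%C = 1 :> R[i] by rewrite -rmorphM /= mulfV.
    rewrite /X /dist_sub /dist_scale mulrBr [h%:C%C * (_ * _)]mulrA hh mul1r rmorphD /=; ring.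
  rewrite /c exprMn nc_sq; case: (X k) => x1 x2.
  by rewrite !cReM !cImM /= !mul0r !subr0 !addr0; ring.
have h1 : S <= Num.sqrt S * (e / 4).
  rewrite {1}ES Re_sum.
  apply: (@le_trans _ _ (\sum_(k <- r) (wt s k * nc (X k)) * (wt s k * nc (w y k + -1 * w t k)))).
    apply: ler_sum => k _; apply: le_trans (ler_norm _) _; apply: le_trans (Re_le_nc _) _.
    rewrite /c !ncM nc_real nc_conj ger0_norm ?sqr_ge0 // expr2.
    by rewrite le_eqVlt; apply/orP; left; apply/eqP; ring.
  apply: sum_cs2; rewrite ?sqrtr_ge0 ?(ltW e4) //.
    by rewrite sqr_sqrtr.
  have [_ /(_ r ur)] := hw; congr (_ <= _); apply: eq_bigr => k _.
  by rewrite /dist_sub mulN1r.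
have h2 : Num.sqrt S <= e / 4.
  have [z0|z0] := eqVneq (Num.sqrt S) 0; first by rewrite z0 ltW.
  have zp : 0 < Num.sqrt S by rewrite lt_neqAle eq_sym z0 sqrtr_ge0.
  by rewrite -(ler_pM2l zp) -expr2 sqr_sqrtr.
rewrite -(sqr_sqrtr S0) ler_pXn2r ?nnegrE ?sqrtr_ge0 ?divr_ge0 ?(ltW e0) //.
by apply: le_trans h2 _; lra.
Qed.

(** Leibniz rule in the duality of H^s and H^(-s), one coefficient at a time. With difference
    quotients qa, qb the error splits into (qa - a') b, a (qb - b') and h qa qb, each controlled by
    [conv_coef]. *)
Lemma dC_fconv s (p q : R) a a' b b' t k : 0 <= s -> p < t < q ->
  (forall x, p < x < q -> inH s (a x)) -> inH s (a' t) ->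
  (forall x, p < x < q -> inH (- s) (b x)) -> inH (- s) (b' t) ->
  has_deriv_H s `]p, q[ a a' -> has_deriv_H (- s) `]p, q[ b b' ->
  dC (fun x => fconv (a x) (b x) k) t (fconv (a' t) (b t) k + fconv (a t) (b' t) k).
Proof.
move=> s0 tpq ia ia' ib ib' da db; apply: dC_eps => e e0.
have It := (open_itvP p q t).2 tpq.
pose A := hn s (a t); pose B := hn (- s) (b t).
pose A' := hn s (a' t); pose B' := hn (- s) (b' t).
pose K := peetre s * wt s k.
have K0 : 0 < K by rewrite mulr_gt0 ?peetre_gt0 ?wt_gt0.
have A0 : 0 <= A by exact: hn_ge0. have B0 : 0 <= B by exact: hn_ge0.
have A'0 : 0 <= A' by exact: hn_ge0. have B'0 : 0 <= B' by exact: hn_ge0.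
pose m := K * (B + A + (1 + A') * (1 + B')) + 1.
have m0 : 0 < m.
  have X0 : 0 <= (1 + A') * (1 + B') by apply: mulr_ge0; apply: addr_ge0.
  by rewrite ltr_wpDl // mulr_ge0 ?(ltW K0) // addr_ge0 // addr_ge0.
have [e1 [e10 e11 e1m]] : exists e1, [/\ 0 < e1, e1 <= 1 & e1 * m <= e].
  exists (Num.min 1 (e / m)); split.
  - by rewrite lt_min ltr01 divr_gt0.
  - by rewrite ge_min lexx.
  - by rewrite -[leRHS](divfK (lt0r_neq0 m0)) ler_wpM2r ?(ltW m0) // ge_min lexx orbT.
have [d1 d10 hd1] := da t It _ e10.
have [d2 d20 hd2] := db t It _ e10.
pose d' := Num.min (Num.min d1 d2) (Num.min e1 (Num.min (t - p) (q - t))).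
have d'd1 : d' <= d1 by rewrite /d' !ge_min lexx.
have d'd2 : d' <= d2 by rewrite /d' !ge_min lexx orbT.
have d'e : d' <= e1 by rewrite /d' !ge_min lexx !orbT.
have d'1 : d' <= t - p by rewrite /d' !ge_min lexx !orbT.
have d'2 : d' <= q - t by rewrite /d' !ge_min lexx !orbT.
exists d'.
  rewrite !lt_min d10 d20 -!lt_min lt_min e10 lt_min.
  by apply/andP; split; lra.
move=> h h0 hd'.
have I : p < t + h < q.
  by move: hd'; rewrite ltr_norml => /andP[]; move: (d') d'1 d'2 => D; lra.
have Ih := (open_itvP p q (t + h)).2 I.
have hA := Hnorm_ltP e10 (hd1 h h0 (lt_le_trans hd' d'd1) Ih).
have hB := Hnorm_ltP e10 (hd2 h h0 (lt_le_trans hd' d'd2) Ih).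
pose qa := dist_scale (h^-1)%:C%C (dist_sub (a (t + h)) (a t)).
pose qb := dist_scale (h^-1)%:C%C (dist_sub (b (t + h)) (b t)).
have iqa : inH s qa by apply: inHZ; apply: inHB; exact: ia.
have iqb : inH (- s) qb by apply: inHZ; apply: inHB; exact: ib.
have hh : h%:C%C * (h^-1)%:C%C = 1 :> R[i] by rewrite -rmorphM /= mulfV.
have hh' : (h^-1)%:C%C * h%:C%C = 1 :> R[i] by rewrite mulrC.
have Ea : a (t + h) = dist_add (a t) (dist_scale h%:C%C qa).
  apply/funext => j; rewrite /dist_add /qa /dist_scale /dist_sub mulrA hh mul1r.
  by rewrite [RHS]addrC subrK.
have Eb : b (t + h) = dist_add (b t) (dist_scale h%:C%C qb).
  apply/funext => j; rewrite /dist_add /qb /dist_scale /dist_sub mulrA hh mul1r.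
  by rewrite [RHS]addrC subrK.
have iat := ia t tpq. have ibt := ib t tpq.
have ihqa := inHZ h%:C%C iqa. have ihqb := inHZ h%:C%C iqb.
have E : (h^-1)%:C%C * (fconv (a (t + h)) (b (t + h)) k - fconv (a t) (b t) k) -
   (fconv (a' t) (b t) k + fconv (a t) (b' t) k) =
   fconv (dist_sub qa (a' t)) (b t) k + fconv (a t) (dist_sub qb (b' t)) k +
   h%:C%C * fconv qa qb k.
  rewrite Ea Eb (@convDl _ s) //; last exact: inHD.
  rewrite (@convBl _ s) // (@convBr _ s) // /dist_add /dist_sub.
  rewrite (@convDr _ s (a t)) // (@convDr _ s (dist_scale _ _)) // /dist_add.
  rewrite (@convZr _ s _ (a t)) // (@convZl _ s _ qa (b t)) //.
  rewrite (@convZl _ s _ qa (dist_scale _ _)) // (@convZr _ s _ qa qb) // /dist_scale.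
  move: (fconv (a t) (b t) k) (fconv (a t) qb k) (fconv qa (b t) k) (fconv qa qb k)
    (fconv (a' t) (b t) k) (fconv (a t) (b' t) k) => x1 x2 x3 x4 x5 x6.
  have -> : (h^-1)%:C%C * (x1 + h%:C%C * x2 + (h%:C%C * x3 + h%:C%C * (h%:C%C * x4)) - x1) =
     ((h^-1)%:C%C * h%:C%C) * (x2 + x3 + h%:C%C * x4) by ring.
  by rewrite hh' mul1r; ring.
rewrite E.
have c1 := conv_coef k s0 hA (hn_hb ibt).
have c2 := conv_coef k s0 (hn_hb iat) hB.
have hqa : hb s qa (1 + A').
  have -> : qa = dist_add (dist_sub qa (a' t)) (a' t).
    by apply/funext => j; rewrite /dist_add /dist_sub subrK.
  by apply: hbD; [exact: hbW e11 hA|exact: hn_hb].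
have hqb : hb (- s) qb (1 + B').
  have -> : qb = dist_add (dist_sub qb (b' t)) (b' t).
    by apply/funext => j; rewrite /dist_add /dist_sub subrK.
  by apply: hbD; [exact: hbW e11 hB|exact: hn_hb].
have c3 := conv_coef k s0 hqa hqb.
apply: le_trans (ncD _ _) _.
have c3' : nc (h%:C%C * fconv qa qb k) <= e1 * (K * ((1 + A') * (1 + B'))).
  rewrite ncM nc_real ler_pM ?nc_ge0 //.
  by apply: le_trans (ltW hd') d'e.
apply: le_trans (lerD (le_trans (ncD _ _) (lerD c1 c2)) c3') _.
apply: le_trans e1m; rewrite -/A -/B -/K /m.
rewrite (_ : K * (e1 * B) + K * (A * e1) + e1 * (K * ((1 + A') * (1 + B'))) =
  e1 * (K * (B + A + (1 + A') * (1 + B')))); last by ring.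
by rewrite ler_wpM2l ?(ltW e10) // lerDl.
Qed.

End ComplexDerivatives.

(** * Curves in Sobolev spaces *)

Section ContinuousCurves.
Variable R : realType.
Implicit Types (s t e : R) (I : set R) (u w : R -> distr R) (a b : distr R).

Lemma contH_hb s I u t e : contH s I u -> I t -> 0 < e -> exists2 d, 0 < d &
  forall t', I t' -> `|t' - t| < d -> hb s (dist_sub (u t') (u t)) e.
Proof.
move=> [_ h] It e0; have [d d0 hd] := h t It e e0.
by exists d => // t' It' td; apply: Hnorm_ltP => //; exact: hd.
Qed.

Lemma contH_intro s I u : (forall t, I t -> inH s (u t)) ->
  (forall t, I t -> forall e, 0 < e -> exists2 d, 0 < d &
     forall t', I t' -> `|t' - t| < d -> hb s (dist_sub (u t') (u t)) e) -> contH s I u.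
Proof.
move=> hi h; split => // t It e e0; have [d d0 hd] := h t It (e / 2) (divr_gt0 e0 (ltr0Sn _ 1)).
by exists d => // t' It' td; apply: hb_Hnorm_lt => //; exact: hd.
Qed.

(** Compatibility with differences is asked on H^s only, because for [W] and for the convolution
    with chi it is established only on Sobolev distributions. *)
Lemma contH_lin s s' I u (L : distr R -> distr R) K : 0 <= K ->
  (forall a B, hb s a B -> hb s' (L a) (K * B)) ->
  (forall a b, inH s a -> inH s b -> L (dist_sub a b) = dist_sub (L a) (L b)) ->
  contH s I u -> contH s' I (fun t => L (u t)).
Proof.
move=> K0 hL LB cu; have [iu _] := cu; apply: contH_intro => [t It|t It e e0].
  by apply/inHP; exists (K * hn s (u t)); apply: hL; exact: hn_hb (iu t It).
have e1 : 0 < e / (K + 1) by rewrite divr_gt0 // ltr_wpDl.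
have [d d0 hd] := contH_hb cu It e1.
exists d => // t' It' td; rewrite -LB; [|exact: iu|exact: iu].
apply: hbW (hL _ _ (hd t' It' td)).
rewrite mulrA ler_pdivrMr ?ltr_wpDl // mulrC ler_wpM2l ?(ltW e0) //; lra.
Qed.

Lemma contH_mono s s' I u : s' <= s -> contH s I u -> contH s' I u.
Proof.
move=> ss; apply: (@contH_lin s s' I u id 1) => // a B h.
by rewrite mul1r; exact: hb_mono h.
Qed.

Lemma contH_sub s I J u : J `<=` I -> contH s I u -> contH s J u.
Proof.
move=> JI [h1 h2]; split=> [t /JI|t Jt e e0]; first exact: h1.
have [d d0 hd] := h2 t (JI _ Jt) e e0.
by exists d => // t' /JI; exact: hd.
Qed.

Lemma contH_cst s I a : inH s a -> contH s I (fun=> a).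
Proof.
move=> ha; apply: contH_intro => // t It e e0; exists 1 => // t' _ _.
split; first exact: ltW.
move=> r _; rewrite big1 ?sqr_ge0 // => k _.
by rewrite /dist_sub subrr ComplexField.Normc.normc0 mulr0 expr0n.
Qed.

Lemma contH_add s I u w : contH s I u -> contH s I w ->
  contH s I (fun t => dist_add (u t) (w t)).
Proof.
move=> cu cw; have [iu _] := cu; have [iw _] := cw.
apply: contH_intro => [t It|t It e e0]; first by apply: inHD; [exact: iu|exact: iw].
have e1 : 0 < e / 2 by rewrite divr_gt0.
have [d d0 hd] := contH_hb cu It e1; have [d' d'0 hd'] := contH_hb cw It e1.
exists (Num.min d d'); first by rewrite lt_min d0.
move=> t' It'; rewrite lt_min => /andP[td td'].
have -> : dist_sub (dist_add (u t') (w t')) (dist_add (u t) (w t)) =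
  dist_add (dist_sub (u t') (u t)) (dist_sub (w t') (w t)).
  by apply/funext => k; rewrite /dist_add /dist_sub; ring.
by rewrite [e]splitr; apply: hbD; [exact: hd|exact: hd'].
Qed.

Lemma contH_scale s I u c : contH s I u -> contH s I (fun t => dist_scale c (u t)).
Proof.
apply: (@contH_lin s s I u (dist_scale c) (nc c)); first exact: nc_ge0.
  by move=> a B; exact: hbZ.
by move=> a b _ _; apply/funext => k; rewrite /dist_scale /dist_sub mulrBr.
Qed.

Lemma fmultB (m : R -> R[i]) a b : fmult m (dist_sub a b) = dist_sub (fmult m a) (fmult m b).
Proof. by apply/funext => k; rewrite /fmult /dist_sub mulrBr. Qed.

Lemma fmultZ (m : R -> R[i]) c a : fmult m (dist_scale c a) = dist_scale c (fmult m a).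
Proof. by apply/funext => k; rewrite /fmult /dist_scale mulrCA. Qed.

Lemma contH_dx s I u : contH (s + 1) I u -> contH s I (fun t => dx (u t)).
Proof.
apply: (@contH_lin _ _ _ _ (@dx R) 1) => // [a B h|a b _ _]; last exact: fmultB.
by rewrite mul1r; exact: hb_dx.
Qed.

Lemma contH_absD s I u al : 0 <= al -> contH (s + al) I u -> contH s I (fun t => absD al (u t)).
Proof.
move=> al0; apply: (@contH_lin _ _ _ _ (@absD R al) 1) => // [a B h|a b _ _]; last exact: fmultB.
by rewrite mul1r; exact: hb_absD.
Qed.

Lemma contH_bilin s1 s2 s3 I u w (P : distr R -> distr R -> distr R) K : 0 <= K ->
  (forall a b A B, hb s1 a A -> hb s2 b B -> hb s3 (P a b) (K * (A * B))) ->
  (forall a a' b, inH s1 a -> inH s1 a' -> inH s2 b ->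
     P (dist_sub a a') b = dist_sub (P a b) (P a' b)) ->
  (forall a b b', inH s1 a -> inH s2 b -> inH s2 b' ->
     P a (dist_sub b b') = dist_sub (P a b) (P a b')) ->
  contH s1 I u -> contH s2 I w -> contH s3 I (fun t => P (u t) (w t)).
Proof.
move=> K0 hP PBl PBr cu cw; have [iu _] := cu; have [iw _] := cw.
apply: contH_intro => [t It|t It e e0].
  apply/inHP; exists (K * (hn s1 (u t) * hn s2 (w t))).
  by apply: hP; apply: hn_hb; [exact: iu|exact: iw].
pose A := hn s1 (u t); pose B := hn s2 (w t).
have A0 : 0 <= A by exact: hn_ge0. have B0 : 0 <= B by exact: hn_ge0.
pose m := K * (1 + A + B) + 1.
have m0 : 0 < m by rewrite ltr_wpDl // mulr_ge0 // !addr_ge0.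
have [e1 [e10 e11 e1m]] : exists e1, [/\ 0 < e1, e1 <= 1 & e1 * m <= e].
  exists (Num.min 1 (e / m)); split.
  - by rewrite lt_min ltr01 divr_gt0.
  - by rewrite ge_min lexx.
  - by rewrite -[leRHS](divfK (lt0r_neq0 m0)) ler_wpM2r ?(ltW m0) // ge_min lexx orbT.
have [d d0 hd] := contH_hb cu It e10; have [d' d'0 hd'] := contH_hb cw It e10.
exists (Num.min d d'); first by rewrite lt_min d0.
move=> t' It'; rewrite lt_min => /andP[td td'].
have iu' := iu t' It'. have iw' := iw t' It'. have iut := iu t It. have iwt := iw t It.
have -> : dist_sub (P (u t') (w t')) (P (u t) (w t)) =
  dist_add (P (dist_sub (u t') (u t)) (w t')) (P (u t) (dist_sub (w t') (w t))).
  by rewrite PBl // PBr //; apply/funext => k; rewrite /dist_add /dist_sub; ring.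
have hw' : hb s2 (w t') (1 + B).
  have -> : w t' = dist_add (dist_sub (w t') (w t)) (w t).
    by apply/funext => j; rewrite /dist_add /dist_sub subrK.
  by apply: hbD; [exact: hbW e11 (hd' t' It' td')|exact: hn_hb].
apply: hbW (hbD (hP _ _ _ _ (hd t' It' td) hw') (hP _ _ _ _ (hn_hb iut) (hd' t' It' td'))).
apply: le_trans e1m; rewrite -/A /m.
rewrite (_ : K * (e1 * (1 + B)) + K * (A * e1) = e1 * (K * (1 + A + B))); last by ring.
by rewrite ler_wpM2l ?(ltW e10) // lerDl.
Qed.

Lemma contH_fconv s I u w : 0 <= s -> contH (s + 1) I u -> contH s I w ->
  contH s I (fun t => fconv (u t) (w t)).
Proof.
move=> s0; have s1 : 0 <= s + 1 by rewrite addr_ge0.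
have s2 : - 0 <= s by rewrite oppr0.
apply: (@contH_bilin (s + 1) s s I u w (@fconv R) (cC s)).
- exact: cC_ge0.
- by move=> a b A B; exact: hb_conv.
- move=> a a' b ha ha' hb'.
  exact: (@convBl _ 0 _ _ _ (lexx 0) (inH_mono s1 ha) (inH_mono s1 ha') (inH_mono s2 hb')).
- move=> a b b' ha hb1 hb2.
  exact: (@convBr _ 0 _ _ _ (lexx 0) (inH_mono s1 ha) (inH_mono s2 hb1) (inH_mono s2 hb2)).
Qed.

Lemma has_deriv_lin s s' I u w (L : distr R -> distr R) K : 0 <= K ->
  (forall a B, hb s a B -> hb s' (L a) (K * B)) ->
  (forall a b, L (dist_sub a b) = dist_sub (L a) (L b)) ->
  (forall c a, L (dist_scale c a) = dist_scale c (L a)) ->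
  has_deriv_H s I u w -> has_deriv_H s' I (fun t => L (u t)) (fun t => L (w t)).
Proof.
move=> K0 hL LB LZ H t It e e0.
have e1 : 0 < e / 2 / (K + 1) by rewrite !divr_gt0 // ltr_wpDl.
have [d d0 hd] := H t It _ e1.
exists d => // h h0 hd' Ith; have /Hnorm_ltP := hd h h0 hd' Ith => /(_ e1) E.
apply: hb_Hnorm_lt => //; rewrite -LB -LZ -LB; apply: hbW (hL _ _ E).
rewrite mulrA ler_pdivrMr ?ltr_wpDl // mulrC ler_wpM2l ?divr_ge0 ?(ltW e0) //; lra.
Qed.

Lemma has_deriv_mono s s' I u w : s' <= s -> has_deriv_H s I u w -> has_deriv_H s' I u w.
Proof.
move=> ss; apply: (@has_deriv_lin s s' I u w id 1) => // a B h.
by rewrite mul1r; exact: hb_mono h.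
Qed.

Lemma has_deriv_dx s I u w : has_deriv_H (s + 1) I u w ->
  has_deriv_H s I (fun t => dx (u t)) (fun t => dx (w t)).
Proof.
apply: (@has_deriv_lin _ _ _ _ _ (@dx R) 1) => // [a B h|a b|c a].
- by rewrite mul1r; exact: hb_dx.
- exact: fmultB.
- exact: fmultZ.
Qed.

Lemma hb_zero s e : 0 <= e -> hb s (fun=> 0 : R[i]) e.
Proof.
move=> e0; split=> // r _; rewrite big1 ?sqr_ge0 // => k _.
by rewrite ComplexField.Normc.normc0 mulr0 expr0n.
Qed.

Lemma has_deriv_cst s I a : has_deriv_H s I (fun=> a) (fun=> (fun=> 0)).
Proof.
move=> t It e e0; exists 1 => // h _ _ _; apply: hb_Hnorm_lt => //.
have -> : dist_sub (dist_scale (h^-1)%:C%C (dist_sub a a)) (fun=> 0) = (fun=> 0).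
  by apply/funext => k; rewrite /dist_sub /dist_scale subrr mulr0 subr0.
by apply: hb_zero; rewrite divr_ge0 // ltW.
Qed.

Lemma fconv0l b : fconv (fun=> 0) b = (fun=> 0).
Proof.
apply/funext => k; rewrite /fconv -[RHS](@csum0 R).
by apply: eq_csum => j; rewrite mulr0.
Qed.

End ContinuousCurves.

(** * The operator W: boundedness, additivity and differentiation in time *)

Section SmoothingOperator.
Variables (R : realType) (N : nat) (W : distr R -> distr R).
Hypothesis hW : smoothing N W.
Implicit Types (s t : R) (u w : distr R).

(** The multiplier of order -N is at most 1, so the smoothing bound yields boundedness on each
    H^s. *)
Lemma W_hb s : exists2 K, 0 < K & forall u B, hb s u B -> hb s (W u) (K * B).
Proof.
have [K K0 hK] := smoothing_bound hW s; exists K => // u B hu.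
have B0 := hu.1.
have iu : inH (s - N%:R) u.
  by apply/inHP; exists B; apply: hb_mono hu; rewrite gerBl.
apply/HnormP; first by rewrite mulr_ge0 // ltW.
apply: le_trans (hK u iu) _; rewrite EFinM lee_pmul2l //.
apply/HnormP => //; rewrite -[B]mul1r; apply: (@hb_fmult _ _ 0) => //; last by rewrite addr0.
move=> k; rewrite mul1r wt0 nc_real ger0_norm ?powR_ge0 //.
have := @wt_le R (- N%:R) 0 k; rewrite wt0 /wt; apply; by rewrite oppr_le0.
Qed.

(* [t |-> W (w + t u)] has the constant derivative [W u]. *)
Lemma W_add s u w : inH s u -> inH s w -> W (dist_add w u) = dist_add (W w) (W u).
Proof.
move=> hu hw.
pose U t := dist_add w (dist_scale t%:C%C u).
(* [smoothing_dt] takes curves in H^(s'-N), which is H^s for this s'. The interval ]-1, 2[ used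
   below contains [0, 1], so the mean value theorem applies between U 0 and U 1. *)
pose s' := s + N%:R.
have sE : s' - N%:R = s by rewrite /s' addrK.
have cU : contH s `]-1, 2[ U.
  apply: contH_add; first exact: contH_cst.
  apply: contH_intro => [t _|t _ e e0]; first exact: inHZ.
  have e1 : 0 < e / (hn s u + 1) by rewrite divr_gt0 // ltr_wpDl ?hn_ge0.
  exists (e / (hn s u + 1)) => // t' _ td.
  have -> : dist_sub (dist_scale t'%:C%C u) (dist_scale t%:C%C u) = dist_scale (t' - t)%:C%C u.
    by apply/funext => k; rewrite /dist_sub /dist_scale rmorphB mulrBl.
  apply: hbW (hbZ _ (hn_hb hu)); rewrite nc_real.
  apply: (@le_trans _ _ (e / (hn s u + 1) * hn s u)).
    by rewrite ler_wpM2r ?hn_ge0 // ltW.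
  rewrite mulrAC ler_pdivrMr ?ltr_wpDl ?hn_ge0 // ler_wpM2l ?(ltW e0) //.
  by rewrite lerDl.
have cU' : contH s `]-1, 2[ (fun=> u) by exact: contH_cst.
have dU : has_deriv_H s `]-1, 2[ U (fun=> u).
  move=> t It e e0; exists 1 => // h h0 _ _; apply: hb_Hnorm_lt => //.
  have -> : dist_sub (dist_scale (h^-1)%:C%C (dist_sub (U (t + h)) (U t))) u = (fun=> 0).
    apply/funext => k; rewrite /dist_sub /dist_scale /U /dist_add /dist_scale.
    have hh : (h^-1)%:C%C * h%:C%C = 1 :> R[i] by rewrite -rmorphM /= mulVf.
    rewrite rmorphD /= (_ : _ * _ - _ = ((h^-1)%:C%C * h%:C%C - 1) * u k); last by ring.
    by rewrite hh subrr mul0r.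
  by apply: hb_zero; rewrite divr_ge0 // ltW.
have := @smoothing_dt R N W hW s' (-1) 2 U (fun=> u); rewrite sE => /(_ cU cU' dU) D.
have E k (re : R[i] -> R) : (forall t, -1 < t < 2 ->
     is_derive t 1 (fun t => re (W (U t) k)) (re (W u k))) ->
     re (W (U 1) k) = re (W (U 0) k) + re (W u k).
  move=> Dk.
  have h01 : 0 < (1 : R) by [].
  have D01 t : t \in `]0, 1[%R -> is_derive t 1 (fun t => re (W (U t) k)) (re (W u k)).
    by rewrite in_itv /= => t01; apply: Dk; lra.
  have C01 : {within `[0, 1], continuous (fun t => re (W (U t) k))}.
    apply: continuous_in_subspaceT => t /set_mem /=; rewrite in_itv /= => t01.
    have t12 : -1 < t < 2 by lra.
    exact: is_derive_cont (Dk t t12).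
  have [t _] := MVT h01 D01 C01.
  by rewrite subr0 mulr1 => <-; rewrite addrC subrK.
apply/funext => k.
have U1 : U 1 = dist_add w u by apply/funext => j; rewrite /U /dist_add /dist_scale mul1r.
have U0 : U 0 = w by apply/funext => j; rewrite /U /dist_add /dist_scale mul0r addr0.
have dk t : -1 < t < 2 -> dC (fun t => W (U t) k) t (W u k).
  by move=> It; exact: (has_deriv_dC k It D).
apply: eq_ReIm.
  have := E k (@complex.Re R) (fun t It => (dk t It).1).
  by rewrite U1 U0 /dist_add cReD.
have := E k (@complex.Im R) (fun t It => (dk t It).2).
by rewrite U1 U0 /dist_add cImD.
Qed.

Lemma W_scale s u (lam : R) : inH s u ->
  W (dist_scale lam%:C%C u) = dist_scale lam%:C%C (W u).
Proof. exact: (smoothing_scale hW). Qed.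

Lemma W_sub s u w : inH s u -> inH s w -> W (dist_sub w u) = dist_sub (W w) (W u).
Proof.
move=> hu hw.
have -> : dist_sub w u = dist_add w (dist_scale (- 1)%:C%C u).
  by apply/funext => k; rewrite /dist_sub /dist_add /dist_scale rmorphN /= mulN1r.
rewrite (W_add (inHZ _ hu) hw) (W_scale _ hu).
by apply/funext => k; rewrite /dist_sub /dist_add /dist_scale rmorphN /= mulN1r.
Qed.

(** Linear scaling cancels eps, so every estimate on W_eps is automatically uniform in eps. *)
Lemma Weps_id s eps u : eps != 0 -> inH s u -> Weps W eps u = W u.
Proof.
move=> e0 hu; rewrite /Weps (W_scale _ hu); apply/funext => k.
by rewrite /dist_scale mulrA -rmorphM /= mulVf // mul1r.
Qed.

Lemma contH_W s I (u : R -> distr R) : contH s I u -> contH s I (fun t => W (u t)).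
Proof.
have [K K0 hK] := W_hb s; apply: (@contH_lin _ s s I u W K) => //; first exact: ltW.
by move=> a b ha hb'; exact: (W_sub hb' ha).
Qed.

Lemma has_deriv_W s (a b : R) (u w : R -> distr R) : contH s `]a, b[ u -> contH s `]a, b[ w ->
  has_deriv_H s `]a, b[ u w ->
  has_deriv_H s `]a, b[ (fun t => W (u t)) (fun t => W (w t)).
Proof.
move=> cu cw du; have le : s - N%:R <= s by rewrite gerBl.
apply: (smoothing_dt hW).
- exact: contH_mono cu.
- exact: contH_mono cw.
- exact: has_deriv_mono du.
Qed.

(** Real-valuedness in the form that makes the transport form antisymmetric in [transport_form]. *)
Lemma W_conj s u k : inH s u -> W u (- k) = (W u k)^*%C.
Proof.
move=> /(smoothing_real hW) h; have := congr1 (fun z : distr R => z (- k)) h.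
by rewrite /dist_conj opprK.
Qed.

End SmoothingOperator.

Section WeakTimeDerivative.
Variable R : realType.
Implicit Types (T t s e : R) (u w : R -> distr R).
Local Notation mu := (@lebesgue_measure R).

Lemma closed_itvP (p q t : R) : (`[p, q] : set R) t <-> p <= t <= q.
Proof. by rewrite /= in_itv. Qed.

Lemma oo_sub_cc (p q : R) : (`]p, q[ : set R) `<=` `[p, q].
Proof. by move=> t /open_itvP/andP[h1 h2]; apply/closed_itvP; rewrite !ltW. Qed.

Lemma coef_within s T u k (re : R[i] -> R) : (forall x y, re (x - y) = re x - re y) ->
  (forall x, `|re x| <= nc x) -> contH s `[0, T] u ->
  {within `[0, T], continuous (fun t => re (u t k))}.
Proof.
move=> reB re_le cu; apply: within_itv_eps => t /closed_itvP It e e0.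
have e1 : 0 < e / wt (- s) k by rewrite divr_gt0 ?wt_gt0.
have [d d0 hd] := contH_hb cu It e1.
exists d => // t' /closed_itvP It' td; rewrite -reB; apply: le_trans (re_le _) _.
apply: le_trans (hb_term k (hd t' It' td)) _.
by rewrite mulrC divfK // gt_eqF // wt_gt0.
Qed.

Lemma weak_dt_dC s T u w : 0 < T -> contH s `[0, T] u -> contH s `[0, T] w ->
  weak_dt T u w -> forall t k, 0 < t < T -> dC (fun x => u x k) t (w t k).
Proof.
move=> T0 cu cw H t k tT.
have R1 (x y : R[i]) : complex.Re (x - y) = complex.Re x - complex.Re y by rewrite cReD cReN.
have I1 (x y : R[i]) : complex.Im (x - y) = complex.Im x - complex.Im y by rewrite cImD cImN.
split.
  apply: (weak_derive T0 (@coef_within s T u k (@complex.Re R) R1 (@Re_le_nc R) cu) (@coef_within s T w k (@complex.Re R) R1 (@Re_le_nc R) cw)) => //.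
  move=> phi tphi; have := congr1 (@complex.Re R) (H phi k tphi).
  rewrite /cintegral /= => E; apply: etrans (etrans E _).
    by apply: eq_Rintegral => x _; rewrite cReM /= mul0r subr0.
  by congr (- _); apply: eq_Rintegral => x _; rewrite cReM /= mul0r subr0.
apply: (weak_derive T0 (@coef_within s T u k (@complex.Im R) I1 (@Im_le_nc R) cu) (@coef_within s T w k (@complex.Im R) I1 (@Im_le_nc R) cw)) => //.
move=> phi tphi; have := congr1 (@complex.Im R) (H phi k tphi).
rewrite /cintegral /= => E; apply: etrans (etrans E _).
  by apply: eq_Rintegral => x _; rewrite cImM /= mul0r addr0.
by congr (- _); apply: eq_Rintegral => x _; rewrite cImM /= mul0r addr0.
Qed.

Lemma dC_weak_dt s T u w u' w' : 0 < T -> contH s `[0, T] u -> contH s `[0, T] w ->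
  (forall t k, 0 < t < T -> dC (fun x => u x k) t (w t k)) ->
  (forall t, 0 <= t <= T -> u' t = u t) -> (forall t, 0 <= t <= T -> w' t = w t) ->
  weak_dt T u' w'.
Proof.
move=> T0 cu cw H uE wE phi k tphi.
have R1 (x y : R[i]) : complex.Re (x - y) = complex.Re x - complex.Re y by rewrite cReD cReN.
have I1 (x y : R[i]) : complex.Im (x - y) = complex.Im x - complex.Im y by rewrite cImD cImN.
apply: eq_ReIm; rewrite /cintegral /=.
  have E := ibp_eq T0 tphi (@coef_within s T u k (@complex.Re R) R1 (@Re_le_nc R) cu)
    (@coef_within s T w k (@complex.Re R) R1 (@Re_le_nc R) cw) (fun t tT => (H t k tT).1).
  apply: etrans (etrans E _).
    by apply: eq_Rintegral => x /set_mem /closed_itvP xT; rewrite cReM /= mul0r subr0 wE.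
  by congr (- _); apply: eq_Rintegral => x /set_mem /closed_itvP xT; rewrite cReM /= mul0r subr0 uE.
have E := ibp_eq T0 tphi (@coef_within s T u k (@complex.Im R) I1 (@Im_le_nc R) cu)
    (@coef_within s T w k (@complex.Im R) I1 (@Im_le_nc R) cw) (fun t tT => (H t k tT).2).
apply: etrans (etrans E _).
  by apply: eq_Rintegral => x /set_mem /closed_itvP xT; rewrite cImM /= mul0r addr0 wE.
by congr (- _); apply: eq_Rintegral => x /set_mem /closed_itvP xT; rewrite cImM /= mul0r addr0 uE.
Qed.

End WeakTimeDerivative.

(** * The evolution equations of v, eps v' and eps^2 v'' *)

Section Transport.
Variable R : realType.
Implicit Types (s t : R) (a b u : distr R).

Definition NL a b : distr R := fconv a (dx b).

Lemma hb_NL s a b A B : 0 <= s -> hb (s + 1) a A -> hb (s + 1) b B ->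
  hb s (NL a b) (cC s * (A * B)).
Proof. by move=> s0 ha hb'; apply: hb_conv => //; exact: hb_dx. Qed.

Lemma contH_NL s I (u w : R -> distr R) : 0 <= s -> contH (s + 1) I u -> contH (s + 1) I w ->
  contH s I (fun t => NL (u t) (w t)).
Proof. by move=> s0 cu cw; apply: contH_fconv => //; exact: contH_dx. Qed.

Lemma dC_NL s (p q : R) (a a' b b' : R -> distr R) t k : 0 <= s -> p < t < q ->
  (forall x, p < x < q -> inH s (a x)) -> inH s (a' t) ->
  (forall x, p < x < q -> inH (- s + 1) (b x)) -> inH (- s + 1) (b' t) ->
  has_deriv_H s `]p, q[ a a' -> has_deriv_H (- s + 1) `]p, q[ b b' ->
  dC (fun x => NL (a x) (b x) k) t (NL (a' t) (b t) k + NL (a t) (b' t) k).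
Proof.
move=> s0 tpq ia ia' ib ib' da db.
have idx (z : distr R) : inH (- s + 1) z -> inH (- s) (dx z).
  by move=> /inHP[B hB]; apply/inHP; exists B; exact: hb_dx.
apply: (@dC_fconv R s p q a a' (fun x => dx (b x)) (fun x => dx (b' x)) t k) => //.
- by move=> x /ib /idx.
- exact: idx.
- exact: has_deriv_dx.
Qed.

Lemma inH_dx s u : inH (s + 1) u -> inH s (dx u).
Proof. by move=> /inHP[B h]; apply/inHP; exists B; exact: hb_dx. Qed.

Lemma l1_hb0 u C : sumle (fun k => nc (u k)) C -> hb 0 u C.
Proof.
move=> h; have C0 := sumle_ge0 h; split=> // r ur; rewrite expr2.
apply: (@le_trans _ _ (\sum_(k <- r) C * nc (u k))).
  apply: ler_sum => k _; rewrite wt0 mul1r expr2 ler_wpM2r ?nc_ge0 //.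
  exact: (sumle_term k h).
by rewrite -mulr_sumr ler_wpM2l // h.
Qed.

(** Stands for the Fourier coefficients of the cut-off. Order 2 covers the levels s = 0 and s = 3/2
    at which [L] is applied, and the square of the frequency gap in [damping_form]. *)
Variable c : distr R.
Variable Cc : R.
Hypothesis hc : sumle (fun k => wt 2 k * nc (c k)) Cc.

Lemma hc_s s : s <= 2 -> sumle (fun k => wt s k * nc (c k)) Cc.
Proof. by move=> s2; apply: sumle_le hc => k; rewrite ler_wpM2r ?nc_ge0 ?wt_le. Qed.

Lemma c_hb0 : hb 0 c Cc.
Proof.
apply: l1_hb0; apply: sumle_le (hc_s (_ : 0 <= 2)) => // k.
by rewrite wt0 mul1r.
Qed.

Lemma c_in0 : inH 0 c. Proof. by apply/inHP; exists Cc; exact: c_hb0. Qed.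

(** The singular part of the equation with its factor 1/eps removed: i |D|^(3/2) plus multiplication
    by chi. *)
Definition L u : distr R :=
  dist_add (dist_scale (0 +i* 1)%C (absD (3 / 2) u)) (fconv c u).

Definition cL s : R := 1 + peetre s * Cc.

Lemma Cc_ge0 : 0 <= Cc. Proof. exact: sumle_ge0 hc. Qed.

Lemma hb_fconv_c s u B : 0 <= s <= 2 -> hb s u B -> hb s (fconv c u) (peetre s * Cc * B).
Proof.
by move=> /andP[s0 s2] hu; rewrite -mulrA; apply: hb_conv_l1 => //; exact: hc_s.
Qed.

Lemma hb_L s u B : 0 <= s <= 2 -> hb (s + 3 / 2) u B -> hb s (L u) (cL s * B).
Proof.
move=> s02 hu; rewrite /cL mulrDl mul1r; apply: hbD.
  have := hbZ (0 +i* 1)%C (hb_absD (_ : 0 <= 3 / 2) hu).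
  by rewrite nc_imag normr1 mul1r; apply; rewrite divr_ge0.
by apply: hb_fconv_c => //; apply: hb_mono hu; lra.
Qed.

Lemma fconv_cB u w : inH 0 u -> inH 0 w ->
  fconv c (dist_sub u w) = dist_sub (fconv c u) (fconv c w).
Proof. by move=> hu hw; apply: (@convBr _ 0) => //; rewrite ?oppr0 //; exact: c_in0. Qed.

Lemma contH_L s I (u : R -> distr R) : 0 <= s <= 2 -> contH (s + 3 / 2) I u ->
  contH s I (fun t => L (u t)).
Proof.
move=> s02 cu; apply: contH_add.
  by apply: contH_scale; apply: contH_absD => //; rewrite divr_ge0.
have cu' : contH s I u by apply: contH_mono cu; lra.
apply: (@contH_lin _ s s I u (fconv c) (peetre s * Cc)) => //.
- by rewrite mulr_ge0 ?Cc_ge0 // ltW // peetre_gt0.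
- by move=> a B; exact: hb_fconv_c.
- have s0 : 0 <= s by case/andP: s02.
  by move=> a b ha hb'; exact: fconv_cB (inH_mono s0 ha) (inH_mono s0 hb').
Qed.

Lemma dC_L (p q : R) (b b' : R -> distr R) t k : p < t < q ->
  (forall x, p < x < q -> inH 0 (b x)) -> inH 0 (b' t) ->
  has_deriv_H 0 `]p, q[ b b' -> dC (fun x => L (b x) k) t (L (b' t) k).
Proof.
move=> tpq ib ib' db; apply: dC_add.
  apply: dC_scale; apply: dC_scale; exact: (has_deriv_dC k tpq db).
have z0 : inH 0 (fun=> 0 : R[i]) by apply/inHP; exists 0; exact: hb_zero.
have := @dC_fconv R 0 p q (fun=> c) (fun=> (fun=> 0)) b b' t k (lexx 0) tpq
  (fun _ _ => c_in0) z0.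
rewrite oppr0 => /(_ ib ib' (@has_deriv_cst R 0 _ c) db).
by rewrite fconv0l add0r.
Qed.

Lemma NLZr a z b s : 0 <= s -> inH s a -> inH (- s + 1) b ->
  NL a (dist_scale z b) = dist_scale z (NL a b).
Proof.
move=> s0 ha hb'; rewrite /NL /dx fmultZ (@convZr _ s) //; exact: inH_dx.
Qed.

Lemma NLZl a z b s : 0 <= s -> inH s a -> inH (- s + 1) b ->
  NL (dist_scale z a) b = dist_scale z (NL a b).
Proof.
by move=> s0 ha hb'; rewrite /NL (@convZl _ s) //; exact: inH_dx.
Qed.

Lemma LZ z u : inH 0 u -> L (dist_scale z u) = dist_scale z (L u).
Proof.
move=> hu; rewrite /L /absD fmultZ (@convZr _ 0) ?oppr0 //; last exact: c_in0.
by apply/funext => k; rewrite /dist_add /dist_scale; ring.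
Qed.

End Transport.

Section Evolution.
Variables (R : realType) (N : nat) (W : distr R -> distr R).
Hypothesis hW : smoothing N W.
Variables (c : distr R) (Cc : R).
Hypothesis hc : sumle (fun k => wt 2 k * nc (c k)) Cc.
Implicit Types (s t e B : R) (u w : distr R).

(* For a solution, [V1 eps v] and [V2 eps v] are [eps v'] and [eps^2 v'']. *)
Definition V1 (eps : R) u : distr R :=
  dist_scale (- 1) (dist_add (dist_scale eps%:C%C (NL (W u) u)) (L c u)).

Definition V2 (eps : R) u : distr R :=
  dist_scale (- 1) (dist_add (dist_scale eps%:C%C
    (dist_add (NL (W (V1 eps u)) u) (NL (W u) (V1 eps u)))) (L c (V1 eps u))).

Definition F1 (eps : R) u : distr R := NL (W (V1 eps u)) u.

Definition F2 (eps : R) u : distr R :=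
  dist_add (NL (W (V2 eps u)) u) (dist_scale 2 (NL (W (V1 eps u)) (V1 eps u))).

Lemma nc_N1 : nc (- 1 : R[i]) = 1.
Proof. by rewrite ncN ComplexField.Normc.normc1. Qed.

Lemma hb_eps s (eps : R) u B : 0 < eps < 1 -> hb s u B -> hb s (dist_scale eps%:C%C u) B.
Proof.
move=> /andP[e0 e1] h; apply: hbW (hbZ _ h); rewrite nc_real gtr0_norm //.
by rewrite ler_piMl ?(ltW e1) // h.1.
Qed.

(** Half of the three derivatives of v are spent on |D|^(3/2). The factor eps only helps, so M1
    depends on M, W and chi. *)
Lemma V1_bound M : exists M1, forall eps u, 0 < eps < 1 -> hb 3 u M ->
  hb (3 / 2) (V1 eps u) M1.
Proof.
have [K K0 hK] := W_hb hW (3 / 2 + 1).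
exists (cC (3 / 2) * (K * M * M) + cL Cc (3 / 2) * M) => eps u he hu.
have h1 : hb (3 / 2 + 1) u M by apply: hb_mono hu; lra.
have h2 : hb (3 / 2 + 3 / 2) u M by apply: hb_mono hu; lra.
have s0 : (0 : R) <= 3 / 2 by lra.
have s2 : 0 <= (3 / 2 : R) <= 2 by rewrite s0 /=; lra.
have := hbZ (- 1) (hbD (hb_eps he (hb_NL s0 (hK _ _ h1) h1)) (hb_L hc s2 h2)).
by rewrite nc_N1 mul1r.
Qed.

(* Interpolation [|k| <= d |k|^(3/2) + d^-2] absorbs one derivative of [V1] in the
   identity defining [V2]. *)
Lemma interp (x d : R) : 0 <= x -> 0 < d -> x <= d * x `^ (3 / 2) + (d ^+ 2)^-1.
Proof.
move=> x0 d0.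
have -> : x `^ (3 / 2) = x * Num.sqrt x.
  have [->|xn] := eqVneq x 0; first by rewrite mul0r powR0 // gt_eqF //; lra.
  have -> : 3 / 2 = 1 + 2^-1 :> R by lra.
  by rewrite powRD ?xn ?implybT // powRr1 // powR12_sqrt.
have [h|h] := lerP 1 (d * Num.sqrt x).
  apply: (@le_trans _ _ (d * (x * Num.sqrt x))); last by rewrite lerDl invr_ge0 exprn_ge0 // ltW.
  by rewrite mulrCA ler_peMr.
apply: (@le_trans _ _ (d ^+ 2)^-1).
  rewrite -(sqr_sqrtr x0) -exprVn ler_pXn2r ?nnegrE ?sqrtr_ge0 ?invr_ge0 ?(ltW d0) //.
  by rewrite -[d^-1]mulr1 ler_pdivlMl // ltW.
by rewrite lerDr mulr_ge0 ?mulr_ge0 ?sqrtr_ge0 // ltW.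
Qed.

(** The norm X of (V_1)_x appears on both sides, since W(u) (V_1)_x is part of V_2. It is finite
    because V_1 lies in H^(3/2), which the hypothesis with [hn] encodes, and [interp] with a small
    parameter absorbs it. The outcome is linear in r. *)
Lemma elliptic M : 0 <= M -> exists2 C, 0 <= C & forall eps u r, 0 < eps < 1 -> hb 3 u M ->
  hb (3 / 2) (V1 eps u) (hn (3 / 2) (V1 eps u)) ->
  hb 0 (V1 eps u) r -> hb 0 (V2 eps u) r -> hb 0 (dx (V1 eps u)) (C * r).
Proof.
move=> M0.
have [K0 K00 hK0] := W_hb hW 0; have [K1 K10 hK1] := W_hb hW (0 + 1).
have Cc0 := Cc_ge0 hc.
have cC0 : 0 <= cC (0 : R) by exact: cC_ge0.
have p0 : 0 <= peetre (0 : R) by exact/ltW/peetre_gt0.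
(* Q is the coefficient of X, from W(u) (V_1)_x. P collects the coefficients of r: 1 for V_2, then
   W(V_1) u_x and chi V_1. *)
pose Q := cC 0 * (K1 * M).
pose P := 1 + cC 0 * (K0 * M) + peetre 0 * Cc.
have Q0 : 0 <= Q by rewrite !mulr_ge0 // ltW.
have P0 : 0 <= P by rewrite !addr_ge0 // !mulr_ge0 // ltW.
(* Chosen so that d Q <= 1/2, which lets X be absorbed; the final constant is then twice the
   remaining coefficient of r. *)
pose d := (2 * (Q + 1))^-1.
have d0 : 0 < d by rewrite invr_gt0 mulr_gt0 // ltr_wpDl.
exists (2 * (d * P + (d ^+ 2)^-1)).
  by rewrite mulr_ge0 // addr_ge0 ?invr_ge0 ?exprn_ge0 ?mulr_ge0 // ltW.
move=> eps u r he hu hv32 hv hv2.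
set v := V1 eps u in hv32 hv hv2 *.
have iv1 : inH (0 + 1) v by apply: (@inH_mono _ _ (3 / 2)); [lra|apply/inHP; eexists; exact: hv32].
have idv : inH 0 (dx v) by exact: inH_dx.
set X := hn 0 (dx v).
have hX : hb 0 (dx v) X by exact: hn_hb.
have X0 : 0 <= X by exact: hn_ge0.
have r0 : 0 <= r by exact: hv.1.
have hu1 : hb (0 + 1) u M by apply: hb_mono hu; lra.
have hdu : hb 1 (dx u) M by apply: hb_dx; apply: hb_mono hu; lra.
have n1 : hb 0 (NL (W v) u) (cC 0 * (K0 * r * M)).
  by apply: hb_conv0r => //; exact: hK0.
have n2 : hb 0 (NL (W u) v) (cC 0 * (K1 * M * X)).
  by apply: hb_conv => //; exact: hK1.
have n3 : hb 0 (fconv c v) (peetre 0 * Cc * r).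
  by apply: (hb_fconv_c hc) => //; rewrite lexx /=.
(* The definition of V_2 solved for |D|^(3/2) V_1, by adding back the other terms and multiplying by
   i. *)
have nA : hb 0 (absD (3 / 2) v) (P * r + Q * X).
  have := hbZ (0 +i* 1)%C (hbD hv2 (hbD (hb_eps he (hbD n1 n2)) n3)).
  rewrite nc_imag normr1 mul1r.
  have -> : dist_scale (0 +i* 1)%C (dist_add (V2 eps u) (dist_add (dist_scale eps%:C%C
      (dist_add (NL (W v) u) (NL (W u) v))) (fconv c v))) = absD (3 / 2) v.
    apply/funext => k; rewrite /V2 /L -/v /dist_scale /dist_add.
    move: (NL (W v) u k) (NL (W u) v k) (fconv c v k) (absD (3 / 2) v k) => x1 x2 x3 x4.
    have ii : (0 +i* 1)%C * (0 +i* 1)%C = - 1 :> R[i].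
      by apply: eq_ReIm; rewrite ?cReM ?cImM /= ?mul0r ?mulr0 ?mulr1 ?mul1r ?sub0r ?addr0 ?oppr0.
    have -> : (0 +i* 1)%C * (-1 * (eps%:C%C * (x1 + x2) + ((0 +i* 1)%C * x4 + x3)) +
      (eps%:C%C * (x1 + x2) + x3)) = - (((0 +i* 1)%C * (0 +i* 1)%C) * x4) by ring.
    by rewrite ii mulN1r opprK.
  apply: hbW; rewrite le_eqVlt; apply/orP; left; apply/eqP; rewrite /P /Q; ring.
have nX : hb 0 (dx v) (d * (P * r + Q * X) + (d ^+ 2)^-1 * r).
  have d20 : 0 <= (d ^+ 2)^-1 by rewrite invr_ge0 exprn_ge0 // ltW.
  have := hbD (hbZ d%:C%C nA) (hbZ (d ^+ 2)^-1%:C%C hv).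
  rewrite !nc_real !ger0_norm ?(ltW d0) // => -[B0 hB]; split=> // s us.
  have Y0 : 0 <= d * (P * r + Q * X) by rewrite mulr_ge0 ?(ltW d0) // nA.1.
  have Z0 : 0 <= (d ^+ 2)^-1 * r by rewrite mulr_ge0.
  apply: le_trans (sum_sqD (a := fun k => d * nc (absD (3 / 2) v k))
    (b := fun k => (d ^+ 2)^-1 * nc (v k)) Y0 Z0 _ _).
  - apply: ler_sum => k _; rewrite ler_pXn2r ?nnegrE ?addr_ge0 ?mulr_ge0 ?nc_ge0 ?wt_ge0 ?(ltW d0) //.
    rewrite wt0 mul1r /dx /absD /fmult; move: (v k) => vk; rewrite !ncM nc_imag nc_real.
    rewrite [`|_ `^ _|]ger0_norm ?powR_ge0 // [d * (_ * _)]mulrA -mulrDl ler_wpM2r ?nc_ge0 //.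
    exact: interp.
  - under eq_bigr do rewrite exprMn; rewrite -mulr_sumr exprMn ler_wpM2l ?sqr_ge0 //.
    have [_ /(_ s us)] := nA; congr (_ <= _); apply: eq_bigr => k _; by rewrite wt0 mul1r.
  - under eq_bigr do rewrite exprMn; rewrite -mulr_sumr exprMn ler_wpM2l ?sqr_ge0 //.
    have [_ /(_ s us)] := hv; congr (_ <= _); apply: eq_bigr => k _; by rewrite wt0 mul1r.
have := hn_le nX; rewrite -/X => hXX.
have dQ : d * (Q * X) <= X / 2.
  rewrite mulrA [X / 2]mulrC ler_wpM2r // /d ler_pdivrMl ?mulr_gt0 ?ltr_wpDl //.
  by rewrite mulrAC mulfV // mul1r lerDl.
have XC : X <= 2 * (d * P + (d ^+ 2)^-1) * r.
  have E : d * (P * r + Q * X) + (d ^+ 2)^-1 * r = (d * P + (d ^+ 2)^-1) * r + d * (Q * X) by ring.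
  rewrite E in hXX; rewrite -mulrA; move: hXX dQ; move: (_ * r) => Y; lra.
exact: hbW XC hX.
Qed.

Lemma F_bounds M : 0 <= M -> exists2 C, 0 <= C & forall eps u r, 0 < eps < 1 -> hb 3 u M ->
  hb 0 (V1 eps u) r -> hb 0 (V2 eps u) r ->
  hb 0 (F1 eps u) (C * r) /\ hb 0 (F2 eps u) (C * r).
Proof.
move=> M0; have [M1 hM1] := V1_bound M; have [C1 C10 hC1] := elliptic M0.
have [K0 K00 hK0] := W_hb hW 0; have [K1 K10 hK1] := W_hb hW (0 + 1).
have cC0 : 0 <= cC (0 : R) by exact: cC_ge0.
pose A := cC 0 * (K0 * M); pose B := 2 * (cC 0 * (K1 * `|M1| * C1)).
have A0 : 0 <= A by exact: mulr_ge0 cC0 (mulr_ge0 (ltW K00) M0).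
have B0 : 0 <= B.
  by apply: mulr_ge0 => //; apply: mulr_ge0 => //; apply: mulr_ge0 => //; apply: mulr_ge0 => //; exact: ltW.
exists (A + B); first exact: addr_ge0.
move=> eps u r he hu hv hv2; have r0 := hv.1.
have hdu : hb 1 (dx u) M by apply: hb_dx; apply: hb_mono hu; lra.
have n1 w : hb 0 w r -> hb 0 (NL (W w) u) (A * r).
  move=> hw; have := hb_conv0r (hK0 _ _ hw) hdu; apply: hbW.
  by rewrite le_eqVlt; apply/orP; left; apply/eqP; rewrite /A; ring.
have hV1 := hM1 eps u he hu.
have iV1 : inH (3 / 2) (V1 eps u) by apply/inHP; exists M1.
have hdv := hC1 eps u r he hu (hn_hb iV1) hv hv2.
have hW1 : hb (0 + 1) (W (V1 eps u)) (K1 * `|M1|).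
  by apply: hK1; apply: hbW (ler_norm _) _; apply: hb_mono hV1; lra.
have n2 : hb 0 (NL (W (V1 eps u)) (V1 eps u)) (cC 0 * (K1 * `|M1| * (C1 * r))).
  exact: hb_conv.
split; first by apply: hbW (n1 _ hv); rewrite mulrDl lerDl mulr_ge0.
have := hbD (n1 _ hv2) (hbZ 2 n2); apply: hbW.
have -> : nc (2 : R[i]) = 2.
  have -> : (2 : R[i]) = (2 : R)%:C%C by rewrite rmorph_nat.
  by rewrite nc_real ger0_norm.
by rewrite le_eqVlt; apply/orP; left; apply/eqP; rewrite /B; ring.
Qed.

Variables (eps T : R) (v : R -> distr R).
Hypothesis heps : 0 < eps < 1.
Hypothesis T0 : 0 < T.
Hypothesis cv : contH 3 `[0, T] v.
Hypothesis weq : weak_dt T v (fun t => dist_scale (eps^-1)%:C%C (V1 eps (v t))).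

Let v1 t := V1 eps (v t).
Let v2 t := V2 eps (v t).

Let le1 : (3 / 2 + 1 : R) <= 3. Proof. lra. Qed.
Let le2 : (3 / 2 + 3 / 2 : R) <= 3. Proof. lra. Qed.
Let le3 : (0 + 1 : R) <= 3 / 2. Proof. lra. Qed.
Let le4 : (0 + 3 / 2 : R) <= 3 / 2. Proof. lra. Qed.
Let le5 : (0 + 1 : R) <= 3. Proof. lra. Qed.
Let le6 : (3 / 2 : R) <= 3. Proof. lra. Qed.
Let le7 : (0 : R) <= 3 / 2. Proof. lra. Qed.
Let le8 : 0 <= (3 / 2 : R) <= 2. Proof. lra. Qed.
Let le9 : 0 <= (0 : R) <= 2. Proof. lra. Qed.
Let le10 : (1 : R) <= 3 / 2. Proof. lra. Qed.
Let le11 : (- 0 + 1 : R) <= 3 / 2. Proof. lra. Qed.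
Let le12 : (- 1 + 1 : R) <= 0. Proof. lra. Qed.
Let le13 : (0 : R) <= 3. Proof. lra. Qed.

Lemma contH_V1 : contH (3 / 2) `[0, T] v1.
Proof.
apply: contH_scale; apply: contH_add.
  apply: contH_scale; apply: contH_NL => //; last exact: contH_mono cv.
  exact: contH_mono le1 (contH_W hW cv).
apply: (contH_L hc) => //; exact: contH_mono le2 cv.
Qed.

Lemma contH_V2 : contH 0 `[0, T] v2.
Proof.
have cv1 := contH_V1.
apply: contH_scale; apply: contH_add.
  apply: contH_scale; apply: contH_add.
    apply: contH_NL => //; last exact: contH_mono cv.
    exact: contH_mono le3 (contH_W hW cv1).
  apply: contH_NL => //; last exact: contH_mono cv1.
  exact: contH_mono le5 (contH_W hW cv).
apply: (contH_L hc) => //; exact: contH_mono le4 cv1.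
Qed.

Lemma deriv_V0 t k : 0 < t < T -> dC (fun x => v x k) t ((eps^-1)%:C%C * v1 t k).
Proof.
exact: (weak_dt_dC T0 (contH_mono le6 cv) (contH_scale _ contH_V1) weq).
Qed.

Let oc : `]0, T[ `<=` (`[0, T] : set R). Proof. exact: oo_sub_cc. Qed.

Let iv t : 0 < t < T -> inH 3 (v t).
Proof. by move=> tT; apply: cv.1; apply: oc; apply/open_itvP. Qed.
Let iv1 t : 0 < t < T -> inH (3 / 2) (v1 t).
Proof. by move=> tT; apply: contH_V1.1; apply: oc; apply/open_itvP. Qed.
Let iv2 t : 0 < t < T -> inH 0 (v2 t).
Proof. by move=> tT; apply: contH_V2.1; apply: oc; apply/open_itvP. Qed.

Lemma W_in s u : inH s u -> inH s (W u).
Proof.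
by have [K _ hK] := W_hb hW s => /inHP[B hB]; apply/inHP; exists (K * B); exact: hK.
Qed.

(** Differentiating W(v) through [smoothing_dt] needs a derivative in the Sobolev norm; continuity
    of V_1 in H^(3/2) upgrades the coefficientwise one. *)
Lemma strong_V0 : has_deriv_H (3 / 2) `]0, T[ v (fun t => dist_scale (eps^-1)%:C%C (v1 t)).
Proof.
apply: strong_deriv => [t k tT|]; first exact: deriv_V0.
exact: contH_sub oc (contH_scale _ contH_V1).
Qed.

Lemma has_deriv_eq s I (u w w' : R -> distr R) : (forall t, I t -> w t = w' t) ->
  has_deriv_H s I u w -> has_deriv_H s I u w'.
Proof. by move=> ww H t It; rewrite -ww //; exact: H. Qed.

Lemma strong_W0 : has_deriv_H (3 / 2) `]0, T[ (fun t => W (v t))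
  (fun t => dist_scale (eps^-1)%:C%C (W (v1 t))).
Proof.
apply: has_deriv_eq (has_deriv_W hW _ _ strong_V0).
- by move=> t /open_itvP tT; rewrite (W_scale hW _ (iv1 tT)).
- exact: contH_sub oc (contH_mono le6 cv).
- exact: contH_sub oc (contH_scale _ contH_V1).
Qed.

Lemma deriv_V1 t k : 0 < t < T -> dC (fun x => v1 x k) t ((eps^-1)%:C%C * v2 t k).
Proof.
move=> tT.
have it (x : R) : 0 < x < T -> inH (- 0 + 1) (v x).
  by move=> /iv; apply: inH_mono; rewrite oppr0.
have i0 (x : R) : 0 < x < T -> inH 0 (W (v x)).
  by move=> /iv /W_in; exact: inH_mono.
have h := inH_mono le11 (iv1 tT).
have h0 := inH_mono le7 (iv1 tT).
have D1 := @dC_NL R 0 0 T (fun x => W (v x)) (fun x => dist_scale (eps^-1)%:C%C (W (v1 x)))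
  v (fun x => dist_scale (eps^-1)%:C%C (v1 x)) t k (lexx 0) tT i0
  (inHZ _ (W_in h0)) it (inHZ _ h) (has_deriv_mono le7 strong_W0) (has_deriv_mono le11 strong_V0).
have D2 := @dC_L R c Cc hc 0 T v (fun x => dist_scale (eps^-1)%:C%C (v1 x)) t k tT
  (fun x xT => inH_mono le13 (iv xT)) (inHZ _ h0) (has_deriv_mono le7 strong_V0).
apply: dC_eq (dC_scale (- 1) (dC_add (dC_scale eps%:C%C D1) D2)) _.
rewrite (@NLZl R (W (v1 t)) _ (v t) 0) //; [|exact: W_in h0|exact: it].
rewrite (@NLZr R (W (v t)) _ (v1 t) 0) //; last exact: i0.
rewrite (LZ hc _ h0) /v2 /V2 /dist_scale /dist_add -/(v1 t).
move: (NL (W (v1 t)) (v t) k) (NL (W (v t)) (v1 t) k) (L c (v1 t) k) => x1 x2 x3; ring.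
Qed.

Lemma strong_V1 : has_deriv_H 0 `]0, T[ v1 (fun t => dist_scale (eps^-1)%:C%C (v2 t)).
Proof.
apply: strong_deriv => [t k tT|]; first exact: deriv_V1.
exact: contH_sub oc (contH_scale _ contH_V2).
Qed.

Lemma strong_W1 : has_deriv_H 0 `]0, T[ (fun t => W (v1 t))
  (fun t => dist_scale (eps^-1)%:C%C (W (v2 t))).
Proof.
apply: has_deriv_eq (has_deriv_W hW _ _ strong_V1).
- by move=> t /open_itvP tT; rewrite (W_scale hW _ (iv2 tT)).
- exact: contH_sub oc (contH_mono le7 contH_V1).
- exact: contH_sub oc (contH_scale _ contH_V2).
Qed.

(* [v], [V1 eps v] and [V2 eps v] all solve [u' = rhs a F u] with [a = W v] and [F = 0],
   [F1 eps v], [F2 eps v] respectively. *)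
Definition rhs (a F u : distr R) : distr R :=
  fun k => - (NL a u k + F k + (eps^-1)%:C%C * L c u k).

Let ee : (eps^-1)%:C%C * eps%:C%C = 1 :> R[i].
Proof. by rewrite -rmorphM /= mulVf // gt_eqF //; case/andP: heps. Qed.

Lemma evol_V0 t k : 0 < t < T -> dC (fun x => v x k) t (rhs (W (v t)) (fun=> 0) (v t) k).
Proof.
move=> /deriv_V0; move=> /(_ k) H; apply: dC_eq H _.
rewrite /rhs /v1 /V1 /dist_scale /dist_add.
move: (NL _ _ k) (L _ _ k) => x1 x2.
have -> : (eps^-1)%:C%C * (-1 * (eps%:C%C * x1 + x2)) =
  - (((eps^-1)%:C%C * eps%:C%C) * x1 + 0 + (eps^-1)%:C%C * x2) by ring.
by rewrite ee mul1r.
Qed.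

Lemma evol_V1 t k : 0 < t < T ->
  dC (fun x => v1 x k) t (rhs (W (v t)) (F1 eps (v t)) (v1 t) k).
Proof.
move=> /deriv_V1; move=> /(_ k) H; apply: dC_eq H _.
rewrite /rhs /v2 /V2 /F1 /dist_scale /dist_add -/(v1 t).
move: (NL (W (v1 t)) (v t) k) (NL (W (v t)) (v1 t) k) (L c (v1 t) k) => x0 x1 x2.
have -> : (eps^-1)%:C%C * (-1 * (eps%:C%C * (x0 + x1) + x2)) =
  - (((eps^-1)%:C%C * eps%:C%C) * (x1 + x0) + (eps^-1)%:C%C * x2) by ring.
by rewrite ee mul1r.
Qed.

Lemma evol_V2 t k : 0 < t < T ->
  dC (fun x => v2 x k) t (rhs (W (v t)) (F2 eps (v t)) (v2 t) k).
Proof.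
move=> tT.
have it (x : R) : 0 < x < T -> inH (- 0 + 1) (v x).
  by move=> /iv; apply: inH_mono; rewrite oppr0.
have i1 (x : R) : 0 < x < T -> inH 0 (W (v1 x)).
  by move=> /iv1 /W_in; exact: inH_mono.
have j0 (x : R) : 0 < x < T -> inH 1 (W (v x)).
  by move=> /iv /W_in; apply: inH_mono; rewrite -[X in X <= _]add0r.
have j1 (x : R) : 0 < x < T -> inH (- 1 + 1) (v1 x).
  by move=> /iv1; apply: inH_mono; rewrite addNr.
have k1 (x : R) : 0 < x < T -> inH 0 (v1 x) by move=> /iv1; exact: inH_mono.
have h := inH_mono le11 (iv1 tT).
have hw1 : inH 1 (W (v1 t)) by exact: W_in (inH_mono le10 (iv1 tT)).
have hv2 : inH (- 1 + 1) (v2 t) by apply: inH_mono (iv2 tT).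
have D1 := @dC_NL R 0 0 T (fun x => W (v1 x)) (fun x => dist_scale (eps^-1)%:C%C (W (v2 x)))
  v (fun x => dist_scale (eps^-1)%:C%C (v1 x)) t k (lexx 0) tT i1
  (inHZ _ (W_in (iv2 tT))) it (inHZ _ h) strong_W1 (has_deriv_mono le11 strong_V0).
(* V_2 is only in L^2, so its product with W(v) after one derivative uses the duality with s = 1;
   the order -1 + 1 = 0 counts before the derivative. [D1] and [D2] each contribute W(V_1) (V_1)_x,
   whence the factor 2 in [F2]. *)
have D2 := @dC_NL R 1 0 T (fun x => W (v x)) (fun x => dist_scale (eps^-1)%:C%C (W (v1 x)))
  v1 (fun x => dist_scale (eps^-1)%:C%C (v2 x)) t k ler01 tT j0
  (inHZ _ hw1) j1 (inHZ _ hv2)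
  (has_deriv_mono le10 strong_W0) (has_deriv_mono le12 strong_V1).
have D3 := @dC_L R c Cc hc 0 T v1 (fun x => dist_scale (eps^-1)%:C%C (v2 x)) t k tT
  k1 (inHZ _ (iv2 tT)) strong_V1.
apply: dC_eq (dC_scale (- 1) (dC_add (dC_scale eps%:C%C (dC_add D1 D2)) D3)) _.
rewrite (@NLZl R (W (v2 t)) _ (v t) 0) //; [|exact: W_in (iv2 tT)|exact: it].
rewrite (@NLZr R (W (v1 t)) _ (v1 t) 0) //; last exact: i1.
rewrite (@NLZl R (W (v1 t)) _ (v1 t) 1) //; last exact: j1.
rewrite (@NLZr R (W (v t)) _ (v2 t) 1) //; last exact: j0.
rewrite (LZ hc _ (iv2 tT)) /rhs /F2 /dist_scale /dist_add -/(v1 t) -/(v2 t).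
move: (NL (W (v2 t)) (v t) k) (NL (W (v1 t)) (v1 t) k) (NL (W (v t)) (v2 t) k)
  (L c (v2 t) k) => x1 x2 x3 x4.
have -> : -1 * (eps%:C%C * ((eps^-1)%:C%C * x1 + (eps^-1)%:C%C * x2 +
   ((eps^-1)%:C%C * x2 + (eps^-1)%:C%C * x3)) + (eps^-1)%:C%C * x4) =
  - (((eps^-1)%:C%C * eps%:C%C) * (x3 + (x1 + 2 * x2)) + (eps^-1)%:C%C * x4) by ring.
by rewrite ee mul1r.
Qed.

End Evolution.

(** * Energy estimate for truncated frequencies *)

Section FiniteSums.
Variable R : realType.
Implicit Types (s : seq int).

(** Schur's test for a convolution kernel: Young's inequality followed by Cauchy-Schwarz. *)
Lemma schur (g x : int -> R) B A s : 0 <= A -> (forall k, 0 <= g k) -> sumle g B ->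
  sumle (fun k => x k ^+ 2) (A ^+ 2) -> uniq s ->
  \sum_(k <- s) \sum_(j <- s) g (k - j) * x j * x k <= B * A ^+ 2.
Proof.
move=> A0 g0 gB xA us; under eq_bigr do rewrite -mulr_suml.
rewrite expr2 mulrA; apply: sum_cs2 => //.
- by rewrite mulr_ge0 // (sumle_ge0 gB).
- exact: young_finite.
- exact: xA.
Qed.

(** Symmetrization requires both indices to run over the same finite set, whereas the evolution
    equation contains infinite convolutions. This passes from the former to the latter, with a bound
    uniform in m. *)
Lemma re_csum_lin (r : seq int) (w : int -> R[i]) (F : int -> int -> R[i]) B n :
  (forall k, summ (F k)) ->
  (forall m, (n <= m)%N -> complex.Re (\sum_(k <- r) w k * psum (F k) m) <= B) ->
  complex.Re (\sum_(k <- r) w k * csum (F k)) <= B.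
Proof.
move=> sF hB.
have [sG E] : summ (fun j => \sum_(k <- r) w k * F k j) /\
    csum (fun j => \sum_(k <- r) w k * F k j) = \sum_(k <- r) w k * csum (F k).
  elim: r {hB} => [|k r [IH1 IH2]].
    split.
      exists 0 => s _; rewrite big1 // => j _; by rewrite big_nil ComplexField.Normc.normc0.
    by rewrite big_nil -[RHS](@csum0 R); apply: eq_csum => j; rewrite big_nil.
  have E j : \sum_(k0 <- k :: r) w k0 * F k0 j = w k * F k j + \sum_(k0 <- r) w k0 * F k0 j.
    by rewrite big_cons.
  have s1 := summZ (w k) (sF k).
  split.
    have := summD s1 IH1; congr summ; apply/funext => j; by rewrite E.
  rewrite (eq_csum E) csumD // csumZ // IH2 big_cons //.
rewrite -E; move: (csum_psum sG); move: (csum _) => Z hZ.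
apply/ler_addgt0Pr => e e0; have [m0 hm0] := hZ e e0.
have := hm0 (maxn m0 n) (leq_maxl _ _); have := hB (maxn m0 n) (leq_maxr _ _).
rewrite /psum; under eq_bigr do rewrite mulr_sumr; rewrite exchange_big /=.
move: (\sum_(j <- _) _) => Y h1 h2.
have := Re_le_nc (Y - Z); rewrite cReD cReN ler_norml => /andP[h3 _].
move: h1 h2 h3; move: (complex.Re Y) (complex.Re Z) (nc (Y - Z)) => a b c; lra.
Qed.

(* Fejer weights. They are Lipschitz with constant [1/n], which makes both commutators
   [tent_comm] and [damping_form] harmless; a sharp cut-off would not do. *)
Definition tent (n : nat) (k : int) : R := Num.max 0 (1 - `|k%:~R| / n%:R).

Lemma tent_ge0 n k : 0 <= tent n k.
Proof. by rewrite /tent le_max lexx. Qed.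

Lemma tent_le1 n k : tent n k <= 1.
Proof. by rewrite /tent ge_max ler01 gerBl divr_ge0. Qed.

Lemma tent_out n k : (0 < n)%N -> (n < `|k|)%N -> tent n k = 0.
Proof.
move=> n0 nk; apply/max_idPl; rewrite subr_le0.
by rewrite ler_pdivlMr ?ltr0n // mul1r -intr_norm -abszE ler_nat ltnW.
Qed.

Lemma tent_lip n k j : (0 < n)%N -> `|tent n k - tent n j| <= `|(k - j)%:~R| / n%:R.
Proof.
move=> n0; have nR : 0 < n%:R^-1 :> R by rewrite invr_gt0 ltr0n.
have H := ler_dist_dist (k%:~R : R) j%:~R.
have : `| `|k%:~R| / n%:R - `|j%:~R| / n%:R| <= `|(k - j)%:~R| / n%:R :> R.
  by rewrite -mulrBl normrM (gtr0_norm nR) intrB ler_wpM2r // ltW.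
rewrite /tent; move: (_ / _) (_ / _) (_ / _) => a b c.
rewrite !ler_norml => /andP[h1 h2]; apply/andP.
by case: (leP 0 (1 - c)) => h; case: (leP 0 (1 - b)) => h'; split; lra.
Qed.

Lemma tent_weight n k : (0 < n)%N -> `|k%:~R| * tent n k <= n%:R.
Proof.
move=> n0; have [kn|kn] := ltnP n `|k|%N; first by rewrite tent_out // mulr0.
apply: (@le_trans _ _ `|k%:~R|); first by rewrite ler_piMr // tent_le1.
by rewrite -intr_norm -abszE ler_nat.
Qed.

(* The commutator estimate: the two derivatives of the symmetrized transport term
   are moved onto the coefficient. *)
Lemma tent_comm n k j : (0 < n)%N ->
  `|j%:~R * tent n k ^+ 2 - k%:~R * tent n j ^+ 2| <= 4 * `|(k - j)%:~R|.
Proof.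
move=> n0; have nR : 0 < n%:R :> R by rewrite ltr0n.
have d1 := tent_lip k j n0; have w1 := tent_weight k n0; have w2 := tent_weight j n0.
have q0 := tent_ge0 n k; have q1 := tent_le1 n k.
have p0 := tent_ge0 n j; have p1 := tent_le1 n j.
move: (tent n k) (tent n j) d1 w1 w2 q0 q1 p0 p1 => q p; rewrite intrB.
move: (k%:~R : R) (j%:~R : R) (n%:R : R) nR => x y m m0 d1 w1 w2 q0 q1 p0 p1.
set D := `|x - y| in d1 *.
have D0 : 0 <= D by exact: normr_ge0.
have dm : `|q - p| * m <= D by rewrite -ler_pdivlMr.
have qp1 : `|q - p| <= 1 by rewrite ler_norml; apply/andP; split; lra.
have e1 : `|x * q * (q - p)| <= D.
  rewrite !normrM (ger0_norm q0); apply: le_trans dm; rewrite mulrC ler_wpM2l //.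
have e2 : `|y * p * (q - p)| <= D.
  rewrite !normrM (ger0_norm p0); apply: le_trans dm; rewrite mulrC ler_wpM2l //.
have e3 : `|(y - x) * q ^+ 2| <= D.
  rewrite normrM distrC ler_piMr // ger0_norm ?sqr_ge0 // expr_le1 //.
have e4 : `|(x - y) * p * (q - p)| <= D.
  rewrite 2!normrM -mulrA ler_piMr // (ger0_norm p0) mulr_ile1 //.
(* Each of the four terms is at most D: in the second and third, the Lipschitz constant 1/n of the
   weights compensates the frequency, which is at most n where the weight is nonzero. *)
rewrite (_ : y * q ^+ 2 - x * p ^+ 2 = (y - x) * q ^+ 2 + x * q * (q - p) +
  y * p * (q - p) + (x - y) * p * (q - p)); last by ring.
move: e1 e2 e3 e4; move: ((y - x) * _) (x * q * _) (y * p * _) ((x - y) * p * _) => z1 z2 z3 z4.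
rewrite !ler_norml => /andP[a1 a2] /andP[a3 a4] /andP[a5 a6] /andP[a7 a8]; apply/andP; split; lra.
Qed.

Implicit Types (u a F : distr R).

Lemma Re_realM (x : R) (z : R[i]) : complex.Re (x%:C%C * z) = x * complex.Re z.
Proof. by rewrite cReM /= mul0r subr0. Qed.

Lemma conj_Z u a k j : (forall m, a (- m) = (a m)^*%C) ->
  (u j)^*%C * u k * a (j - k) = ((u k)^*%C * u j * a (k - j))^*%C.
Proof. by move=> ha; rewrite !cconjM -ha opprB conjcK [_ * u k]mulrC. Qed.

Lemma sym_double s (w G : int -> int -> R) (sg : R) : (forall k j, G j k = sg * G k j) ->
  2 * \sum_(k <- s) \sum_(j <- s) w k j * G k j =
  \sum_(k <- s) \sum_(j <- s) (w k j + sg * w j k) * G k j.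
Proof.
move=> hG; rewrite mulrDl !mul1r.
rewrite {2}exchange_big /= -big_split /=; apply: eq_bigr => k _.
rewrite -big_split /=; apply: eq_bigr => j _; rewrite (hG k j); ring.
Qed.

Lemma form_le s (g : int -> R) u a (w : int -> int -> R) (G : int -> int -> R) B A :
  0 <= A -> (forall k, 0 <= g k) -> sumle g B ->
  sumle (fun k => nc (u k) ^+ 2) (A ^+ 2) -> uniq s ->
  (forall k j, `|w k j * G k j| <= g (k - j) * nc (u j) * nc (u k)) ->
  `|\sum_(k <- s) \sum_(j <- s) w k j * G k j| <= B * A ^+ 2.
Proof.
move=> A0 g0 gB uA us h; apply: le_trans (schur A0 g0 gB uA us).
apply: le_trans (ler_norm_sum _ _ _) _; apply: ler_sum => k _.
by apply: le_trans (ler_norm_sum _ _ _) _; apply: ler_sum => j _.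
Qed.

(** The derivative turns the real part into -j times an imaginary part, antisymmetric in j and k
    since a is real. Symmetrization leaves the weight k q_j^2 - j q_k^2, which [tent_comm] bounds by
    4 |k-j|: the derivative now sits on a, and [schur] concludes. *)
Lemma transport_form s a u U A n : (0 < n)%N -> 0 <= U ->
  (forall m, a (- m) = (a m)^*%C) ->
  sumle (fun m => `|m%:~R| * nc (a m)) A -> sumle (fun k => nc (u k) ^+ 2) (U ^+ 2) ->
  uniq s ->
  `|\sum_(k <- s) \sum_(j <- s) tent n k ^+ 2 *
     complex.Re ((u k)^*%C * (dx u j * a (k - j)))| <= 2 * A * U ^+ 2.
Proof.
move=> n0 U0 ha hA hu us.
pose G k j := complex.Im ((u k)^*%C * u j * a (k - j)).
have GE k j : tent n k ^+ 2 * complex.Re ((u k)^*%C * (dx u j * a (k - j))) =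
    (- (j%:~R * tent n k ^+ 2)) * G k j.
  rewrite /G /dx /fmult.
  rewrite (_ : (u k)^*%C * _ = (0 +i* j%:~R)%C * ((u k)^*%C * u j * a (k - j))); last by ring.
  rewrite cReM /= mul0r sub0r; ring.
have GA k j : G j k = - 1 * G k j.
  by rewrite /G conj_Z //; case: (_ * _ * _) => x y /=; rewrite mulN1r.
have -> : \sum_(k <- s) \sum_(j <- s) tent n k ^+ 2 *
    complex.Re ((u k)^*%C * (dx u j * a (k - j))) =
   \sum_(k <- s) \sum_(j <- s) (- (j%:~R * tent n k ^+ 2)) * G k j.
  by apply: eq_bigr => k _; apply: eq_bigr => j _.
rewrite -(@ler_pM2l _ 2) // -[X in X * `|_|]ger0_norm // -normrM (sym_double _ _ GA).
rewrite mulrA (_ : 2 * (2 * A) = 4 * A); last by ring.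
apply: (@form_le s (fun m => 4 * (`|m%:~R| * nc (a m))) u a) => //.
- by move=> k; rewrite !mulr_ge0 ?nc_ge0.
- exact: sumleZ.
move=> k j; rewrite normrM.
have := tent_comm k j n0; rewrite distrC.
rewrite (_ : - (j%:~R * tent n k ^+ 2) + _ = k%:~R * tent n j ^+ 2 - j%:~R * tent n k ^+ 2); last by ring.
move=> h1; have := Im_le_nc ((u k)^*%C * u j * a (k - j)); rewrite !ncM nc_conj -/(G k j) => h2.
apply: le_trans (ler_pM _ _ h1 h2) _; rewrite ?normr_ge0 //.
rewrite le_eqVlt; apply/orP; left; apply/eqP; ring.
Qed.

Variable chi : R -> R.
Hypothesis chi_cont : continuous chi.
Hypothesis chi_ge0 : forall x : R, 0 <= chi x.
Let c : distr R := fcoef (fun x => (chi x)%:C%C).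
Variable Cc : R.
Hypothesis hc : sumle (fun k => wt 2 k * nc (c k)) Cc.

(* [q_k^2 + q_j^2 = 2 q_k q_j + (q_k - q_j)^2]: the first part is a nonnegative form
   because [chi >= 0], the second one is of size [n^-2]. *)
Lemma damping_form m u U n : (0 < n)%N -> 0 <= U ->
  sumle (fun k => nc (u k) ^+ 2) (U ^+ 2) ->
  - (Cc / n%:R ^+ 2 * U ^+ 2) <= 2 * \sum_(k <- symr m) \sum_(j <- symr m) tent n k ^+ 2 *
     complex.Re ((u k)^*%C * (u j * c (k - j))).
Proof.
move=> n0 U0 hu.
pose G k j := complex.Re ((u k)^*%C * u j * c (k - j)).
have GA k j : G j k = 1 * G k j.
  rewrite mul1r /G conj_Z; last by move=> k'; exact: fcoef_real_conj.
  by case: (_ * _ * _).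
have -> : \sum_(k <- symr m) \sum_(j <- symr m) tent n k ^+ 2 *
    complex.Re ((u k)^*%C * (u j * c (k - j))) =
   \sum_(k <- symr m) \sum_(j <- symr m) tent n k ^+ 2 * G k j.
  by apply: eq_bigr => k _; apply: eq_bigr => j _; rewrite /G mulrA.
rewrite (sym_double _ _ GA).
have -> : \sum_(k <- symr m) \sum_(j <- symr m) (tent n k ^+ 2 + 1 * tent n j ^+ 2) * G k j =
  2 * (\sum_(k <- symr m) \sum_(j <- symr m) (tent n k * tent n j) * G k j) +
  \sum_(k <- symr m) \sum_(j <- symr m) (tent n k - tent n j) ^+ 2 * G k j.
  rewrite mulr_sumr -big_split /=; apply: eq_bigr => k _.
  rewrite mulr_sumr -big_split /=; apply: eq_bigr => j _; ring.
(* Positivity is applied to the sequence q_k u_k, which produces exactly the weights q_k q_j. *)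
have := @fcoef_pos R chi (fun k => (tent n k)%:C%C * u k) m chi_cont chi_ge0.
rewrite exchange_big /= Re_sum.
have -> : \sum_(k <- symr m) complex.Re (\sum_(j <- symr m) (tent n j)%:C%C * u j *
    (((tent n k)%:C%C * u k)^*%C * fcoef (fun x => (chi x)%:C%C) (k - j))) =
  \sum_(k <- symr m) \sum_(j <- symr m) (tent n k * tent n j) * G k j.
  apply: eq_bigr => k _; rewrite Re_sum; apply: eq_bigr => j _.
  rewrite cconjM -/c /G.
  have -> : ((tent n k)%:C%C)^*%C = (tent n k)%:C%C :> R[i] by rewrite /= oppr0.
  have -> : (tent n j)%:C%C * u j * ((tent n k)%:C%C * (u k)^*%C * c (k - j)) =
    (tent n k * tent n j)%:C%C * ((u k)^*%C * u j * c (k - j)) by rewrite rmorphM /=; ring.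
  by rewrite Re_realM.
move: (\sum_(k <- _) _) => P P0.
suff : `|\sum_(k <- symr m) \sum_(j <- symr m) (tent n k - tent n j) ^+ 2 * G k j| <=
    (n%:R ^+ 2)^-1 * Cc * U ^+ 2.
  rewrite ler_norml [Cc / _]mulrC => /andP[+ _].
  by move: (- _) (\sum_(k <- _) _) => x y; lra.
apply: (@form_le _ (fun k => (n%:R ^+ 2)^-1 * (wt 2 k * nc (c k))) u c) => //.
- by move=> k; rewrite !mulr_ge0 ?nc_ge0 ?wt_ge0 ?invr_ge0 ?sqr_ge0.
- by apply: sumleZ hc; rewrite invr_ge0 sqr_ge0.
- exact: symr_uniq.
move=> k j; rewrite normrM ger0_norm ?sqr_ge0 //.
(* The Lipschitz bound squared costs the square of the frequency gap; this is where the order 2 of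
   the decay of chi enters. *)
have h1 : (tent n k - tent n j) ^+ 2 <= (n%:R ^+ 2)^-1 * wt 2 (k - j).
  rewrite -[leLHS]real_normK ?num_real //.
  apply: le_trans (_ : (`|(k - j)%:~R| / n%:R) ^+ 2 <= _).
    by rewrite ler_pXn2r ?nnegrE ?divr_ge0 // tent_lip.
  rewrite exprMn exprVn mulrC ler_wpM2l ?invr_ge0 ?sqr_ge0 //.
  have -> : wt 2 (k - j) = wt 1 (k - j) ^+ 2 :> R by rewrite expr2 -wtD; congr (wt _ _); lra.
  by rewrite ler_pXn2r ?nnegrE ?wt_ge0 // normz_le_wt1.
have := Re_le_nc ((u k)^*%C * u j * c (k - j)); rewrite !ncM nc_conj -/(G k j) => h2.
apply: le_trans (ler_pM _ _ h1 h2) _; rewrite ?sqr_ge0 //.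
rewrite le_eqVlt; apply/orP; left; apply/eqP; ring.
Qed.

(** The weights vanish beyond n, so the outer sum may be enlarged to match the inner range. *)
Lemma tent_symr n m (X : int -> R) : (0 < n)%N -> (n <= m)%N ->
  \sum_(k <- symr n) tent n k ^+ 2 * X k = \sum_(k <- symr m) tent n k ^+ 2 * X k.
Proof.
move=> n0 nm; rewrite [RHS](bigID (mem (symr n))) /= [X in _ + X]big1 => [|k].
  by rewrite addr0 sum_mem_sub ?symr_uniq //; exact: sub_symr.
by rewrite mem_symr -ltnNge => /(tent_out n0) ->; rewrite expr0n mul0r.
Qed.

Lemma Re_scale (x : R) (z y : R[i]) : complex.Re (x%:C%C * z * y) = x * complex.Re (z * y).
Proof. by rewrite -mulrA Re_realM. Qed.

(** The dispersive term, singular as it is, disappears from the truncated energy: a real Fourier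
    multiplier times i is skew at each frequency, and the weights act frequency by frequency. *)
Lemma Re_skew (x : R) (z : R[i]) : complex.Re (z^*%C * ((0 +i* 1)%C * (x%:C%C * z))) = 0.
Proof. by case: z => a b /=; ring. Qed.

(** The three terms are transport, damping and source. The factor 1/eps survives only next to 1/n^2,
    from the commutator of chi with the truncation, so it disappears as n grows at fixed eps. *)
Lemma energy_rate n u a F U A Fb (eps : R) : (0 < n)%N -> 0 < eps -> inH 0 u ->
  hb 0 u U -> hb 0 F Fb -> inH 1 a -> (forall m, a (- m) = (a m)^*%C) ->
  sumle (fun m => `|m%:~R| * nc (a m)) A ->
  \sum_(k <- symr n) tent n k ^+ 2 * (2 * complex.Re ((u k)^*%C * rhs c eps a F u k)) <=
  (4 * A + Cc / n%:R ^+ 2 / eps) * U ^+ 2 + 2 * (U * Fb).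
Proof.
move=> n0 eps0 iu hU hF ia ha hA.
have U0 := hU.1; have Fb0 := hF.1.
have hu : sumle (fun k => nc (u k) ^+ 2) (U ^+ 2).
  by have [_] := hU; apply: sumle_le => k; rewrite wt0 mul1r.
have t1 : - \sum_(k <- symr n) tent n k ^+ 2 * complex.Re ((u k)^*%C * NL a u k) <= 2 * A * U ^+ 2.
  pose w k := (- tent n k ^+ 2)%:C%C * (u k)^*%C.
  have sF k : summ (fun j => dx u j * a (k - j)).
    by apply: (@conv_summ _ 1) => //; apply: inH_dx; rewrite addNr.
  have B m : (n <= m)%N -> complex.Re (\sum_(k <- symr n) w k *
      psum (fun j => dx u j * a (k - j)) m) <= 2 * A * U ^+ 2.
    move=> nm; have := transport_form n0 U0 ha hA hu (symr_uniq m).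
    rewrite ler_norml => /andP[+ _]; rewrite lerNl; apply: le_trans.
    rewrite Re_sum le_eqVlt; apply/orP; left; apply/eqP.
    have -> : \sum_(k <- symr m) \sum_(j <- symr m) tent n k ^+ 2 *
       complex.Re ((u k)^*%C * (dx u j * a (k - j))) = \sum_(k <- symr m) tent n k ^+ 2 *
       (\sum_(j <- symr m) complex.Re ((u k)^*%C * (dx u j * a (k - j)))).
      by apply: eq_bigr => k _; rewrite mulr_sumr.
    rewrite -(tent_symr _ n0 nm) -sumrN; apply: eq_bigr => k _.
    by rewrite /w Re_scale mulNr /psum mulr_sumr Re_sum.
  have := re_csum_lin sF B; apply: le_trans; rewrite Re_sum -sumrN le_eqVlt.
  apply/orP; left; apply/eqP; apply: eq_bigr => k _.
  by rewrite /w Re_scale mulNr.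
have t2 : - \sum_(k <- symr n) tent n k ^+ 2 * complex.Re ((u k)^*%C * F k) <= U * Fb.
  have hF2 : sumle (fun k => nc (F k) ^+ 2) (Fb ^+ 2).
    by have [_] := hF; apply: sumle_le => k; rewrite wt0 mul1r.
  apply: le_trans (sum_cs2 U0 Fb0 (hu _ (symr_uniq n)) (hF2 _ (symr_uniq n))).
  rewrite -sumrN; apply: ler_sum => k _; rewrite -mulrN.
  apply: (@le_trans _ _ `|complex.Re ((u k)^*%C * F k)|).
    apply: (@le_trans _ _ (tent n k ^+ 2 * `|complex.Re ((u k)^*%C * F k)|)).
      by rewrite ler_wpM2l ?sqr_ge0 // -normrN ler_norm.
    by rewrite ler_piMl // expr_le1 // ?tent_le1 ?tent_ge0.
  by apply: le_trans (Re_le_nc _) _; rewrite ncM nc_conj.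
have t3 : - (2 * \sum_(k <- symr n) tent n k ^+ 2 * complex.Re ((u k)^*%C * L c u k)) <=
    Cc / n%:R ^+ 2 * U ^+ 2.
  pose w k := (- tent n k ^+ 2)%:C%C * (u k)^*%C.
  have sF k : summ (fun j => u j * c (k - j)).
    by apply: (@conv_summ _ 0) => //; rewrite ?oppr0 //; exact: (c_in0 hc).
  have B m : (n <= m)%N -> complex.Re (\sum_(k <- symr n) w k *
      psum (fun j => u j * c (k - j)) m) <= Cc / n%:R ^+ 2 * U ^+ 2 / 2.
    move=> nm; have := damping_form m n0 U0 hu.
    have -> : \sum_(k <- symr m) \sum_(j <- symr m) tent n k ^+ 2 *
       complex.Re ((u k)^*%C * (u j * c (k - j))) = \sum_(k <- symr m) tent n k ^+ 2 *
       (\sum_(j <- symr m) complex.Re ((u k)^*%C * (u j * c (k - j)))).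
      by apply: eq_bigr => k _; rewrite mulr_sumr.
    rewrite -(tent_symr _ n0 nm) Re_sum.
    have -> : \sum_(k <- symr n) complex.Re (w k * psum (fun j => u j * c (k - j)) m) =
      - \sum_(k <- symr n) tent n k ^+ 2 * \sum_(j <- symr m) complex.Re ((u k)^*%C * (u j * c (k - j))).
      rewrite -sumrN; apply: eq_bigr => k _.
      by rewrite /w Re_scale mulNr /psum mulr_sumr Re_sum.
    move: (\sum_(k <- _) _) (_ * U ^+ 2) => x y; lra.
  have := re_csum_lin sF B; rewrite Re_sum.
  have -> : \sum_(k <- symr n) complex.Re (w k * csum (fun j => u j * c (k - j))) =
     - \sum_(k <- symr n) tent n k ^+ 2 * complex.Re ((u k)^*%C * L c u k).
    rewrite -sumrN; apply: eq_bigr => k _.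
    rewrite /w Re_scale mulNr /L /dist_add /dist_scale /absD /fmult -/(fconv c u k).
    by rewrite mulrDr cReD Re_skew add0r.
  move: (\sum_(k <- _) _) (_ * U ^+ 2) => x y; lra.
have -> : \sum_(k <- symr n) tent n k ^+ 2 * (2 * complex.Re ((u k)^*%C * rhs c eps a F u k)) =
  2 * (- \sum_(k <- symr n) tent n k ^+ 2 * complex.Re ((u k)^*%C * NL a u k)) +
  2 * (- \sum_(k <- symr n) tent n k ^+ 2 * complex.Re ((u k)^*%C * F k)) +
  eps^-1 * (- (2 * \sum_(k <- symr n) tent n k ^+ 2 * complex.Re ((u k)^*%C * L c u k))).
  rewrite -!sumrN -!mulrN -!sumrN !mulr_sumr -!big_split /=; apply: eq_bigr => k _.
  rewrite /rhs; move: (NL a u k) (F k) (L c u k) ((u k)^*%C) => x y z v.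
  have -> : v * - (x + y + (eps^-1)%:C%C * z) = - (v * x + v * y + (eps^-1)%:C%C * (v * z)) by ring.
  rewrite cReN !cReD Re_realM; ring.
have e0 : 0 <= eps^-1 by rewrite invr_ge0 ltW.
have t4 := ler_wpM2l e0 t3.
rewrite (_ : (4 * A + Cc / n%:R ^+ 2 / eps) * U ^+ 2 =
  4 * (A * U ^+ 2) + eps^-1 * (Cc / n%:R ^+ 2 * U ^+ 2)); last by ring.
rewrite -mulrA in t1; move: t1 t2 t4.
move: (\sum_(k <- _) _) (\sum_(k <- _) _) (eps^-1 * _) (eps^-1 * - _) (U * Fb) (A * _).
move=> x y z v p r; lra.
Qed.

End FiniteSums.

(** * Removal of the truncation and conclusion *)

Section DifferentialInequality.
Variable R : realType.
Implicit Types (T C t e : R) (E : R -> R).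
Local Notation mu := (@lebesgue_measure R).

Lemma Rintegral_dominated T (f_ : nat -> R -> R) (f g : R -> R) :
  (forall n, {within `[0, T], continuous (f_ n)}) ->
  {within `[0, T], continuous f} -> {within `[0, T], continuous g} ->
  (forall t, 0 <= t <= T -> f_ n t @[n --> \oo] --> f t) ->
  (forall n t, 0 <= t <= T -> `|f_ n t| <= g t) ->
  \int[mu]_(t in `[0, T]) f_ n t @[n --> \oo] --> \int[mu]_(t in `[0, T]) f t.
Proof.
move=> cf_ cf cg f_f fg.
have mD : measurable (`[0, T]%classic : set R) by exact: measurable_itv.
have H : (\int[mu]_(t in `[0%R, T]) (f_ n t)%:E @[n --> \oo] --> \int[mu]_(t in `[0%R, T]) (f t)%:E)%E.
  apply: (@dominated_cvg _ _ R mu _ mD _ _ (fun t => (g t)%:E)).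
  - by move=> n; have /integrableP[] := within_integrable (cf_ n).
  - move=> t /closed_itvP tT; apply/EFin_cvg; exact: f_f.
  - by [].
  - exact: within_integrable cg.
  - by move=> n t /closed_itvP tT; rewrite lee_fin fg.
have Fn n : (\int[mu]_(t in `[0%R, T]) (f_ n t)%:E)%E = (\int[mu]_(t in `[0, T]) f_ n t)%:E.
  by rewrite /Rintegral fineK //; apply: integrable_fin_num => //; exact: within_integrable.
have Ff : (\int[mu]_(t in `[0%R, T]) (f t)%:E)%E = (\int[mu]_(t in `[0, T]) f t)%:E.
  by rewrite /Rintegral fineK //; apply: integrable_fin_num => //; exact: within_integrable.
by rewrite Ff (funext Fn) in H; exact: (fine_cvg H).
Qed.

(** Only the approximations are ever differentiated. The distributional half integrates their
    inequality with [ibp_le] and uses dominated convergence; the pointwise half integrates it over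
    [t, t+h] by the mean value theorem, lets n grow and only then compares with the derivative of
    E. *)
Lemma dt_le_approx T C E (En Dn : nat -> R -> R) (del : nat -> R) : 0 < T ->
  {within `[0, T], continuous E} -> (forall n, {within `[0, T], continuous (En n)}) ->
  (forall t, 0 <= t <= T -> 0 <= E t) ->
  (forall n t, 0 <= t <= T -> 0 <= En n t <= E t) ->
  (forall t, 0 <= t <= T -> En n t @[n --> \oo] --> E t) ->
  (forall n t, 0 < t < T -> is_derive t 1 (En n) (Dn n t)) ->
  (forall n t, 0 < t < T -> Dn n t <= (C + del n) * E t) ->
  (forall n, 0 <= del n) -> del n @[n --> \oo] --> 0 -> dt_le T C E.
Proof.
move=> T0 cE cEn E0 EnE EnC dEn hDn del0 delC; split.
  move=> phi tphi phi0.
  have [sphi _] := tphi.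
  have cp : continuous phi by exact: (@smooth_continuous _ 0 _ sphi).
  have cp' : continuous (derive1 phi) by exact: (@smooth_continuous _ 1 _ sphi).
  have cM (f g : R -> R) : continuous f -> {within `[0, T], continuous g} ->
      {within `[0, T], continuous (fun t => f t * g t)}.
    by move=> cf cg t; apply: cvgM; [exact: (continuous_subspaceT cf)|exact: cg].
  have H n : - (\int[mu]_(t in `[0, T]) (derive1 phi t * En n t)) <=
      (C + del n) * \int[mu]_(t in `[0, T]) (phi t * E t).
    rewrite -RintegralZl //; last exact: within_integrable (cM _ _ cp cE).
    rewrite [leRHS](_ : _ = \int[mu]_(t in `[0, T]) (phi t * ((C + del n) * E t))); last first.
      by apply: eq_Rintegral => t _; rewrite mulrCA.
    apply: (@ibp_le R T phi (En n) (Dn n) (fun t => (C + del n) * E t)) => //.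
    - by apply: cM => //; exact: cst_continuous.
    - by move=> t tT; rewrite ler_wpM2l // hDn.
  have L1 : \int[mu]_(t in `[0, T]) (derive1 phi t * En n t) @[n --> \oo] -->
      \int[mu]_(t in `[0, T]) (derive1 phi t * E t).
    apply: (@Rintegral_dominated T _ _ (fun t => `|derive1 phi t| * E t)).
    - by move=> n; exact: cM.
    - exact: cM.
    - apply: cM => // t; apply: (@continuous_comp _ _ _ (derive1 phi) Num.norm); first exact: cp'.
      exact: norm_continuous.
    - by move=> t tT; apply: cvgM; [exact: cvg_cst|exact: EnC].
    - move=> n t tT; rewrite normrM ler_wpM2l //.
      by have /andP[h1 h2] := EnE n t tT; rewrite ger0_norm.
  have L2 : (C + del n) * \int[mu]_(t in `[0, T]) (phi t * E t) @[n --> \oo] -->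
      C * \int[mu]_(t in `[0, T]) (phi t * E t).
    apply: cvgM; last exact: cvg_cst.
    by rewrite -[X in _ --> X]addr0; apply: cvgD => //; exact: cvg_cst.
  exact: (ler_cvg_to (cvgN L1) L2 (nearW _ H)).
move=> t tT dE.
have cEt := within_itv_interior cE tT.
rewrite derive1E; have HE := (is_derive_epsP E t ('D_1 E t)).1 (derivableP dE).
apply/ler_addgt0Pr => e e0.
(* Half of e pays for the oscillation of E near t, the other half for the difference quotient. The
   absolute value is there because C has no prescribed sign. *)
pose e1 := e / (`|C| + 1) / 2.
have e10 : 0 < e1 by rewrite !divr_gt0 // ltr_wpDl.
have Ce1 : `|C| * e1 <= e / 2.
  rewrite /e1 mulrA ler_pM2r // mulrCA ler_piMr ?(ltW e0) //.
  by rewrite ler_pdivrMr ?ltr_wpDl // mul1r lerDl.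
have e2 : 0 < e / 2 by rewrite divr_gt0.
have [d1 d10 hd1] := HE _ e2.
have [d2 d20 hd2] : exists2 d, 0 < d & forall s, `|s - t| < d -> `|E s - E t| <= e1.
  move/cvgrPdist_le : cEt => /(_ e1 e10)[d /= d0 hd]; exists d => // s hs.
  by rewrite distrC; apply: hd; rewrite /ball /= distrC.
have [r [r0 r1 r2 r3]] : exists r : R, [/\ 0 < r, r <= d2, r <= t & r <= T - t].
  exists (Num.min d2 (Num.min t (T - t))); rewrite !lt_min !ge_min !lexx !orbT d20 subr_gt0.
  by rewrite tT; split.
have [h [h0 hd hr]] : exists h : R, [/\ 0 < h, h < d1 & h < r].
  have a1 : Num.min d1 r <= d1 by rewrite ge_min lexx.
  have a2 : Num.min d1 r <= r by rewrite ge_min lexx orbT.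
  have a3 : 0 < Num.min d1 r by rewrite lt_min d10.
  exists (Num.min d1 r / 2); move: a1 a2 a3; move: (Num.min d1 r) => m a1 a2 a3.
  by split; lra.
have hn0 : h != 0 by rewrite gt_eqF.
have habs : `|h| = h by rewrite gtr0_norm.
have inT s : `|s - t| < r -> 0 < s < T.
  rewrite ltr_norml => /andP[a1 a2]; apply/andP; split; lra.
(* The mean value point depends on n, so E at that point is first replaced by E at t, up to e1; the
   resulting bound has a limit in n. *)
have Hn n : En n (t + h) - En n t <= h * (C * E t + `|C| * e1 + del n * (E t + e1)).
  have [s hs ->] := @MVT_sym R (En n) (Dn n) t r r0 (fun s hs => dEn n s (inT s hs)) h hn0
    (eq_ind_r (fun x => x < r) hr habs).
  have hsr : `|s - t| < r by apply: lt_trans hs _; rewrite habs.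
  have sT := inT s hsr.
  rewrite mulrC ler_pM2l //; apply: le_trans (hDn n s sT) _.
  have := hd2 s (lt_le_trans hsr r1); have D0 := del0 n; rewrite mulrDl => he.
  apply: lerD.
    rewrite -lerBlDl -mulrBr; apply: le_trans (ler_norm _) _.
    by rewrite normrM ler_wpM2l.
  by rewrite ler_wpM2l // -lerBlDl; exact: le_trans (ler_norm _) he.
have tT' : 0 <= t <= T by case/andP: tT => ? ?; rewrite !ltW.
have thT : 0 <= t + h <= T.
  have /inT/andP[a1 a2] : `|(t + h) - t| < r by rewrite addrAC subrr add0r habs.
  by rewrite !ltW.
have L1 : En n (t + h) - En n t @[n --> \oo] --> E (t + h) - E t.
  by apply: cvgB; exact: EnC.
have L2 : h * (C * E t + `|C| * e1 + del n * (E t + e1)) @[n --> \oo] -->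
    h * (C * E t + `|C| * e1).
  apply: cvgM; first exact: cvg_cst.
  rewrite -[X in _ --> X]addr0; apply: cvgD; first exact: cvg_cst.
  by rewrite -[X in _ --> X](mul0r (E t + e1)); apply: cvgM => //; exact: cvg_cst.
have LL : E (t + h) - E t <= h * (C * E t + `|C| * e1).
  exact: (ler_cvg_to L1 L2 (nearW _ Hn)).
have := hd1 h hn0; rewrite habs => /(_ hd); rewrite ler_norml => /andP[q1 _].
have : h^-1 * (E (t + h) - E t) <= C * E t + `|C| * e1 by rewrite ler_pdivrMl.
move: q1; move: (h^-1 * _) ('D_1 E t) => x y; lra.
Qed.

End DifferentialInequality.

Section TruncatedEnergy.
Variable R : realType.
Implicit Types (T t e : R) (u : distr R) (w : R -> distr R).

(** The squared norm of the Fejer mean of u, in the normalization of [hn] (no factor 2 pi). *)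
Definition tnorm n u : R := \sum_(k <- symr n) tent R n k ^+ 2 * nc (u k) ^+ 2.

Lemma hn_dist u u' : inH 0 u -> inH 0 u' -> hn 0 u' <= hn 0 u + hn 0 (dist_sub u' u).
Proof.
move=> iu iu'; have id : inH 0 (dist_sub u' u) by exact: inHB.
apply: hn_le; have := hbD (hn_hb iu) (hn_hb id).
by congr (hb _ _ _); apply/funext => k; rewrite /dist_add /dist_sub addrC subrK.
Qed.

Lemma hn_within T w : contH 0 `[0, T] w -> {within `[0, T], continuous (fun t => hn 0 (w t))}.
Proof.
move=> cw; apply: within_itv_eps => t /closed_itvP tT e e0.
have [d d0 hd] := contH_hb cw tT e0; exists d => // t' /closed_itvP t'T td.
have h1 := hn_le (hd t' t'T td).
have h2 : hn 0 (dist_sub (w t) (w t')) <= e.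
  apply: hn_le; have := hbZ (- 1) (hd t' t'T td); rewrite nc_N1 mul1r.
  by congr (hb _ _ _); apply/funext => k; rewrite /dist_scale /dist_sub mulN1r opprB.
have i1 := cw.1 t tT; have i2 := cw.1 t' t'T.
have := hn_dist i1 i2; have := hn_dist i2 i1.
rewrite ler_norml => q1 q2; apply/andP; split; lra.
Qed.

Lemma hnsq_within T w : contH 0 `[0, T] w ->
  {within `[0, T], continuous (fun t => hn 0 (w t) ^+ 2)}.
Proof.
move=> cw; rewrite (_ : (fun t => _) = fun t => hn 0 (w t) * hn 0 (w t)); last first.
  by apply/funext => t; rewrite expr2.
by move=> t; apply: cvgM; exact: (hn_within cw).
Qed.

Lemma tnorm_within n T w : contH 0 `[0, T] w ->
  {within `[0, T], continuous (fun t => tnorm n (w t))}.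
Proof.
move=> cw; rewrite /tnorm.
have R1 (x y : R[i]) : complex.Re (x - y) = complex.Re x - complex.Re y by rewrite cReD cReN.
have I1 (x y : R[i]) : complex.Im (x - y) = complex.Im x - complex.Im y by rewrite cImD cImN.
elim: (symr n) => [|k s IH].
  rewrite (_ : (fun t => _) = fun=> 0); first by move=> t; exact: cvg_cst.
  by apply/funext => t; rewrite big_nil.
rewrite (_ : (fun t => _) = fun t =>
   tent R n k ^+ 2 * (complex.Re (w t k) * complex.Re (w t k) + complex.Im (w t k) * complex.Im (w t k)) +
   \sum_(j <- s) tent R n j ^+ 2 * nc (w t j) ^+ 2); last first.
  by apply/funext => t; rewrite big_cons nc_sq !expr2.
move=> t; apply: cvgD; last exact: IH.
apply: cvgM; first exact: cvg_cst.
by apply: cvgD; apply: cvgM;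
  [exact: (coef_within R1 (@Re_le_nc R) cw)|exact: (coef_within R1 (@Re_le_nc R) cw)|
   exact: (coef_within I1 (@Im_le_nc R) cw)|exact: (coef_within I1 (@Im_le_nc R) cw)].
Qed.

Lemma tnorm_ge0 n u : 0 <= tnorm n u.
Proof. by apply: sumr_ge0 => k _; rewrite mulr_ge0 ?sqr_ge0. Qed.

Lemma tnorm_le n u : inH 0 u -> tnorm n u <= hn 0 u ^+ 2.
Proof.
move=> iu; apply: le_trans (hn_sumle iu (symr_uniq n)); apply: ler_sum => k _.
by rewrite ler_piMl ?sqr_ge0 // expr_le1 // ?tent_le1 ?tent_ge0.
Qed.

(** On [symr m0], which carries all but e/2 of the square norm, the weights are at least 1 -
    m0/(n+1) and their squares at least 1 - 2 m0/(n+1). The successor keeps the denominator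
    nonzero. *)
Lemma tnorm_cvg u : inH 0 u -> tnorm n.+1 u @[n --> \oo] --> hn 0 u ^+ 2.
Proof.
move=> iu; apply/cvgrPdist_le => e e0.
have e2 : 0 < e / 2 by rewrite divr_gt0.
have [m0 hm0] := hn_psum iu e2.
set H := hn 0 u ^+ 2 in hm0 *; have H0 : 0 <= H by exact: sqr_ge0.
set S := \sum_(k <- symr m0) _ in hm0.
have S0 : 0 <= S by apply: sumr_ge0 => k _; exact: sqr_ge0.
have SH : S <= H by exact: (hn_sumle iu (symr_uniq m0)).
(* The threshold for n+1 beyond which 2 m0 H/(n+1) <= e/2. *)
pose x := 4 * m0%:R * H / e.
exists (maxn m0 (Num.bound x)) => // n /= mn.
have m0n : (m0 <= n)%N by apply: leq_trans mn; exact: leq_maxl.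
have xn : x <= n.+1%:R.
  apply: (@le_trans _ _ (Num.bound x)%:R); last first.
    by rewrite ler_nat; apply: leqW; apply: leq_trans mn; exact: leq_maxr.
  apply: ltW; apply: archi_boundP; apply: divr_ge0; last exact: ltW.
  by apply: mulr_ge0 => //; exact: mulr_ge0.
have n1 : 0 < n.+1%:R :> R by rewrite ltr0n.
pose y : R := m0%:R / n.+1%:R.
have y0 : 0 <= y by rewrite divr_ge0.
have yH : 2 * y * H <= e / 2.
  rewrite (_ : 2 * y * H = 2 * m0%:R * H / n.+1%:R); last by rewrite /y; ring.
  rewrite ler_pdivrMr //.
  move: xn; rewrite /x ler_pdivrMr // => xn.
  by move: xn; move: (m0%:R) (n.+1%:R) => p q; nra.
have low : (1 - 2 * y) * S <= tnorm n.+1 u.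
  apply: (@le_trans _ _ (\sum_(k <- symr m0) tent R n.+1 k ^+ 2 * nc (u k) ^+ 2)).
    rewrite mulr_sumr big_seq [leRHS]big_seq; apply: ler_sum => k; rewrite mem_symr => km.
    rewrite ler_wpM2r ?sqr_ge0 //.
    have ky : `|k%:~R| / n.+1%:R <= y.
      by rewrite ler_pM2r ?invr_gt0 // -intr_norm -abszE ler_nat.
    have : 1 - y <= tent R n.+1 k by rewrite /tent le_max lerD2l lerN2 ky orbT.
    have := tent_ge0 R n.+1 k; move: (tent R n.+1 k) => q; nra.
  apply: ler_sum_sub; [|exact: symr_uniq|exact: symr_uniq|].
    by move=> k; rewrite mulr_ge0 ?sqr_ge0.
  by apply: sub_symr; apply: leqW.
have up := tnorm_le n.+1 iu; rewrite -/H in up.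
rewrite ger0_norm ?subr_ge0 //.
have : y * S <= y * H by rewrite ler_wpM2l.
move: low yH hm0; rewrite -mulrA mulrBl mul1r -mulrA; move: (y * S) (y * H) => a b; lra.
Qed.

Lemma tnorm_deriv n w (w' : distr R) t : (forall k, dC (fun x => w x k) t (w' k)) ->
  is_derive t 1 (fun x => tnorm n (w x))
    (\sum_(k <- symr n) tent R n k ^+ 2 * (2 * complex.Re ((w t k)^*%C * w' k))).
Proof.
move=> H; rewrite /tnorm; elim: (symr n) => [|k s IH].
  rewrite (_ : (fun x => _) = fun=> 0); last by apply/funext => x; rewrite big_nil.
  by rewrite big_nil; exact: is_derive_cst.
rewrite (_ : (fun x => _) = fun x => tent R n k ^+ 2 * nc (w x k) ^+ 2 +
   \sum_(j <- s) tent R n j ^+ 2 * nc (w x j) ^+ 2); last by apply/funext => x; rewrite big_cons.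
rewrite big_cons; apply: is_deriveD; have D := dC_sq (H k).
apply: (is_derive_eq (is_deriveM (is_derive_cst (tent R n k ^+ 2) t 1) D)).
by rewrite scaler0 addr0.
Qed.

End TruncatedEnergy.

(** * The energy inequality with a constant uniform in eps *)

Section Conclusion.
Variables (R : realType) (N : nat) (W : distr R -> distr R).
Hypothesis hW : smoothing N W.
Variable chi : R -> R.
Hypothesis chi_cont : continuous chi.
Hypothesis chi_ge0 : forall x : R, 0 <= chi x.
Let c : distr R := fcoef (fun x => (chi x)%:C%C).
Variable Cc : R.
Hypothesis hc : sumle (fun k => wt 2 k * nc (c k)) Cc.
Implicit Types (t e : R) (u : distr R).

Lemma hb_l10 u B : hb 1 u B -> l1 u.
Proof.
move=> hu; exists (Num.sqrt 5 * B).
have hu' : hb (0 + 1) u B by rewrite add0r.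
by apply: sumle_le (hb_l1 hu') => k; rewrite wt0 mul1r.
Qed.

(** For u in H^3 the series of u, u_x and W(u) converge absolutely, so the pointwise products of the
    equation are convolutions of coefficients. *)
Lemma spatial_partE (eps : R) u : eps != 0 -> inH 3 u ->
  dist_scale (-1) (spatial_part (3 / 2) W chi eps u) =
  dist_scale (eps^-1)%:C%C (V1 W c eps u).
Proof.
move=> e0 iu.
have ee : (eps^-1)%:C%C * eps%:C%C = 1 :> R[i] by rewrite -rmorphM /= mulVf.
have /inHP[B hB] := iu.
have i1 : inH 1 u by apply: inH_mono iu; lra.
have /inHP[B1 hB1] := i1.
have idx : hb 1 (dx u) B by apply: hb_dx; apply: hb_mono hB; lra.
have [K K0 hK] := W_hb hW 1.
rewrite /spatial_part (Weps_id hW e0 iu).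
rewrite fcoef_fsumM; [|exact: hb_l10 (hK _ _ hB1)|exact: hb_l10 idx].
rewrite fcoef_fsum; [|exact: bm_cont|exact: hb_l10 hB1].
apply/funext => k; rewrite /V1 /L /NL /dist_scale /dist_add -/c.
have -> : (0 +i* eps^-1)%C = (eps^-1)%:C%C * (0 +i* 1)%C :> R[i].
  by apply: eq_ReIm => /=; ring.
move: (fconv (W u) (dx u) k) (absD (3 / 2) u k) (fconv c u k) => x y z.
rewrite -[x in LHS]mul1r -ee; ring.
Qed.

Variable M : R.
Hypothesis M0 : 0 <= M.

(** The constant is fixed before eps, T and v. The dependence on eps is confined to the sequence
    [del], whose limit is taken for each eps separately. *)
Lemma uniform_rate : exists C, forall (eps T : R) (v : R -> distr R), 0 < eps < 1 -> 0 < T ->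
  contH 3 `[0, T] v -> (forall t, 0 <= t <= T -> hb 3 (v t) M) ->
  weak_dt T v (fun t => dist_scale (eps^-1)%:C%C (V1 W c eps (v t))) ->
  dt_le T C (fun t => 2 * pi * (hn 0 (v t) ^+ 2 + hn 0 (V1 W c eps (v t)) ^+ 2 +
                                hn 0 (V2 W c eps (v t)) ^+ 2)).
Proof.
have [C1 C10 hC1] := F_bounds hW hc M0.
have [K K0 hK] := W_hb hW (1 + 1).
(* Bounds the l^1 norm of the coefficients of the derivative of W(v), and so its sup norm; an H^2
   bound on W(v) suffices. *)
pose A := Num.sqrt 5 * (K * M).
exists (4 * A + 4 * C1) => eps T v he T0 cv hv weq.
have /andP[eps0 eps1] := he.
have cv0 : contH 0 `[0, T] v by apply: contH_mono cv; lra.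
have cv1 : contH 0 `[0, T] (fun t => V1 W c eps (v t)).
  by apply: contH_mono (contH_V1 hW hc eps cv); lra.
have cv2 := contH_V2 hW hc eps cv.
have i0 t : 0 <= t <= T -> inH 0 (v t) by move=> tT; apply: cv0.1; apply/closed_itvP.
have i1 t : 0 <= t <= T -> inH 0 (V1 W c eps (v t)).
  by move=> tT; apply: cv1.1; apply/closed_itvP.
have i2 t : 0 <= t <= T -> inH 0 (V2 W c eps (v t)).
  by move=> tT; apply: cv2.1; apply/closed_itvP.
have : 0 < 2 * pi :> R by exact: twopi_gt0.
move: (2 * pi : R) => w2 w20.
pose rate n t (u : distr R) F := \sum_(k <- symr n) tent R n k ^+ 2 *
  (2 * complex.Re ((u k)^*%C * rhs c eps (W (v t)) F u k)).
have Cc0 := Cc_ge0 hc.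
have rate_le n t u F U Fb : (0 < n)%N -> 0 <= t <= T -> inH 0 u -> hb 0 u U -> hb 0 F Fb ->
    rate n t u F <= (4 * A + Cc / n%:R ^+ 2 / eps) * U ^+ 2 + 2 * (U * Fb).
  move=> n0 tT iu hU hF.
  have hu1 : hb (1 + 1) (v t) M by apply: hb_mono (hv t tT); lra.
  have hw := hK _ _ hu1.
  apply: (energy_rate chi_cont chi_ge0 hc n0 eps0 iu hU hF).
  - by apply/inHP; exists (K * M); apply: hb_mono hw; lra.
  - by move=> m; exact: (W_conj hW m (i0 t tT)).
  - by apply: sumle_le (hb_l1 hw) => m; rewrite ler_wpM2r ?nc_ge0 // normz_le_wt1.
pose del n : R := Cc / n.+1%:R ^+ 2 / eps.
have del0 n : 0 <= del n by rewrite !divr_ge0 ?exprn_ge0 // ltW.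
apply: (@dt_le_approx R T _ _
  (fun n t => w2 * (tnorm n.+1 (v t) + tnorm n.+1 (V1 W c eps (v t)) +
                    tnorm n.+1 (V2 W c eps (v t))))
  (fun n t => w2 * (rate n.+1 t (v t) (fun=> 0) + rate n.+1 t (V1 W c eps (v t)) (F1 W c eps (v t)) +
                    rate n.+1 t (V2 W c eps (v t)) (F2 W c eps (v t)))) del T0).
- move=> t; apply: cvgM; first exact: cvg_cst.
  apply: cvgD; [apply: cvgD|]; [exact: (hnsq_within cv0)|exact: (hnsq_within cv1)|exact: (hnsq_within cv2)].
- move=> n t; apply: cvgM; first exact: cvg_cst.
  apply: cvgD; [apply: cvgD|]; [exact: (tnorm_within cv0)|exact: (tnorm_within cv1)|exact: (tnorm_within cv2)].
- by move=> t tT; rewrite mulr_ge0 ?(ltW w20) // !addr_ge0 ?sqr_ge0.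
- move=> n t tT; apply/andP; split; first by rewrite mulr_ge0 ?(ltW w20) // !addr_ge0 ?tnorm_ge0.
  by rewrite ler_pM2l // !lerD // tnorm_le //; [exact: i0|exact: i1|exact: i2].
- move=> t tT; apply: cvgM; first exact: cvg_cst.
  apply: cvgD; [apply: cvgD|]; apply: tnorm_cvg; [exact: i0|exact: i1|exact: i2].
- move=> n t tT.
  have D0 := tnorm_deriv n.+1 (fun k => evol_V0 hW hc he T0 cv weq k tT).
  have D1 := tnorm_deriv n.+1 (fun k => evol_V1 hW hc he T0 cv weq k tT).
  have D2 := tnorm_deriv n.+1 (fun k => evol_V2 hW hc he T0 cv weq k tT).
  have D := is_deriveM (is_derive_cst w2 t 1) (is_deriveD (is_deriveD D0 D1) D2).
  apply: (is_derive_eq D); by rewrite scaler0 addr0.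
- move=> n t /andP[t0 tT].
  have tcc : 0 <= t <= T by rewrite !ltW.
  pose r0 := hn 0 (v t); pose r1 := hn 0 (V1 W c eps (v t)); pose r2 := hn 0 (V2 W c eps (v t)).
  have p1 : 0 <= r1 by exact: hn_ge0. have p2 : 0 <= r2 by exact: hn_ge0.
  have h1 := hn_hb (i1 t tcc); have h2 := hn_hb (i2 t tcc).
  have l1 : r1 <= r1 + r2 by rewrite lerDl.
  have l2 : r2 <= r1 + r2 by rewrite lerDr.
  (* [F_bounds] wants a single number dominating both V_1 and V_2 in L^2. *)
  have [f1 f2] := hC1 eps (v t) (r1 + r2) he (hv t tcc) (hbW l1 h1) (hbW l2 h2).
  have q0 := rate_le n.+1 t _ _ _ _ (ltn0Sn n) tcc (i0 t tcc) (hn_hb (i0 t tcc)) (hb_zero 0 (lexx 0)).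
  have q1 := rate_le n.+1 t _ _ _ _ (ltn0Sn n) tcc (i1 t tcc) h1 f1.
  have q2 := rate_le n.+1 t _ _ _ _ (ltn0Sn n) tcc (i2 t tcc) h2 f2.
  rewrite [leRHS]mulrCA ler_pM2l //; apply: le_trans (lerD (lerD q0 q1) q2) _.
  rewrite -/r0 -/r1 -/r2 -/(del n) -subr_ge0.
  (* The source terms add up to 2 C1 (r1 + r2)^2 <= 4 C1 (r1^2 + r2^2), which explains 4 C1; the
     difference is written as a sum of squares. *)
  have -> : (4 * A + 4 * C1 + del n) * (r0 ^+ 2 + r1 ^+ 2 + r2 ^+ 2) -
     ((4 * A + del n) * r0 ^+ 2 + 2 * (r0 * 0) +
      ((4 * A + del n) * r1 ^+ 2 + 2 * (r1 * (C1 * (r1 + r2)))) +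
      ((4 * A + del n) * r2 ^+ 2 + 2 * (r2 * (C1 * (r1 + r2))))) =
     C1 * (4 * r0 ^+ 2 + 2 * (r1 - r2) ^+ 2) by ring.
  by rewrite mulr_ge0 // addr_ge0 // mulr_ge0 ?sqr_ge0.
- exact: del0.
- have L : Cc / eps * (n.+1%:R^-1 * n.+1%:R^-1) @[n --> \oo] --> Cc / eps * (0 * 0).
    by apply: cvgM; [exact: cvg_cst|apply: cvgM; exact: cvg_harmonic].
  have delE : del = fun n => Cc / eps * (n.+1%:R^-1 * n.+1%:R^-1).
    by apply/funext => n; rewrite /del expr2 invfM; ring.
  by rewrite !mulr0 -delE in L.
Qed.

Lemma dt_le_eq (T C : R) (E E' : R -> R) : (forall t, 0 <= t <= T -> E t = E' t) ->
  dt_le T C E -> dt_le T C E'.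
Proof.
move=> EE [h1 h2]; split=> [phi tphi phi0|t tT dE].
  have := h1 phi tphi phi0; congr (- _ <= _ * _).
    by apply: eq_Rintegral => t /set_mem /closed_itvP tT; rewrite EE.
  by apply: eq_Rintegral => t /set_mem /closed_itvP tT; rewrite EE.
have /andP[t0 t1] := tT.
have m0 : 0 < Num.min t (T - t) by rewrite lt_min t0 subr_gt0.
have : is_derive t 1 E ('D_1 E' t).
  apply: (is_derive_local m0 _ (derivableP dE)) => y.
  rewrite lt_min !ltr_norml => /andP[/andP[a1 a2] /andP[a3 a4]]; apply: EE.
  by apply/andP; split; lra.
move=> [d1 d2]; have := h2 t tT d1; rewrite !derive1E d2 EE //.
by rewrite !ltW.
Qed.

End Conclusion.

(** * Square-integrable functions realising the distributions *)

Section Realisation.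
Variable R : realType.
Implicit Types (T t : R) (w : R -> distr R) (S : distr R -> R -> R[i]).

(** One choice for all distributions in L^2, so that the function attached to a time t depends only
    on the distribution at t. *)
Lemma L2_realisation : exists S, forall u, inH 0 u -> RF (S u) u.
Proof.
have H (u : distr R) : exists f : R -> R[i], inH 0 u -> RF f u.
  have [iu|niu] := pselect (inH 0 u).
    by have [f hf] := RF_exists iu; exists f.
  by exists (fun=> 0) => /niu.
by have [S hS] := choice H; exists S.
Qed.

(** The chosen representatives need not depend linearly on u, but the difference of two realisations
    realises the difference ([RFB]), and [RF_L2normsq] computes its norm. *)
Lemma contL2_realisation S I w : (forall u, inH 0 u -> RF (S u) u) -> contH 0 I w ->
  contL2 I (fun t => S (w t)).
Proof.
move=> hS cw; have [iw _] := cw; split=> [t It|t It e e0].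
  by have [] := hS _ (iw t It).
have w0 : 0 < 2 * pi :> R by exact: twopi_gt0.
have e1 : 0 < Num.sqrt (e / (2 * pi)) / 2 by rewrite divr_gt0 // sqrtr_gt0 divr_gt0.
have [d d0 hd] := contH_hb cw It e1; exists d => // t' It' td.
have id : inH 0 (dist_sub (w t') (w t)) by apply: inHB; exact: iw.
rewrite (RF_L2normsq id (RFB (hS _ (iw _ It')) (hS _ (iw _ It)))) lte_fin.
have := hn_le (hd t' It' td); have := hn_ge0 0 (dist_sub (w t') (w t)).
have sq : Num.sqrt (e / (2 * pi)) ^+ 2 = e / (2 * pi) by rewrite sqr_sqrtr // divr_ge0 // ltW.
have s0 : 0 < Num.sqrt (e / (2 * pi)) by rewrite sqrtr_gt0 divr_gt0.
move: w0 sq s0; move: (2 * pi : R) => p p0.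
move: (Num.sqrt _) (hn _ _) => x y sq x0 y0 yx.
rewrite mulrC -ltr_pdivlMr // -sq ltr_pXn2r ?nnegrE ?(ltW x0) //; lra.
Qed.

End Realisation.

Theorem theorem4p1 (R : realType) (N : nat) (W : distr R -> distr R)
    (hW : smoothing N W)
    (omega : interval R) (chi : R -> R) (hchi : cutoff omega chi)
    (sigma : R) (hsigma : 3 <= sigma) (M : R) (hM : 0 < M) :
  exists C : R, forall (eps T : R) (v0 : distr R) (v : R -> distr R),
    0 < eps < 1 -> 0 < T -> inH sigma v0 ->
    solution (3 / 2) W chi eps sigma T v0 v ->
    (forall t, 0 <= t <= T -> (Hnorm sigma (v t) <= M%:E)%E) ->
    exists z : nat -> R -> R -> R[i],
      Zpowers 2 eps T v z /\ dt_le T C (Ecap z).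
Proof.
have chi_cont : continuous chi by exact: (@smooth_continuous _ 0 _ (cutoff_smooth hchi)).
have chi_ge0 := cutoff_ge0 hchi.
have [Cc hc] := smooth_fcoef_l1 (cutoff_smooth hchi) (cutoff_periodic hchi).
have [C hC] := uniform_rate hW chi_cont chi_ge0 hc (ltW hM).
have [S hS] := L2_realisation R.
exists C => eps T v0 v he T0 _ sol bnd.
pose c : distr R := fcoef (fun x => (chi x)%:C%C).
have /andP[eps0 _] := he.
have epsn : eps != 0 by rewrite gt_eqF.
have cv : contH 3 `[0, T] v by exact: contH_mono hsigma (solution_cont sol).
have iv t : 0 <= t <= T -> inH 3 (v t) by move=> tT; apply: cv.1; apply/closed_itvP.
have hv t : 0 <= t <= T -> hb 3 (v t) M.
  by move=> tT; apply: (hb_mono hsigma); apply/HnormP; [exact: ltW|exact: bnd].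
(* The right-hand side is rewritten inside the time integrals, where t lies in [0, T] and v t is in
   H^3. *)
have weq : weak_dt T v (fun t => dist_scale (eps^-1)%:C%C (V1 W c eps (v t))).
  move=> phi k tphi; have := solution_eq sol k tphi; congr (_ = _).
  by congr (_ +i* _)%C; apply: eq_Rintegral => t /set_mem /closed_itvP tT;
    rewrite (spatial_partE hW chi_cont epsn (iv t tT)).
have le1 : (0 : R) <= 3 by lra.
have le2 : (0 : R) <= 3 / 2 by lra.
have cv0 := contH_mono le1 cv.
have cv1 := contH_mono le2 (contH_V1 hW hc eps cv).
have cv2 := contH_V2 hW hc eps cv.
(* Indices beyond 2 default to V_2, so that continuity and membership in L^2 hold for every m. *)
pose V m u := if m is m'.+1 then (if m' is 0%N then V1 W c eps u else V2 W c eps u) else u.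
have cV m : contH 0 `[0, T] (fun t => V m (v t)) by case: m => [|[|m]].
have iV m t : 0 <= t <= T -> inH 0 (V m (v t)).
  by move=> tT; apply: (cV m).1; apply/closed_itvP.
have dV m t k : (m < 2)%N -> 0 < t < T ->
    dC (fun x => V m (v x) k) t ((eps^-1)%:C%C * V m.+1 (v t) k).
  case: m => [|[|//]] _ tT; first exact: (deriv_V0 hW hc T0 cv weq k tT).
  exact: (deriv_V1 hW hc T0 cv weq k tT).
exists (fun m t => S (V m (v t))); split.
  split=> [m _|t tT|m m2].
  - exact: contL2_realisation (cV m).
  - exact: RF_fcoef (hS _ (iV 0%N t tT)).
  - apply: (@dC_weak_dt R 0 T (fun t => dist_scale eps%:C%C (V m (v t))) (fun t => V m.+1 (v t))) => //.
    + exact: contH_scale.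
    + move=> t k tT; apply: dC_eq (dC_scale eps%:C%C (dV m t k m2 tT)) _.
      by rewrite mulrA -rmorphM /= mulfV // mul1r.
    + by move=> t tT; rewrite (RF_fcoef (hS _ (iV m t tT))).
    + by move=> t tT; rewrite (RF_fcoef (hS _ (iV m.+1 t tT))).
apply: dt_le_eq (hC eps T v he T0 cv hv weq) => t tT.
rewrite /Ecap !big_ord_recr big_ord0 /= add0r.
have E m := RF_L2normsq (iV m t tT) (hS _ (iV m t tT)).
have := E 2%N; have := E 1%N; have := E 0%N; rewrite /V => -> -> ->.
by rewrite /= -!mulrDr.
Qed.
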